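(* Assume there are constants $0<\delta\le M$ with $-M\le\Delta(t)\le-\delta$ for all $t\in[0,T_1]$, and let $z^*$ be the boundary function with $\mathcal C=\{z>z^*(t)\}$ if $0<\gamma<1$ and $\mathcal C=\{z<z^*(t)\}$ if $\gamma>1$. Then for every $t\in[0,T_1)$: if $\gamma>1$, $$\tilde{\mathbb E}\Big[\int_t^{T_1}e^{\vartheta(u-t)}\big(1+\Delta(u)(\mu^T(u)Z^{t,z^*(t)}(u))^{-\tilde\gamma}\big)1_{\{Z^{t,z^*(t)}(u)<z^*(u)\}}du\Big]=0;$$ if $0<\gamma<1$, the same identity holds with the indicator $1_{\{Z^{t,z^*(t)}(u)>z^*(u)\}}$. In either case $\lim_{t\to T_1-}z^*(t)=(-\Delta(T_1))^{1/\tilde\gamma}\mu^T(T_1)^{-1}$.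
   Context: Setting: a filtered probability space with the usual conditions carrying a standard Brownian motion $B$; $0<T_1<T<\infty$; constants $r,\mu,\sigma,\rho,\mu_w,\sigma_w,\alpha,\beta>0$, $\kappa=(\mu-r)/\sigma$; $\xi(t)=\exp(-\kappa B(t)-(\kappa^2/2+r)t)$, $\xi^t(s)=\xi(s)/\xi(t)$; $\mathcal W^{t,w}(s)=w\exp((\mu_w-\sigma_w^2/2)(s-t)+\sigma_w(B(s)-B(t)))$; $\vartheta=-r+\mu_w-\kappa\sigma_w<0$; $q(s)=(e^{\vartheta(T_1-s)}-1)/\vartheta$; $p^T(s)=\int_s^T e^{(\alpha-\beta-r)(u-s)}du$, $\mu^T=1+\alpha p^T$; $Y^{t,y}(s)=ye^{\rho(s-t)}\xi^t(s)$. Power utilities: $\gamma>0,\gamma\neq1$, $K:[0,T]\to(0,\infty)$ smooth, $U_1(t,x)=x^{1-\gamma}/(1-\gamma)$, $U_2(t,x)=K(t)x^{1-\gamma}/(1-\gamma)$; $\tilde\gamma=(1-\gamma)/\gamma$; $\Delta(t)=(1-K(t)^{1/\gamma})/\tilde\gamma$. $\hat V_i(t,y)=\sup_{c>0}\{U_i(t,c)-y\mu^T(t)c\}$; $\tilde V(t,y)=\mathbb E\int_t^Te^{-\rho(u-t)}\hat V_2(u,Y^{t,y}(u))du$. Measure change: $\mathcal E(t)=\exp(-\frac12(\sigma_w-\kappa)^2t+(\sigma_w-\kappa)B(t))$, $d\tilde{\mathbb P}=\mathcal E(T_1)d\mathbb P$, $\tilde{\mathbb E}$ its expectation. For $z>0$,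 $Z^{t,z}(s)=z\,(Y^{t,1}(s))^{1/(1-\gamma)}(\mathcal W^{t,1}(s))^{\gamma/(1-\gamma)}$. Reduced problem $\tilde w(t,z)=\sup_{\tau}\tilde{\mathbb E}\big[\int_t^\tau e^{\vartheta(u-t)}\hat V_1(u,Z^{t,z}(u))du+e^{\vartheta(\tau-t)}(\tilde V(\tau,Z^{t,z}(\tau))-q(\tau))\big]$ over stopping times $t\le\tau\le T_1$. Continuation region $\mathcal C=\{(t,z)\in[0,T_1)\times(0,\infty):\tilde w(t,z)>\tilde V(t,z)-q(t)\}$. *)

(* Defs.v *)
From HB Require Import structures.
From mathcomp Require Import all_boot all_order all_algebra.
From mathcomp Require Import all_classical all_reals all_analysis.
From mathcomp Require Import normal_distribution.
Set Implicit Arguments. Unset Strict Implicit. Unset Printing Implicit Defensive.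
Import Order.TTheory GRing.Theory Num.Theory.
Import numFieldNormedType.Exports.
Local Open Scope classical_set_scope.
Local Open Scope ring_scope.

Section Stoch.
Context {d : measure_display} {Omega : measurableType d} {R : realType}.

Definition is_filtration (F : R -> set (set Omega)) :=
  [/\ (forall t, sigma_algebra setT (F t)),
      (forall t, F t `<=` measurable) &
      (forall s t, s <= t -> F s `<=` F t)].

(* usual conditions: F 0 contains every subset of a P-null set (so the space is
   complete), and the filtration is right-continuous *)
Definition usual_conditions (P : probability Omega R) (F : R -> set (set Omega)) :=
  (forall N A, measurable N -> P N = 0%E -> A `<=` N -> F 0 A) /\
  (forall t A, (forall s, t < s -> F s A) -> F t A).

(* standard (F,P)-Brownian motion on [0, +oo) : B 0 = 0, continuous paths,
   adapted, and for 0 <= s < t the increment B t - B s is independent of F s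
   and N(0, t - s)-distributed (normal_prob m sd, sd = standard deviation) *)
Definition is_brownian (P : probability Omega R) (F : R -> set (set Omega))
    (B : R -> Omega -> R) :=
  [/\ (forall w, B 0 w = 0),
      (forall w, {within `[0, +oo[, continuous (fun t => B t w)}),
      (forall t V, 0 <= t -> measurable V -> F t [set w | V (B t w)]) &
      (forall s t A V, 0 <= s -> s < t -> F s A -> measurable V ->
         P (A `&` [set w | V (B t w - B s w)]) =
         (P A * normal_prob 0 (Num.sqrt (t - s)) V)%E)].

Definition is_stopping_time (F : R -> set (set Omega)) (tau : Omega -> R) :=
  forall s, F s [set w | tau w <= s].

End Stoch.

Record params (R : realType) := Params {
  p_r : R; p_mu : R; p_sigma : R; p_rho : R; p_muw : R; p_sigmaw : R;
  p_alpha : R; p_beta : R; p_gamma : R; p_T1 : R; p_T : R; p_K : R -> R }.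

Section Model.
Context {d : measure_display} {Omega : measurableType d} {R : realType}.
Variable (p : params R).
Local Notation r := (p_r p).
Local Notation mu := (p_mu p).
Local Notation sigma := (p_sigma p).
Local Notation rho := (p_rho p).
Local Notation muw := (p_muw p).
Local Notation sigmaw := (p_sigmaw p).
Local Notation alpha := (p_alpha p).
Local Notation beta := (p_beta p).
Local Notation gam := (p_gamma p).
Local Notation T1 := (p_T1 p).
Local Notation T := (p_T p).
Local Notation K := (p_K p).

Definition kappa : R := (mu - r) / sigma.
Definition xi (B : R -> Omega -> R) (t : R) (w : Omega) : R :=
  expR (- kappa * B t w - (kappa ^+ 2 / 2 + r) * t).
Definition xit B (t s : R) w : R := xi B s w / xi B t w.
Definition Wproc (B : R -> Omega -> R) (t w0 s : R) (om : Omega) : R :=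
  w0 * expR ((muw - sigmaw ^+ 2 / 2) * (s - t) + sigmaw * (B s om - B t om)).
Definition theta : R := - r + muw - kappa * sigmaw.
Definition qf (s : R) : R := (expR (theta * (T1 - s)) - 1) / theta.
Definition pT (s : R) : R :=
  Rintegral lebesgue_measure `[s, T] (fun u => expR ((alpha - beta - r) * (u - s))).
Definition muT (s : R) : R := 1 + alpha * pT s.
Definition Yproc B (t y s : R) (om : Omega) : R :=
  y * expR (rho * (s - t)) * xit B t s om.
Definition gt : R := (1 - gam) / gam.
Definition Delta (t : R) : R := (1 - K t `^ (1 / gam)) / gt.
Definition U1 (t x : R) : R := x `^ (1 - gam) / (1 - gam).
Definition U2 (t x : R) : R := K t * x `^ (1 - gam) / (1 - gam).
Definition hatV (U : R -> R -> R) (t y : R) : \bar R :=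
  ereal_sup [set x | exists c, 0 < c /\ x = (U t c - y * muT t * c)%:E].
Definition tildeV (P : probability Omega R) B (t y : R) : \bar R :=
  (\int[P]_om (\int[lebesgue_measure]_(u in `[t, T])
       ((expR (- rho * (u - t)))%:E * hatV U2 u (Yproc B t y u om))))%E.
Definition calE B (t : R) (om : Omega) : R :=
  expR (- (1 / 2) * (sigmaw - kappa) ^+ 2 * t + (sigmaw - kappa) * B t om).
(* expectation under tilde P, dtilde P = calE(T1) dP *)
Definition tE (P : probability Omega R) B (X : Omega -> \bar R) : \bar R :=
  (\int[P]_om (X om * (calE B T1 om)%:E))%E.
Definition Zproc B (t z s : R) (om : Omega) : R :=
  z * (Yproc B t 1 s om) `^ (1 / (1 - gam)) * (Wproc B t 1 s om) `^ (gam / (1 - gam)).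
Definition admissible F (t : R) (tau : Omega -> R) :=
  is_stopping_time F tau /\ (forall om, t <= tau om <= T1).
Definition wtilde P F B (t z : R) : \bar R :=
  ereal_sup [set x | exists tau, admissible F t tau /\
    x = tE P B (fun om =>
      (\int[lebesgue_measure]_(u in `[t, tau om])
          ((expR (theta * (u - t)))%:E * hatV U1 u (Zproc B t z u om))
       + (expR (theta * (tau om - t)))%:E *
           (tildeV P B (tau om) (Zproc B t z (tau om) om) - (qf (tau om))%:E))%E)].
Definition inC P F B (t z : R) : Prop :=
  [/\ 0 <= t, t < T1, 0 < z & (tildeV P B t z - (qf t)%:E < wtilde P F B t z)%E].

End Model.

(* Main.v *)
Require Import Defs.
From HB Require Import structures.
From mathcomp Require Import all_boot all_order all_algebra.
From mathcomp Require Import all_classical all_reals all_analysis.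
From mathcomp Require Import normal_distribution measurable_realfun random_variable.
From mathcomp Require Import ring lra.
Import Order.TTheory GRing.Theory Num.Theory.
Import numFieldNormedType.Exports.
Local Open Scope classical_set_scope.
Local Open Scope ring_scope.
Set Implicit Arguments. Unset Strict Implicit. Unset Printing Implicit Defensive.

(** With [tg = (1 - gamma) / gamma], both conjugate utilities and hence the dual value
    are multiples of [y ^ (- tg)], so that under the changed measure the reduced problem
    is the optimal stopping of [F(tau) X_tau - W(tau)] for a geometric Brownian motion
    [X], a multiple of [Z ^ (- tg)]; here [F] and [W] are integrals from [tau] to [T1] of
    positive rates [f] and [w].  Let [G(t, x)] be the gain over stopping at once.  It is
    the least supersolution of a backward recursion over finite sets of exercise dates,
    and comparison with explicit supersolutions gives everything that is needed:
    if [f x < w] then [G > 0]; if [f(T1) x > w(T1)] then [G = 0] near [T1]; and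
    [G(u, x) - E G(u + h, X_(u+h))] is [(w - f x) h + o(h)] where [G > 0], and [o(h)] to
    the right of the first zero of [G(u, .)].  Consequently [e(u) = E G(u, X_u)] is
    Lipschitz with right derivative [- E ((w - f X_u) 1_(G(u, X_u) > 0))].  Started on the
    boundary, [e(t) = e(T1) = 0], and integrating the derivative yields the identity; the
    first two facts enclose the boundary and give its terminal limit. *)

(** * Densities, independence and Gaussian moments *)

(** The derivative of the mean gain is usually obtained from Ito's formula, which needs regularity
    of the value function across the boundary. Here nothing smoother than a Lipschitz bound in space
    and continuity in time is used of [G]; all local estimates come from explicit barriers. The
    difficulty is their order: an error of size h over a step h would change the derivative. Second
    moments alone give errors of that size, so the barriers use the fourth moment of the
    displacement, which is O(h^2); this is why the growth class and the assumed moments stop at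
    degree four. Two obstacles remain. The difference quotient is not controlled at a first zero of
    [G u]: with positive volatility this point carries no mass, but with zero volatility the path is
    constant and may sit on it, so a separate damping argument is needed. And the problem is posed
    over stopping times, while [G] comes from a deterministic recursion; optional stopping on
    refining grids links the two. *)

Section density.
Context d (T : measurableType d) (R : realType) (P : probability T R) (c : T -> R).

(** The three facts are arguments so that the measure and probability instances attach to this very
    term. *)
Definition density_measure (c0 : forall x, 0 <= c x)
    (mc : measurable_fun setT c) (c1 : (\int[P]_x (c x)%:E = 1)%E) :
  set T -> \bar R := fun A => (\int[P]_(x in A) (c x)%:E)%E.

Hypotheses (c0 : forall x, 0 <= c x) (mc : measurable_fun setT c)
  (c1 : (\int[P]_x (c x)%:E = 1)%E).

Let D := density_measure c0 mc c1.

Let D0 : D set0 = 0%E.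
Proof. by rewrite /D /density_measure integral_set0. Qed.

Let D_ge0 A : (0 <= D A)%E.
Proof. by apply: integral_ge0 => x _; rewrite lee_fin. Qed.

Let D_sigma_additive : semi_sigma_additive D.
Proof.
move=> A mA tA mUA; rewrite /D /density_measure ge0_integral_bigcup//=.
- apply: is_cvg_ereal_nneg_natsum_cond => n _ _.
  by apply: integral_ge0 => x _; rewrite lee_fin.
- by apply/measurable_EFinP; exact: measurable_funTS.
- by move=> x _; rewrite lee_fin.
Qed.

HB.instance Definition _ := isMeasure.Build _ _ _
  (density_measure c0 mc c1) D0 D_ge0 D_sigma_additive.

Let D1 : D setT = 1%E. Proof. exact: c1. Qed.

HB.instance Definition _ :=
  @Measure_isProbability.Build _ _ R (density_measure c0 mc c1) D1.

(** The Radon-Nikodym derivative of the new measure agrees almost everywhere with [c], because both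
    have the same integral over every measurable set; a change of variables then gives the
    formula. *)
Lemma ge0_integral_density (f : T -> \bar R) :
  measurable_fun setT f -> (forall x, 0 <= f x)%E ->
  (\int[density_measure c0 mc c1]_x f x = \int[P]_x (f x * (c x)%:E))%E.
Proof.
move=> mf f0.
have dom : density_measure c0 mc c1 `<< P.
  apply/null_content_dominatesP => A mA A0; rewrite /density_measure.
  by apply: null_set_integral => //; apply/measurable_EFinP; exact: measurable_funTS.
have mE : measurable_fun setT (EFin \o c) by exact/measurable_EFinP.
have := @Radon_Nikodym_SigmaFinite.change_of_variables _ _ _
  (density_measure c0 mc c1) P dom f setT f0 measurableT mf.
move=> <-; apply: ae_eq_integral => //.
- apply: emeasurable_funM => //.
  exact: measurable_int (Radon_Nikodym_SigmaFinite.f_integrable dom).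
- exact: emeasurable_funM.
- have : ae_eq P setT (Radon_Nikodym_SigmaFinite.f (density_measure c0 mc c1) P) (EFin \o c).
    apply: integral_ae_eq => //.
      exact: (Radon_Nikodym_SigmaFinite.f_integrable dom).
    by move=> E _ mE'; rewrite -(Radon_Nikodym_SigmaFinite.f_integral dom).
  by apply: filterS => x /= h /h ->.
Qed.

End density.

Lemma exists_density {d} {T : measurableType d} {R : realType} (P : probability T R)
    (c : T -> R) : (forall x, 0 <= c x) -> measurable_fun setT c ->
    (\int[P]_x (c x)%:E = 1)%E ->
  exists Q : probability T R, forall f : T -> \bar R, measurable_fun setT f ->
    (forall x, 0 <= f x)%E -> (\int[Q]_x f x = \int[P]_x (f x * (c x)%:E))%E.
Proof.
move=> c0 mc c1; exists (density_measure c0 mc c1) => f mf f0.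
exact: ge0_integral_density.
Qed.

Section independence.
Context d (Om : measurableType d) (R : realType) d1 d2
  (S : measurableType d1) (U : measurableType d2).
Variables (P : probability Om R) (X : Om -> S) (Y : Om -> U) (nu : probability U R).
Hypotheses (mX : measurable_fun setT X) (mY : measurable_fun setT Y)
  (indep : forall V V', measurable V -> measurable V' ->
     P (X @^-1` V `&` Y @^-1` V') = (P (X @^-1` V) * nu V')%E).

(** The law of the pair agrees on rectangles with the product of the law of [X] and [nu], hence is
    that product; Tonelli does the rest. Only [Y] has a prescribed law, so [X] can collect
    everything known at an earlier time. *)
Lemma ge0_integral_indep (phi : S * U -> \bar R) :
  measurable_fun setT phi -> (forall z, 0 <= phi z)%E ->
  (\int[P]_w phi (X w, Y w) = \int[P]_w \int[nu]_y phi (X w, y))%E.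
Proof.
move=> mphi phi0.
have mXY : measurable_fun setT (fun w => (X w, Y w)) by exact: measurable_fun_pair.
pose X' : {mfun Om >-> S} := HB.pack X (isMeasurableFun.Build _ _ _ _ _ mX).
pose XY : {mfun Om >-> (S * U)%type} :=
  HB.pack (fun w => (X w, Y w)) (isMeasurableFun.Build _ _ _ _ _ mXY).
have E1 : (\int[distribution P XY]_z phi z = \int[P]_w phi (X w, Y w))%E.
  by rewrite ge0_integral_distribution.
have mF := @measurable_fun_fubini_tonelli_F _ _ _ _ R nu phi mphi phi0.
have E2 : (\int[distribution P X']_x \int[nu]_y phi (x, y) =
    \int[P]_w \int[nu]_y phi (X w, y))%E.
  by rewrite ge0_integral_distribution//= => x; exact: integral_ge0.
rewrite -E1 -E2 -(@fubini_tonelli1 _ _ _ _ _ (distribution P X') nu phi mphi phi0).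
apply: eq_measure_integral => A mA _; apply/esym/product_measure_unique => // V V' mV mV'.
Qed.

End independence.
Section normal_moments.
Context {R : realType}.

Lemma normal_prob_set1 (m s a : R) : s != 0 -> normal_prob m s [set a] = 0%E.
Proof.
move=> s0; have /null_content_dominatesP := normal_prob_dominates m s.
by apply => //; exact: lebesgue_measure_set1.
Qed.

Lemma ge0_integral_normal_prob (s : R) (f : R -> \bar R) :
  measurable_fun setT f -> (forall x, 0 <= f x)%E ->
  (\int[normal_prob 0%R s]_x f x =
   \int[lebesgue_measure]_x (f x * (normal_pdf 0 s x)%:E))%E.
Proof.
move=> mf f0; have dom := @normal_prob_dominates R 0 s.
have := @Radon_Nikodym_SigmaFinite.change_of_variables _ _ _
  (normal_prob 0%R s) lebesgue_measure dom f setT f0 measurableT mf.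
move=> <-; apply: ae_eq_integral => //.
- apply: emeasurable_funM => //.
  exact: measurable_int (Radon_Nikodym_SigmaFinite.f_integrable dom).
- apply: emeasurable_funM => //.
  by apply/measurable_EFinP; exact: measurable_normal_pdf.
- have : ae_eq (@lebesgue_measure R) setT
    (Radon_Nikodym_SigmaFinite.f (normal_prob 0%R s) lebesgue_measure)
    (EFin \o normal_pdf 0 s).
    apply: integral_ae_eq => //.
    - exact: (Radon_Nikodym_SigmaFinite.f_integrable dom).
    - by apply/measurable_EFinP; exact: measurable_normal_pdf.
    - by move=> E _ mE'; rewrite -(Radon_Nikodym_SigmaFinite.f_integral dom).
  by apply: filterS => x /= h /h ->.
Qed.

(** Completing the square: tilting the centred density by [expR (k * x)] gives a constant times the
    density with mean [k * s ^+ 2], which has mass one. *)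
Lemma normal_mgf (s k : R) : 0 < s ->
  (\int[normal_prob 0%R s]_x (expR (k * x))%:E = (expR (k ^+ 2 * s ^+ 2 / 2))%:E)%E.
Proof.
move=> s0; have sn0 : s != 0 by rewrite gt_eqF.
rewrite ge0_integral_normal_prob; last 2 first.
- by apply/measurable_EFinP; apply: measurableT_comp => //; exact: measurable_funM.
- by move=> x; rewrite lee_fin expR_ge0.
have E x : ((expR (k * x))%:E * (normal_pdf 0 s x)%:E =
  (expR (k ^+ 2 * s ^+ 2 / 2))%:E * (normal_pdf (k * s ^+ 2) s x)%:E)%E.
  rewrite -!EFinM /normal_pdf (negbTE sn0) /normal_fun; congr EFin.
  rewrite mulrCA [RHS]mulrCA -!expRD; congr (_ * expR _).
  by field.
under eq_integral do rewrite E.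
rewrite ge0_integralZl//=.
- by rewrite integral_normal_pdf mule1.
- by apply/measurable_EFinP; exact: measurable_normal_pdf.
- by move=> x _; rewrite lee_fin normal_pdf_ge0.
Qed.

End normal_moments.

(** * Joint measurability of fields with continuous paths *)

Section joint_measurability.
Context d (Om : measurableType d) (R : realType).

(** Time is rounded down to the grid of mesh 1/(n+1). The rounded field takes countably many time
    values, so its preimages are countable unions of rectangles, and path continuity gives the
    limit. *)
Lemma measurable_fun_joint_continuous (X : R -> Om -> R) :
  (forall t, measurable_fun setT (X t)) -> (forall w, continuous (X ^~ w)) ->
  measurable_fun setT (fun z : R * Om => X z.1 z.2).
Proof.
move=> mX cX.
pose a (n : nat) (t : R) : R := (Num.floor (t * n.+1%:R))%:~R / n.+1%:R.
have n0 n : 0 < n.+1%:R :> R by [].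
have acvg t : a ^~ t @ \oo --> t.
  apply/cvgrPdist_lt => e e0; near=> n.
  have := floor_itv (t * n.+1%:R); rewrite intrD => /andP[h1 h2].
  rewrite /a ger0_norm ?subr_ge0 ?ler_pdivrMr//.
  rewrite ltrBlDr -ltrBlDl -(ltr_pM2r (n0 n)) divfK ?gt_eqF// mulrBl.
  rewrite ltrBlDr (lt_le_trans h2)// lerD2l.
  have : n.+1%:R^-1 < e by near: n; exact: (near_infty_natSinv_lt (PosNum e0)).
  by rewrite -(ltr_pM2r (n0 n)) mulVf ?gt_eqF//; exact: ltW.
apply: (@measurable_fun_cvg _ _ R _ (fun n z => X (a n z.1) z.2)).
  move=> n _ V mV; rewrite setTI.
  have -> : (fun z : R * Om => X (a n z.1) z.2) @^-1` V =
      \bigcup_(k : int) (`[k%:~R / n.+1%:R, (k + 1)%:~R / n.+1%:R[%classic `*`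
        (X (k%:~R / n.+1%:R) @^-1` V)).
    apply/seteqP; split => -[t w] /=.
      move=> Vz; exists (Num.floor (t * n.+1%:R)) => //=; split => //=.
      by rewrite in_itv/= ler_pdivrMr// ltr_pdivlMr// floor_itv.
    move=> [k _ [/=]]; rewrite in_itv/= ler_pdivrMr// ltr_pdivlMr// => h Vk.
    by rewrite /a; move: h; rewrite -floor_eq => /eqP ->.
  apply: countable_bigcupT_measurable => // k.
  apply: measurableX => //.
  by rewrite -[X in measurable X]setTI; exact: mX.
by move=> [t w] _; exact: (cvg_comp _ _ (acvg t) (cX w t)).
Unshelve. all: by end_near. Qed.

End joint_measurability.

(** * Real-valued integrals *)

Section rintegrable.
Context d (T : measurableType d) (R : realType) (mu : {measure set T -> \bar R}).
Implicit Types (f g : T -> R) (D : set T).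

Definition rint D f := mu.-integrable D (EFin \o f).

Lemma rint_measurable D f : rint D f -> measurable_fun D f.
Proof. by move=> /integrableP[/measurable_EFinP]. Qed.

Lemma rintD D f g : measurable D -> rint D f -> rint D g ->
  rint D (fun x => f x + g x).
Proof. by move=> mD i1 i2; have := integrableD mD i1 i2; exact: eq_integrable. Qed.

Lemma rintB D f g : measurable D -> rint D f -> rint D g ->
  rint D (fun x => f x - g x).
Proof. by move=> mD i1 i2; have := integrableB mD i1 i2; exact: eq_integrable. Qed.

Lemma rintZ D c f : measurable D -> rint D f -> rint D (fun x => c * f x).
Proof. by move=> mD i1; have := integrableZl mD c i1; exact: eq_integrable. Qed.

Lemma rintZr D c f : measurable D -> rint D f -> rint D (fun x => f x * c).
Proof.
move=> mD /(rintZ c mD); apply: eq_integrable => // x _ /=.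
by rewrite mulrC.
Qed.

Lemma rint_le D f g : measurable D -> measurable_fun D f ->
  (forall x, D x -> `|f x| <= g x) -> rint D g -> rint D f.
Proof.
move=> mD mf fg ig; apply: le_integrable ig => //; first exact/measurable_EFinP.
move=> x Dx /=; rewrite lee_fin (le_trans (fg _ Dx))//.
by rewrite ler_norm.
Qed.

Lemma rint_norm D f : measurable D -> rint D f -> rint D (fun x => `|f x|).
Proof. by move=> mD /integrable_abse; exact: eq_integrable. Qed.

Lemma rint_ge0_lty D f : measurable D -> measurable_fun D f ->
  (forall x, D x -> 0 <= f x) -> (\int[mu]_(x in D) (f x)%:E < +oo)%E -> rint D f.
Proof.
move=> mD mf f0 h; apply/integrableP; split; first exact/measurable_EFinP.
rewrite (eq_integral (fun x => (f x)%:E))// => x; rewrite inE => Dx /=.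
by rewrite ger0_norm// f0.
Qed.

Lemma EFin_Rintegral D f : measurable D -> rint D f ->
  (\int[mu]_(x in D) (f x)%:E)%E = (\int[mu]_(x in D) f x)%:E.
Proof. by move=> mD fi; rewrite /Rintegral fineK//; exact: integrable_fin_num. Qed.

End rintegrable.

Lemma rint_cst d (T : measurableType d) (R : realType) (mu : {finite_measure set T -> \bar R})
  (D : set T) (c : R) : measurable D -> rint mu D (fun=> c).
Proof. by move=> mD; exact: finite_measure_integrable_cst. Qed.

Lemma rint_bounded d (T : measurableType d) (R : realType) (mu : {finite_measure set T -> \bar R})
  (D : set T) (f : T -> R) (C : R) : measurable D -> measurable_fun D f ->
  (forall x, D x -> `|f x| <= C) -> rint mu D f.
Proof. by move=> mD mf fC; apply: (rint_le mD mf fC); exact: rint_cst. Qed.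

Lemma Rintegral_probability_cst d (T : measurableType d) (R : realType)
  (Q : probability T R) (c : R) : \int[Q]_w c = c.
Proof.
rewrite (Rintegral_cst Q measurableT).
set q := (X in fine X); have -> : q = 1%E by exact: probability_setT.
by rewrite mulr1.
Qed.

Section Rconvergence.
Context d (T : measurableType d) (R : realType) (mu : {measure set T -> \bar R}).
Variables (D : set T) (f_ : nat -> T -> R) (f : T -> R).
Hypotheses (mD : measurable D) (mf_ : forall n, measurable_fun D (f_ n))
  (f_f : forall x, D x -> f_ ^~ x @ \oo --> f x).

Let mf : measurable_fun D f.
Proof. exact: measurable_fun_cvg mf_ f_f. Qed.

Lemma Rintegral_dominated (g : T -> R) : rint mu D g ->
  (forall n x, D x -> `|f_ n x| <= g x) ->
  rint mu D f /\ (\int[mu]_(x in D) f_ n x) @[n --> \oo] --> \int[mu]_(x in D) f x.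
Proof.
move=> ig fg.
have ff : {ae mu, forall x, D x -> (EFin \o f_ n) x @[n --> \oo] --> (EFin \o f) x}.
  by apply: aeW => x Dx /=; apply/fine_cvgP; split; [exact: nearW|exact: f_f].
have gg : {ae mu, forall x n, D x -> (`|(EFin \o f_ n) x| <= (EFin \o g) x)%E}.
  by apply: aeW => x n Dx /=; rewrite lee_fin fg.
have [i1 _ i2] := dominated_convergence mD (fun n => (measurable_EFinP _ _).2 (mf_ n))
  ((measurable_EFinP _ _).2 mf) ff ig gg.
split => //; apply: fine_cvg; rewrite fineK //; exact: integrable_fin_num.
Qed.

(** Integrability of the limit is part of the conclusion: it serves for stopped processes that come
    with bounded means instead of a dominating function. *)
Lemma Rintegral_fatou (c : R) : (forall n x, D x -> 0 <= f_ n x) ->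
  (forall n, rint mu D (f_ n)) -> (forall n, \int[mu]_(x in D) f_ n x <= c) ->
  rint mu D f /\ \int[mu]_(x in D) f x <= c.
Proof.
move=> f0 if_ fc.
have fx0 x : D x -> 0 <= f x.
  move=> Dx; rewrite -(cvg_lim _ (f_f Dx))//; apply: limr_ge.
    exact: cvgP (f_f Dx).
  by apply: nearW => n; exact: f0.
have h : (\int[mu]_(x in D) (f x)%:E <= c%:E)%E.
  have := @fatou _ _ _ mu D mD (fun n => EFin \o f_ n).
  move=> /(_ (fun n => (measurable_EFinP _ _).2 (mf_ n))).
  move=> /(_ (fun n x Dx => f0 n x Dx)).
  have -> : (\int[mu]_(x in D) limn_einf (fun n => (EFin \o f_ n) x))%E =
      (\int[mu]_(x in D) (f x)%:E)%E.
    apply: eq_integral => x; rewrite inE => Dx.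
    have cv : (fun n => (EFin \o f_ n) x) @ \oo --> (f x)%:E.
      by apply/fine_cvgP; split; [exact: nearW|exact: f_f].
    by rewrite is_cvg_limn_einfE; [exact/cvg_lim|exact: cvgP cv].
  move=> /le_trans; apply.
  have -> : (fun n => \int[mu]_(x in D) (EFin \o f_ n) x)%E =
      (fun n => (\int[mu]_(x in D) f_ n x)%:E).
    by apply/funext => n; rewrite -EFin_Rintegral.
  rewrite limn_einf_lim; apply: lime_le; first exact: is_cvg_einfs.
  apply: nearW => n; apply: (@le_trans _ _ (\int[mu]_(x in D) f_ n x)%:E).
    by apply: ereal_inf_lbound; exists n => /=.
  by rewrite lee_fin.
have i : rint mu D f by apply: rint_ge0_lty => //; exact: le_lt_trans h (ltry _).
by split => //; rewrite -lee_fin -EFin_Rintegral.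
Qed.

End Rconvergence.

(** * Lipschitz functions and functions of quartic growth *)

Ltac pos := repeat (first [exact: ler01 | exact: normr_ge0 | exact: sqr_ge0
  | exact: exprn_even_ge0 | exact: expR_ge0 | assumption | by apply: ltW
  | apply: addr_ge0
  | apply: mulr_ge0 | apply: exprn_ge0]).

Definition lip {R : realType} (L : R) (phi : R -> R) :=
  forall x y, `|phi x - phi y| <= L * `|x - y|.

(** Four is the degree of the barrier [R4] below; membership makes means under the kernel finite. *)
Definition quartic {R : realType} (phi : R -> R) :=
  measurable_fun setT phi /\ exists C, forall x, `|phi x| <= C * (1 + x ^+ 4).

Section growth.
Context {R : realType}.
Implicit Types (phi psi : R -> R) (L : R).

Lemma lip_measurable L phi : lip L phi -> measurable_fun setT phi.
Proof.
move=> lp; apply: continuous_measurable_fun => x.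
have L1 : 0 < `|L| + 1 by rewrite ltr_wpDl.
apply/cvgrPdist_le => e e0; near=> y.
apply: (le_trans (lp _ _)).
apply: (@le_trans _ _ ((`|L| + 1) * `|x - y|)).
  by rewrite ler_wpM2r// (le_trans (ler_norm L))// lerDl.
rewrite -ler_pdivlMl//; near: y.
by apply: cvgr_dist_le => //; rewrite mulr_gt0 ?invr_gt0.
Unshelve. all: by end_near. Qed.

Lemma quarticD phi psi : quartic phi -> quartic psi ->
  quartic (fun x => phi x + psi x).
Proof.
move=> [m1 [C1 h1]] [m2 [C2 h2]]; split; first exact: measurable_funD.
exists (C1 + C2) => x; rewrite mulrDl (le_trans (ler_normD _ _))//.
by rewrite lerD.
Qed.

Lemma quarticZ c phi : quartic phi -> quartic (fun x => c * phi x).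
Proof.
move=> [m1 [C1 h1]]; split; first exact: measurable_funM.
by exists (`|c| * C1) => x; rewrite normrM -mulrA ler_wpM2l.
Qed.

Lemma quarticN phi : quartic phi -> quartic (fun x => - phi x).
Proof.
move=> [m1 [C1 h1]]; split; first exact: measurableT_comp.
by exists C1 => x; rewrite normrN.
Qed.

Lemma quarticB phi psi : quartic phi -> quartic psi ->
  quartic (fun x => phi x - psi x).
Proof. by move=> h1 /quarticN; exact: quarticD. Qed.

Lemma quartic_cst c : quartic (fun _ : R => c).
Proof.
split=> //; exists `|c| => x; rewrite -[X in X <= _]mulr1 ler_wpM2l// lerDl.
by rewrite exprn_even_ge0.
Qed.

Lemma normr_le_quartic (x : R) : `|x| <= 1 + x ^+ 4.
Proof.
rewrite -[x ^+ 4](@ger0_norm _) ?normrX; last by rewrite exprn_even_ge0.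
have := normr_ge0 x; set y := `|x| => y0.
have [y1|y1] := lerP y 1; first by rewrite (le_trans y1)// lerDl exprn_ge0.
by rewrite ler_wpDl// -[X in X <= _]expr1 ler_eXn2l.
Qed.

Lemma quartic_lip L phi : lip L phi -> quartic phi.
Proof.
move=> lp; split; first exact: lip_measurable lp.
exists (`|phi 0| + `|L|) => x.
have := lp x 0; rewrite subr0 => h.
have -> : phi x = phi 0 + (phi x - phi 0) by rewrite addrC subrK.
rewrite (le_trans (ler_normD _ _))// mulrDl lerD//.
  rewrite -[X in X <= _]mulr1 ler_wpM2l// lerDl.
  by rewrite exprn_even_ge0.
rewrite (le_trans h)// (@le_trans _ _ (`|L| * `|x|))//.
  by rewrite ler_wpM2r// ler_norm.
by rewrite ler_wpM2l// normr_le_quartic.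
Qed.

Lemma quartic_exp k : (k <= 4)%N -> quartic (fun x : R => x ^+ k).
Proof.
move=> k4; split; first exact: exprn_measurable.
exists 1 => x; rewrite mul1r normrX.
rewrite -[x ^+ 4](@ger0_norm _) ?normrX; last by rewrite exprn_even_ge0.
have := normr_ge0 x; set y := `|x| => y0.
have [y1|y1] := lerP y 1.
  by rewrite ler_wpDr ?exprn_ge0// exprn_ile1.
by rewrite ler_wpDl// ler_eXn2l.
Qed.

Lemma lipD L L' phi psi : lip L phi -> lip L' psi ->
  lip (L + L') (fun x => phi x + psi x).
Proof.
move=> h1 h2 x y; rewrite opprD addrACA mulrDl (le_trans (ler_normD _ _))//.
by rewrite lerD.
Qed.

Lemma lip_affine a b : lip `|b| (fun x : R => a + b * x).
Proof. by move=> x y; rewrite opprD addrACA subrr add0r -mulrBr normrM. Qed.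

Lemma lip_max0 L phi : lip L phi -> lip L (fun x => Num.max 0 (phi x)).
Proof.
move=> h x y; apply: le_trans (h x y).
move: (phi x) (phi y) => a b.
have h1 := ler_norm (a - b); have := ler_norm (b - a); rewrite distrC => h2.
rewrite ler_norml.
by case: (leP 0 a) => h3; case: (leP 0 b) => h4; apply/andP; split; lra.
Qed.

End growth.

(** * Integrals over intervals and a fundamental theorem for Lipschitz functions *)

Section lebesgue_intervals.
Context {R : realType}.
Notation mu := (@lebesgue_measure R).
Implicit Types (f e : R -> R) (a b c h : R).

Lemma rint_continuous f a b : continuous f -> rint mu `[a, b] f.
Proof.
move=> cf; apply: continuous_compact_integrable; first exact: segment_compact.
exact: continuous_subspaceT.
Qed.

Lemma Rintegral_itv_cat f a b c : a <= b -> b <= c -> rint mu `[a, c] f ->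
  \int[mu]_(u in `[a, c]) f u = \int[mu]_(u in `[a, b]) f u + \int[mu]_(u in `[b, c]) f u.
Proof.
move=> ab bc i; rewrite -[X in X = _](subrK (\int[mu]_(u in `[a, b]) f u)) addrC.
congr (_ + _); rewrite (Rintegral_itvB i) ?bnd_simp//.
apply: Rintegral_itv_obnd_cbnd; apply: integrableS i => //.
by apply: subset_itvr; rewrite bnd_simp.
Qed.

Lemma Rintegral_itv_cst a b c : a <= b -> \int[mu]_(u in `[a, b]) c = c * (b - a).
Proof.
move=> ab; rewrite Rintegral_cst//= lebesgue_measure_itv/= lte_fin.
by case: ltP => h //=; rewrite (_ : b - a = 0)//; apply/eqP; rewrite subr_eq0 eq_le ab h.
Qed.

Lemma Rintegral_itv_bound f a b C : a <= b -> rint mu `[a, b] f ->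
  (forall u, a <= u <= b -> `|f u| <= C) ->
  `|\int[mu]_(u in `[a, b]) f u| <= C * (b - a).
Proof.
move=> ab i fC; apply: (le_trans (le_normr_Rintegral _ i)) => //.
rewrite -Rintegral_itv_cst//; apply: le_Rintegral => //.
- exact: rint_norm.
- by apply: rint_continuous => x; exact: cvg_cst.
Qed.

Lemma Rintegral_shift f a b h : a <= b -> continuous f ->
  \int[mu]_(u in `[a, b]) f (u + h) = \int[mu]_(u in `[a + h, b + h]) f u.
Proof.
move=> ab cf; rewrite /Rintegral; congr fine.
have dF (u : R) : is_derive u (1 : R) (fun v : R => v + h : R) (1 : R).
  by apply: is_derive_eq; rewrite addr0.
have F1 : derive1 (fun v : R => v + h : R) = cst (1 : R).
  by apply/funext => u; rewrite derive1E; apply: derive_val.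
rewrite (@integration_by_substitution_increasing _ (fun v => v + h) f a b ab).
- by apply: eq_integral => u _; rewrite F1 /= fctE mulr1.
- by move=> u v _ _; rewrite ltrD2r.
- by rewrite F1 => u _; exact: cvg_cst.
- by rewrite F1; exact: is_cvg_cst.
- by rewrite F1; exact: is_cvg_cst.
- split.
  + by move=> u _; exact: ex_derive.
  + by apply: cvg_at_right_filter; apply: cvgD; [exact: cvg_id|exact: cvg_cst].
  + by apply: cvg_at_left_filter; apply: cvgD; [exact: cvg_id|exact: cvg_cst].
- exact: continuous_subspaceT.
Qed.

Lemma lip_continuous C e : lip C e -> continuous e.
Proof.
move=> le x; have C1 : 0 < `|C| + 1 by rewrite ltr_wpDl.
apply/cvgrPdist_le => eps e0; near=> y.
apply: (le_trans (le _ _)); apply: (@le_trans _ _ ((`|C| + 1) * `|x - y|)).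
  by rewrite ler_wpM2r// (le_trans (ler_norm C))// lerDl.
rewrite -ler_pdivlMl//; near: y.
by apply: cvgr_dist_le => //; rewrite mulr_gt0 ?invr_gt0.
Unshelve. all: by end_near. Qed.

Lemma lip_FTC C e (j : R -> R) a b : 0 <= C -> a <= b -> lip C e ->
  (forall u, a < u < b ->
     (fun n => n.+1%:R * (e (u + n.+1%:R^-1) - e u)) @ \oo --> j u) ->
  rint mu `]a, b[ j /\ \int[mu]_(u in `]a, b[) j u = e b - e a.
Proof.
move=> C0 ab le hj; have ce := lip_continuous le.
pose h n : R := n.+1%:R^-1.
have h0 n : 0 < h n by rewrite invr_gt0.
pose D n u := n.+1%:R * (e (u + h n) - e u).
have cD n : continuous (D n).
  move=> u; apply: cvgMr; apply: cvgB; last exact: ce.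
  apply: (@cvg_comp _ _ _ (fun v : R => v + h n) e _ _ _ _ (ce _)).
  by apply: cvgD; [exact: cvg_id|exact: cvg_cst].
have bD n u : `|D n u| <= C.
  rewrite /D normrM ger0_norm// -ler_pdivlMl//.
  apply: (le_trans (le _ _)); rewrite addrAC subrr add0r (gtr0_norm (h0 n)).
  by rewrite mulrC.
have mab : measurable (`]a, b[%classic : set R) by exact: measurable_itv.
have mD n : measurable_fun `]a, b[ (D n).
  by apply: measurable_funTS; exact: continuous_measurable_fun.
have iC : rint mu `]a, b[ (fun=> C).
  apply: (@integrableS _ _ _ mu `[a, b]) => //; last by apply: rint_continuous => x; exact: cvg_cst.
  exact: subset_itv_oo_cc.
have hj' u : (`]a, b[%classic : set R) u -> (fun n => D n u) @ \oo --> j u.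
  by rewrite /= in_itv/=; exact: hj.
have [ij cj] := @Rintegral_dominated _ _ _ mu `]a, b[%classic D j mab mD hj' (fun=> C) iC (fun n u _ => bD n u).
split => //.
have e1 n : \int[mu]_(u in `]a, b[) D n u =
    n.+1%:R * (\int[mu]_(u in `[b, b + h n]) e u - \int[mu]_(u in `[a, a + h n]) e u).
  have -> : \int[mu]_(u in `]a, b[) D n u = \int[mu]_(u in `[a, b]) D n u.
    by rewrite /Rintegral [in RHS]integral_itv_bndoo//; exact: measurableT_comp.
  have ceh : continuous (fun u => e (u + h n)).
    move=> u; apply: (@cvg_comp _ _ _ (fun v : R => v + h n) e _ _ _ _ (ce _)).
    by apply: cvgD; [exact: cvg_id|exact: cvg_cst].
  have i1 : rint mu `[a, b] (fun u => e (u + h n)) by exact: rint_continuous.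
  have i2 : rint mu `[a, b] e by exact: rint_continuous.
  rewrite RintegralZl//; last exact: rintB.
  rewrite RintegralB// Rintegral_shift//; congr (_ * _).
  have abh : a <= b + h n by rewrite ler_wpDr// ltW.
  have i3 : rint mu `[a, b + h n] e by exact: rint_continuous.
  have bh : b <= b + h n by rewrite lerDl ltW.
  have ah : a <= a + h n by rewrite lerDl ltW.
  have ahb : a + h n <= b + h n by rewrite lerD2r.
  have c1 := Rintegral_itv_cat ab bh i3; have c2 := Rintegral_itv_cat ah ahb i3.
  by rewrite c1 in c2; rewrite -[X in X - _ = _](addKr (\int[mu]_(u in `[a, a + h n]) e u)) -c2; ring.
have e2 c n : `|n.+1%:R * \int[mu]_(u in `[c, c + h n]) e u - e c| <= C * h n.
  have ch : c <= c + h n by rewrite lerDl ltW.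
  have -> : n.+1%:R * \int[mu]_(u in `[c, c + h n]) e u - e c =
      n.+1%:R * \int[mu]_(u in `[c, c + h n]) (e u - e c).
    rewrite RintegralB//; [|exact: rint_continuous|by apply: rint_continuous => x; exact: cvg_cst].
    rewrite Rintegral_itv_cst// addrAC subrr add0r mulrBr; congr (_ - _).
    by rewrite mulrCA mulfV ?mulr1// pnatr_eq0.
  rewrite normrM ger0_norm// -ler_pdivlMl//.
  apply: (le_trans (@Rintegral_itv_bound _ c (c + h n) (C * h n) ch _ _)).
  - by apply: rint_continuous => x; apply: cvgB; [exact: ce|exact: cvg_cst].
  - move=> u /andP[u1 u2]; apply: (le_trans (le _ _)); rewrite ler_wpM2l// ger0_norm ?subr_ge0//.
    by rewrite lerBlDl.
  by rewrite addrAC subrr add0r mulrC -/(h n).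
have h_cvg : h @ \oo --> (0 : R) by exact: cvg_harmonic.
have e3 c : (fun n => n.+1%:R * \int[mu]_(u in `[c, c + h n]) e u) @ \oo --> e c.
  apply/cvgrPdist_le => eps eps0; near=> n.
  rewrite distrC (le_trans (e2 c n))//.
  have : h n <= eps / (C + 1).
    have : `|0 - h n| <= eps / (C + 1).
      by near: n; apply: cvgr_dist_le => //; rewrite divr_gt0// ltr_wpDl.
    by rewrite sub0r normrN (gtr0_norm (h0 n)).
  move=> h3; apply: (le_trans (ler_wpM2l C0 h3)).
  by rewrite mulrCA -[X in _ <= X]mulr1 ler_wpM2l ?(ltW eps0)// ler_pdivrMr ?mul1r ?lerDl// ltr_wpDl.
have e4 : (fun n => \int[mu]_(u in `]a, b[) D n u) @ \oo --> e b - e a.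
  under eq_fun do rewrite e1 mulrBr.
  by apply: cvgB; exact: e3.
exact: cvg_unique cj e4.
Unshelve. all: by end_near. Qed.

End lebesgue_intervals.
(** Clamping to an interval is monotone and does not expand distances. It lets functions that are
    controlled on a time interval be handled as functions on the whole line. *)
Lemma clamp_step {R : realDomainType} (a T s s' : R) : a <= T -> s <= s' ->
  [/\ a <= Num.max a (Num.min s T) <= T, a <= Num.max a (Num.min s' T) <= T,
     Num.max a (Num.min s T) <= Num.max a (Num.min s' T) &
     Num.max a (Num.min s' T) - Num.max a (Num.min s T) <= s' - s].
Proof.
move=> aT ss'.
have mm (u v : R) : u <= v -> Num.max a u <= Num.max a v /\ Num.max a v - Num.max a u <= v - u.
  by rewrite /Num.max => uv; case: (ltP a v); case: (ltP a u); split; lra.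
have nn : Num.min s T <= Num.min s' T /\ Num.min s' T - Num.min s T <= s' - s.
  by rewrite /Num.min; case: (ltP s T); case: (ltP s' T); split; lra.
have [m1 m2] := mm _ _ nn.1.
split=> //; last exact: le_trans m2 nn.2.
- by rewrite le_max lexx ge_max aT ge_min lexx orbT.
- by rewrite le_max lexx ge_max aT ge_min lexx orbT.
Qed.

(** * Tail integrals of a continuous rate *)

Section tail_integrals.
Context {R : realType}.
Notation mu := (@lebesgue_measure R).
Implicit Types (g : R -> R) (a b s t T : R).

Definition tail g T s : R := \int[mu]_(u in `[s, T]) g u.

Lemma tail_TT g T : tail g T T = 0.
Proof. by rewrite /tail set_itv1 Rintegral_set1. Qed.

Lemma tailB g T a b : continuous g -> a <= b -> b <= T ->
  tail g T a - tail g T b = \int[mu]_(u in `[a, b]) g u.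
Proof.
move=> cg ab bT; rewrite /tail (Rintegral_itv_cat ab bT) ?addrK//.
exact: rint_continuous.
Qed.

Lemma tail_slope g T t e : continuous g -> 0 < e -> exists2 eta : R, 0 < eta &
  forall a b, a <= b -> b <= T -> `|a - t| < eta -> `|b - t| < eta ->
    `|tail g T a - tail g T b - g t * (b - a)| <= e * (b - a).
Proof.
move=> cg e0; have /cvgrPdist_le /(_ _ e0) := cg t.
move=> [eta /= eta0 H]; exists eta => // a b ab bT ha hb.
have ig : rint mu `[a, b] g by exact: rint_continuous.
have ic : rint mu `[a, b] (fun=> g t) by apply: rint_continuous => z; exact: cvg_cst.
rewrite tailB// -Rintegral_itv_cst// -RintegralB//.
apply: Rintegral_itv_bound => //.
  by apply: rint_continuous => z; apply: cvgB; [exact: cg|exact: cvg_cst].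
move=> u /andP[au ub]; rewrite distrC; apply: H => /=.
move: ha hb; rewrite !ltr_norml => /andP[ha1 ha2] /andP[hb1 hb2]; apply/andP; split; lra.
Qed.

Lemma tail_bound g T a b C : continuous g -> a <= b -> b <= T ->
  (forall u, a <= u <= b -> 0 <= g u <= C) -> 0 <= tail g T a - tail g T b <= C * (b - a).
Proof.
move=> cg ab bT H; rewrite tailB//; apply/andP; split.
  by apply: Rintegral_ge0 => // u; rewrite /= in_itv/= => /H /andP[].
apply: le_trans (ler_norm _) _; apply: Rintegral_itv_bound => //.
  exact: rint_continuous.
by move=> u /H /andP[h1 h2]; rewrite ger0_norm.
Qed.

Lemma continuous_bounded g a b : continuous g -> a <= b ->
  exists2 C, 0 <= C & forall u, a <= u <= b -> `|g u| <= C.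
Proof.
move=> cg ab; have cn : {within `[a, b], continuous (fun u => `|g u|)}.
  by apply: continuous_subspaceT => u; apply: cvg_norm; exact: cg.
have [m _ Hm] := EVT_max ab cn; by exists `|g m|.
Qed.

Lemma tail_lip g T a : continuous g -> a <= T -> exists2 C, 0 <= C &
  lip C (fun s => tail g T (Num.max a (Num.min s T))).
Proof.
move=> cg aT; have [C C0 HC] := continuous_bounded cg aT; exists C => //.
have key s s' : s <= s' ->
    `|tail g T (Num.max a (Num.min s T)) - tail g T (Num.max a (Num.min s' T))| <= C * `|s - s'|.
  move=> ss'; set u := Num.max a (Num.min s T); set u' := Num.max a (Num.min s' T).
  have [/andP[u1 u2] /andP[u1' u2'] uu' du] :
      [/\ a <= u <= T, a <= u' <= T, u <= u' & u' - u <= s' - s].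
    exact: clamp_step.
  rewrite tailB//; apply: (@le_trans _ _ (C * (u' - u))); last first.
    by rewrite ler_wpM2l// distrC (le_trans du)// ler_norm.
  apply: Rintegral_itv_bound => //; first exact: rint_continuous.
  by move=> v /andP[v1 v2]; apply: HC; rewrite (le_trans u1 v1) (le_trans v2 u2').
move=> s s'; case/orP: (le_total s s') => ss'; first exact: key.
by rewrite distrC [X in _ * X]distrC; exact: key.
Qed.

End tail_integrals.

(** * Convex conjugates of power utilities *)

Section power_conjugate.
Context {R : realType}.
Implicit Types (g k m c : R).

(** With the optimum normalised to [s = 0], tangent bounds [1 + v <= expR v] suffice. For [g < 1]
    the power [m] is the convex combination, with weights [1 - g] and [g], of two quantities bounded
    in this way; for [g > 1] the division by [1 - g] reverses the sign and the bounds apply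
    directly. *)
Lemma expR_conj_le g (s : R) : 0 < g -> g != 1 ->
  expR ((1 - g) * s) / (1 - g) - expR s <= g / (1 - g).
Proof.
move=> g0 g1; have E v : 1 + v <= expR v :> R by exact: expR_ge1Dx.
case: (ltgtP g 1) g1 => // h _.
- have d0 : 0 < 1 - g by rewrite subr_gt0.
  set m := expR ((1 - g) * s); have m0 : 0 < m by exact: expR_gt0.
  have e1 : m * (1 + g * s) <= expR s.
    have -> : expR s = m * expR (g * s) by rewrite /m -expRD; congr expR; ring.
    by rewrite ler_pM2l.
  have e2 : m * (1 - (1 - g) * s) <= 1.
    have mE : m * expR (- ((1 - g) * s)) = 1 by rewrite /m -expRD subrr expR0.
    by rewrite -[leRHS]mE ler_pM2l// E.
  rewrite lerBlDr ler_pdivrMr// mulrDl divfK ?gt_eqF//.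
  have e3 := ler_wpM2l (ltW d0) e1; have e4 := ler_wpM2l (ltW g0) e2.
  have -> : m = (1 - g) * (m * (1 + g * s)) + g * (m * (1 - (1 - g) * s)) by ring.
  lra.
- have d0 : 1 - g < 0 by rewrite subr_lt0.
  have e1 := E ((1 - g) * s); have e2 := E s.
  rewrite lerBlDr ler_ndivrMr// mulrDl divfK ?lt_eqF//.
  have e3 : 0 <= (g - 1) * (expR s - (1 + s)).
    by rewrite mulr_ge0 ?subr_ge0// ltW.
  lra.
Qed.

Lemma power_conjugate g k m : 0 < g -> g != 1 -> 0 < k -> 0 < m ->
  ereal_sup [set v | exists c, 0 < c /\ v = (k * c `^ (1 - g) / (1 - g) - m * c)%:E] =
  (k `^ (1 / g) * m `^ (- ((1 - g) / g)) / ((1 - g) / g))%:E.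
Proof.
move=> g0 g1 k0 m0; have g0' : g != 0 by rewrite gt_eqF.
have g1' : 1 - g != 0 by rewrite subr_eq0 eq_sym.
have kE : k = expR (ln k) by rewrite lnK.
have mE : m = expR (ln m) by rewrite lnK.
move: (ln k) (ln m) kE mE => a e -> -> {k m k0 m0}.
(* [expR s0] is the maximiser (k / m)^(1/g) of the first order condition; [s] below is the
   logarithmic deviation from it. *)
pose s0 := (a - e) / g.
have val s : expR a * expR (s + s0) `^ (1 - g) / (1 - g) - expR e * expR (s + s0) =
    expR (e + s0) * (expR ((1 - g) * s) / (1 - g) - expR s).
  rewrite /powR gt_eqF ?expR_gt0// expRK mulrBr mulrA -!expRD.
  by congr (expR _ / _ - expR _); rewrite /s0; field.
have top : expR (e + s0) * (g / (1 - g)) =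
    expR a `^ (1 / g) * expR e `^ (- ((1 - g) / g)) / ((1 - g) / g).
  rewrite /powR !gt_eqF ?expR_gt0// !expRK -expRD invf_div.
  by congr (expR _ * _); rewrite /s0; field.
apply/eqP; rewrite eq_le; apply/andP; split.
- apply: ub_ereal_sup => v [c [c1 ->]]; rewrite lee_fin -top.
  have -> : c = expR ((ln c - s0) + s0) by rewrite subrK lnK.
  by rewrite val ler_pM2l ?expR_gt0//; exact: expR_conj_le.
- apply: ereal_sup_ubound; exists (expR s0); split; first exact: expR_gt0.
  rewrite -top; congr EFin.
  by have := val 0; rewrite add0r mulr0 expR0 => ->; congr (_ * _); field.
Qed.

End power_conjugate.
(** A bound on the first absolute moments that is uniform in time gives joint integrability over the
    bounded interval. The integrand is extended by zero outside so that Fubini applies on the whole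
    product. *)
Lemma Fubini_itv d (Om : measurableType d) (R : realType) (Q : probability Om R)
    (j : R -> Om -> R) (a b C : R) : a <= b -> 0 <= C ->
  measurable_fun setT (fun z : R * Om => j z.1 z.2) ->
  (forall u, a <= u <= b -> rint Q setT (j u) /\ \int[Q]_om `|j u om| <= C) ->
  Q.-integrable setT (fun om => \int[@lebesgue_measure R]_(u in `[a, b]) (j u om)%:E)%E /\
  (\int[Q]_om \int[@lebesgue_measure R]_(u in `[a, b]) (j u om)%:E =
   \int[@lebesgue_measure R]_(u in `[a, b]) (\int[Q]_om j u om)%:E)%E.
Proof.
set mu := @lebesgue_measure R => ab C0 mj Hj.
pose h (z : Om * R) : R := \1_(`[a, b]%classic) z.2 * j z.2 z.1.
have mI : measurable (`[a, b]%classic : set R) by exact: measurable_itv.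
have mh : measurable_fun setT h.
  apply: measurable_funM; last exact: measurableT_comp mj (@measurable_swap _ _ _ _).
  by apply: measurableT_comp => //; exact: measurable_indic.
have mEh : measurable_fun setT (EFin \o h) by exact/measurable_EFinP.
have hE u om : (h (om, u))%:E = ((fun v => (j v om)%:E) \_ `[a, b]) u.
  by rewrite /h patchE /= indicE; case: ifPn => ut; rewrite ?mul0r ?mul1r.
have GE om : (\int[mu]_u (h (om, u))%:E = \int[mu]_(u in `[a, b]) (j u om)%:E)%E.
  by rewrite [RHS]integral_mkcond; apply: eq_integral => u _; exact: hE.
have uab u : u \in `[a, b]%classic -> a <= u <= b by rewrite inE /= in_itv.
have ih : (Q \x mu)%E.-integrable setT (EFin \o h).
  apply/integrable21ltyP => //=.
  apply: (@le_lt_trans _ _ (\int[mu]_(u in `[a, b]) C%:E)%E); last first.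
    rewrite integral_cst//= lebesgue_measure_itv/= lte_fin.
    by case: ifP => _; rewrite ?mule0 ?ltry// -EFinB -EFinM ltry.
  rewrite [leRHS]integral_mkcond; apply: ge0_le_integral => //.
  - by move=> u _; apply: integral_ge0.
  - have := measurable_fun_fubini_tonelli_G (m1 := Q) (fun z => (`|h z|)%:E).
    apply.
    + by apply/measurable_EFinP; apply: measurableT_comp.
    + by move=> z; exact: normr_ge0.
  - by apply/measurable_restrict => //; apply: measurable_funTS.
  move=> u _; rewrite patchE; case: ifPn => [ut|/negbTE ut].
    have [i1 i2] := Hj _ (uab _ ut).
    apply: (@le_trans _ _ (\int[Q]_om `|j u om|)%:E); last by rewrite lee_fin.
    rewrite -EFin_Rintegral//; last exact: rint_norm.
    rewrite le_eqVlt; apply/orP; left; apply/eqP; apply: eq_integral => om _.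
    by rewrite /h /= indicE ut mul1r.
  rewrite (eq_integral (cst 0%E)) ?integral0// => om _.
  by rewrite /h /= indicE ut mul0r normr0.
split.
  by have := integrable_fubini_F ih; apply: eq_integrable => // om _; rewrite /fubini_F/= GE.
under eq_integral => om _ do rewrite -GE.
have := Fubini ih => /= ->.
rewrite [RHS]integral_mkcond; apply: eq_integral => u _; rewrite patchE; case: ifPn => ut.
  have [i1 _] := Hj _ (uab _ ut).
  rewrite -EFin_Rintegral//; apply: eq_integral => om _.
  by rewrite /h /= indicE ut mul1r.
rewrite (eq_integral (cst 0%E)) ?integral0// => om _.
by rewrite /h /= indicE (negbTE ut) mul0r.
Qed.

Lemma Fubini_weighted d (Om : measurableType d) (R : realType) (Q : probability Om R)
    (k : R -> R) (N : R -> Om -> R) (a b x : R) : a <= b -> continuous k ->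
  measurable_fun setT (fun z : R * Om => N z.1 z.2) -> (forall u om, 0 <= N u om) ->
  (forall u, a <= u <= b -> rint Q setT (N u) /\ \int[Q]_om N u om = x) ->
  Q.-integrable setT (fun om => \int[@lebesgue_measure R]_(u in `[a, b]) (k u * N u om)%:E)%E /\
  (\int[Q]_om \int[@lebesgue_measure R]_(u in `[a, b]) (k u * N u om)%:E =
   (\int[@lebesgue_measure R]_(u in `[a, b]) k u * x)%:E)%E.
Proof.
move=> ab ck mN N0 HN.
have x0 : 0 <= x.
  have aab : a <= a <= b by rewrite lexx.
  have [_ <-] := HN a aab.
  by apply: Rintegral_ge0 => // om _; exact: N0.
have [C C0 HC] := continuous_bounded ck ab.
have ik : rint (@lebesgue_measure R) `[a, b] k by exact: rint_continuous.
have [] := @Fubini_itv _ _ _ Q (fun u om => k u * N u om) a b (C * x) ab.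
- by rewrite mulr_ge0.
- apply: measurable_funM => //; apply: (measurableT_comp _ measurable_fst).
  exact: continuous_measurable_fun.
- move=> u uab; have [i1 i2] := HN u uab; split; first exact: rintZ.
  under eq_Rintegral => om _ do rewrite normrM (ger0_norm (N0 u om)).
  by rewrite RintegralZl// i2 ler_wpM2r// HC.
move=> i1 ->; split=> //; rewrite -RintegralZr// -EFin_Rintegral//; last exact: rintZr.
apply: eq_integral => u; rewrite inE /= in_itv/= => uab; have [i3 i4] := HN u uab.
by rewrite RintegralZl// i4.
Qed.

(** * Filtrations and measurability at a fixed time *)

Section filtration.
Context d (Om : measurableType d) (R : realType) (Fi : R -> set (set Om)).
Hypothesis Fi_filt : is_filtration Fi.
Implicit Types a b e : R.

Lemma Fi_sub a b A : a <= b -> Fi a A -> Fi b A.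
Proof. by case: Fi_filt => _ _ h /h; apply. Qed.

Lemma Fi_meas a A : Fi a A -> measurable A.
Proof. by case: Fi_filt => _ h _; exact: h. Qed.

Lemma FiC a A : Fi a A -> Fi a (~` A).
Proof.
case: Fi_filt => h _ _ hA; have [_ hC _] := h a.
by have := hC _ hA; rewrite setTD.
Qed.

Lemma Fi0 a : Fi a set0.
Proof. by case: Fi_filt => h _ _; have [] := h a. Qed.

Lemma FiT a : Fi a setT.
Proof. by rewrite -setC0; apply: FiC; exact: Fi0. Qed.

Lemma Fi_bigcup a (A : (set Om)^nat) : (forall n, Fi a (A n)) -> Fi a (\bigcup_n A n).
Proof. by case: Fi_filt => h _ _; have [_ _ hU] := h a; exact: hU. Qed.

Lemma FiU a A B : Fi a A -> Fi a B -> Fi a (A `|` B).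
Proof.
move=> hA hB; rewrite -bigcup2E; apply: Fi_bigcup => -[|[|n]] //=; exact: Fi0.
Qed.

Lemma FiI a A B : Fi a A -> Fi a B -> Fi a (A `&` B).
Proof.
by move=> hA hB; rewrite -[A `&` B]setCK setCI; apply/FiC/FiU; exact: FiC.
Qed.

(** Measurability with respect to [Fi a], stated on preimages because [Fi a] is a bare family of
    sets and not the measurable structure of [Om]. *)
Definition Fmeasurable d' (S : measurableType d') a (V : Om -> S) :=
  forall U, measurable U -> Fi a (V @^-1` U).

(** The sets with preimage in [Fi a] form a sigma-algebra, and rectangles belong to it because they
    pull back to intersections. *)
Lemma Fmeasurable_pair d1 d2 (S1 : measurableType d1) (S2 : measurableType d2) a
    (X : Om -> S1) (Y : Om -> S2) :
  Fmeasurable a X -> Fmeasurable a Y -> Fmeasurable a (fun w => (X w, Y w)).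
Proof.
move=> hX hY V mV.
pose C := [set U : set (S1 * S2) | Fi a ((fun w => (X w, Y w)) @^-1` U)].
have sC : sigma_algebra setT C.
  split.
  - by rewrite /C /= preimage_set0; exact: Fi0.
  - by move=> U CU; rewrite /C /= setTD preimage_setC; exact: FiC.
  - by move=> U CU; rewrite /C /= preimage_bigcup; exact: Fi_bigcup.
suff CV : C V by exact: CV.
move: V mV; rewrite measurable_prod_measurableType.
apply: smallest_sub => // _ [A mA [A' mA' <-]].
by rewrite /C /=; apply: FiI => //; [exact: hX|exact: hY].
Qed.

Lemma Fmeasurable_meas d' (S : measurableType d') a (V : Om -> S) :
  Fmeasurable a V -> measurable_fun setT V.
Proof. by move=> hV _ U mU; rewrite setTI; apply: Fi_meas; exact: hV. Qed.

Lemma Fmeasurable_comp d1 d2 (S1 : measurableType d1) (S2 : measurableType d2) a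
    (X : Om -> S1) (g : S1 -> S2) :
  Fmeasurable a X -> measurable_fun setT g -> Fmeasurable a (g \o X).
Proof.
move=> hX mg U mU; rewrite comp_preimage; apply: hX.
by rewrite -[X in measurable X]setTI; exact: mg.
Qed.

Lemma Fmeasurable_sub d' (S : measurableType d') a e (V : Om -> S) :
  a <= e -> Fmeasurable a V -> Fmeasurable e V.
Proof. by move=> ae hV U mU; apply: Fi_sub ae _; exact: hV. Qed.

Lemma Fmeasurable_indic a A : Fi a A -> Fmeasurable a (\1_A : Om -> R).
Proof.
move=> hA U mU; rewrite preimage_indic.
case: ifPn => _; case: ifPn => _ //; [exact: FiT|exact: FiC|exact: Fi0].
Qed.

End filtration.

(** * The stopping recursion *)

Section kernel.
Context d (Om : measurableType d) (R : realType) (Q : probability Om R)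
  (M : R -> Om -> R) (T1 s : R).
Hypotheses (s0 : 0 <= s)
  (mM : forall h, measurable_fun setT (M h)) (M_gt0 : forall h w, 0 < M h w)
  (M_0 : forall w, M 0 w = 1)
  (M_mom : forall (h : R) (k : nat), 0 <= h <= T1 -> (k <= 4)%N ->
     (\int[Q]_w (M h w ^+ k)%:E = (expR (k%:R * (k%:R - 1) / 2 * (s * h)))%:E)%E)
  (M_sg : forall (h k x : R) (phi : R -> R), 0 <= h -> 0 <= k -> h + k <= T1 ->
     measurable_fun setT phi -> (forall y, 0 <= phi y) ->
     (\int[Q]_w (phi (x * M (h + k) w))%:E =
      \int[Q]_w \int[Q]_v (phi (x * M h w * M k v))%:E)%E).
Implicit Types (phi psi : R -> R) (x y : R).

(** Transition operator of the geometric Brownian motion started at [x]. *)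
Definition Pk h phi x : R := \int[Q]_w phi (x * M h w).

Let mxM h x : measurable_fun setT (fun w => x * M h w).
Proof. exact: measurable_funM. Qed.

Lemma integrable_M (h : R) (k : nat) : 0 <= h <= T1 -> (k <= 4)%N ->
  Q.-integrable setT (EFin \o (fun w => M h w ^+ k)).
Proof.
move=> hT k4; apply/integrableP; split.
  by apply/measurable_EFinP; exact: measurable_funX.
under eq_integral do rewrite /= ger0_norm ?exprn_ge0 ?ltW//.
by rewrite M_mom// ltry.
Qed.

Lemma Pk_integrable h phi x : 0 <= h <= T1 -> quartic phi ->
  Q.-integrable setT (EFin \o (fun w => phi (x * M h w))).
Proof.
move=> hT [mp [C hC]].
apply: (@le_integrable _ _ _ _ _ measurableT _
  (EFin \o (fun w => `|C| * 1 + `|C| * x ^+ 4 * M h w ^+ 4))).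
- by apply/measurable_EFinP; apply: measurableT_comp => //.
- move=> w _ /=; rewrite lee_fin (le_trans (hC _))//.
  rewrite [X in _ <= X]ger0_norm; last first.
    by pos.
  rewrite -mulrA -mulrDr exprMn ler_wpM2r ?ler_norm//.
  by pos.
- apply: rintD => //; first exact: rint_cst.
  by apply: rintZ => //; exact: integrable_M.
Qed.

Lemma PkE h phi x : 0 <= h <= T1 -> quartic phi ->
  (Pk h phi x)%:E = (\int[Q]_w (phi (x * M h w))%:E)%E.
Proof.
by move=> hT gp; rewrite /Pk /Rintegral fineK//; apply: integrable_fin_num => //; exact: Pk_integrable.
Qed.

Lemma PkD h phi psi x : 0 <= h <= T1 -> quartic phi -> quartic psi ->
  Pk h (fun y => phi y + psi y) x = Pk h phi x + Pk h psi x.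
Proof. by move=> hT g1 g2; rewrite /Pk RintegralD//; exact: Pk_integrable. Qed.

Lemma PkB h phi psi x : 0 <= h <= T1 -> quartic phi -> quartic psi ->
  Pk h (fun y => phi y - psi y) x = Pk h phi x - Pk h psi x.
Proof. by move=> hT g1 g2; rewrite /Pk RintegralB//; exact: Pk_integrable. Qed.

Lemma PkZ h c phi x : 0 <= h <= T1 -> quartic phi ->
  Pk h (fun y => c * phi y) x = c * Pk h phi x.
Proof. by move=> hT g1; rewrite /Pk RintegralZl//; exact: Pk_integrable. Qed.

Lemma Pk_cst h c x : Pk h (fun=> c) x = c.
Proof. by rewrite /Pk Rintegral_probability_cst. Qed.

Lemma Pk_exp h (k : nat) x : 0 <= h <= T1 -> (k <= 4)%N ->
  Pk h (fun y => y ^+ k) x = x ^+ k * expR (k%:R * (k%:R - 1) / 2 * (s * h)).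
Proof.
move=> hT k4; rewrite /Pk.
under eq_Rintegral do rewrite exprMn.
rewrite RintegralZl//; last exact: integrable_M.
by rewrite /Rintegral M_mom.
Qed.

Lemma Pk_id h x : 0 <= h <= T1 -> Pk h id x = x.
Proof.
move=> hT; have := @Pk_exp h 1 x hT isT.
by rewrite subrr mulr0 !mul0r expR0 mulr1 expr1.
Qed.

Lemma Pk_affine h a b x : 0 <= h <= T1 -> Pk h (fun y => a + b * y) x = a + b * x.
Proof.
move=> hT; rewrite PkD ?Pk_cst ?PkZ ?Pk_id//; [|exact: quartic_cst|].
  exact: (@quartic_exp _ 1).
by apply: quarticZ; exact: (@quartic_exp _ 1).
Qed.

Lemma Pk_le h phi psi x : 0 <= h <= T1 -> quartic phi -> quartic psi -> 0 <= x ->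
  (forall y, 0 <= y -> phi y <= psi y) -> Pk h phi x <= Pk h psi x.
Proof.
move=> hT g1 g2 x0 hh; apply: le_Rintegral => //; try exact: Pk_integrable.
by move=> w _; apply: hh; rewrite mulr_ge0// ltW.
Qed.

Lemma Pk_nincr h phi x y : 0 <= h <= T1 -> quartic phi -> x <= y ->
  (forall a b, a <= b -> phi b <= phi a) -> Pk h phi y <= Pk h phi x.
Proof.
move=> hT g1 xy hh; apply: le_Rintegral => //; try exact: Pk_integrable.
by move=> w _; apply: hh; rewrite ler_wpM2r// ltW.
Qed.

Lemma Pk_ge0 h phi x : (forall y, 0 <= phi y) -> 0 <= Pk h phi x.
Proof. by move=> hh; apply: Rintegral_ge0. Qed.

Lemma Pk_eq h phi psi x : phi =1 psi -> Pk h phi x = Pk h psi x.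
Proof. by move=> e; congr Pk; exact/funext. Qed.

Lemma Pk0 phi x : Pk 0 phi x = phi x.
Proof.
rewrite /Pk; under eq_Rintegral do rewrite M_0 mulr1.
by rewrite Rintegral_probability_cst.
Qed.

(** The constant is preserved because [M h] is positive with mean one. *)
Lemma Pk_lip h L phi : 0 <= h <= T1 -> lip L phi -> lip L (Pk h phi).
Proof.
move=> hT lp x y; have gp := quartic_lip lp.
have ix := Pk_integrable x hT gp; have iy := Pk_integrable y hT gp.
rewrite /Pk -RintegralB//.
have ib := rintB measurableT ix iy.
apply: (le_trans (le_normr_Rintegral measurableT ib)).
have q1 : quartic (fun z : R => (L * `|x - y|) * z ^+ 1) by apply: quarticZ; exact: quartic_exp.
have : Pk h (fun z => (L * `|x - y|) * z ^+ 1) 1 = L * `|x - y|.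
  by rewrite PkZ ?Pk_exp ?expr1n//; [rewrite subrr mulr0 !mul0r expR0 !mulr1|exact: quartic_exp].
move=> <-; apply: le_Rintegral => //.
- exact: rint_norm.
- exact: Pk_integrable.
- move=> w _; apply: (le_trans (lp _ _)).
  by rewrite -mulrBl normrM (gtr0_norm (M_gt0 _ _)) mul1r mulrA.
Qed.

(** [M_sg] is available for nonnegative functions; the positive and negative parts of a Lipschitz
    function are Lipschitz with the same constant. *)
Lemma Pk_semigroup (h k : R) L phi x : 0 <= h -> 0 <= k -> h + k <= T1 -> lip L phi ->
  Pk h (Pk k phi) x = Pk (h + k) phi x.
Proof.
move=> h0 k0 hk lp.
have hT : 0 <= h <= T1 by rewrite h0 (le_trans _ hk)// lerDl.
have kT : 0 <= k <= T1 by rewrite k0 (le_trans _ hk)// lerDr.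
have hkT : 0 <= h + k <= T1 by rewrite addr_ge0.
have sg psi : lip L psi -> (forall y, 0 <= psi y) ->
    Pk h (Pk k psi) x = Pk (h + k) psi x.
  move=> lp' p0; apply/EFin_inj; rewrite !PkE//; last 2 first.
  - exact: quartic_lip lp'.
  - by apply: quartic_lip; exact: Pk_lip lp'.
  rewrite M_sg//; last exact: lip_measurable lp'.
  by apply: eq_integral => w _; rewrite PkE//; exact: quartic_lip lp'.
pose p1 y := Num.max 0 (phi y); pose p2 y := Num.max 0 (- phi y).
have l1 : lip L p1 by exact: lip_max0.
have l2 : lip L p2.
  by apply: lip_max0 => y z; rewrite opprK addrC distrC.
have e y : phi y = p1 y - p2 y by rewrite /p1 /p2; case: leP => h1; case: leP => h2; lra.
have q1 := quartic_lip l1; have q2 := quartic_lip l2.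
rewrite [RHS](Pk_eq _ _ e) PkB// -!sg//; last 2 first.
- by move=> y; rewrite /p2 le_max lexx.
- by move=> y; rewrite /p1 le_max lexx.
rewrite -PkB//.
- by apply: Pk_eq => y; rewrite (Pk_eq _ _ e) PkB.
- exact: quartic_lip (Pk_lip kT l1).
- exact: quartic_lip (Pk_lip kT l2).
Qed.

Lemma quartic_poly (c0 c1 c2 c3 c4 : R) :
  quartic (fun z : R => c0 + c1 * z + c2 * z ^+ 2 + c3 * z ^+ 3 + c4 * z ^+ 4).
Proof.
do 4 (apply: quarticD; last by apply: quarticZ; try exact: quartic_exp; exact: (@quartic_exp _ 1)).
exact: quartic_cst.
Qed.

Lemma Pk_poly h (c0 c1 c2 c3 c4 x : R) : 0 <= h <= T1 ->
  Pk h (fun z => c0 + c1 * z + c2 * z ^+ 2 + c3 * z ^+ 3 + c4 * z ^+ 4) x =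
  c0 + c1 * x + c2 * x ^+ 2 * expR (s * h) + c3 * x ^+ 3 * expR (3 * (s * h)) +
  c4 * x ^+ 4 * expR (6 * (s * h)).
Proof.
move=> hT.
have q n : (n <= 4)%N -> forall c, quartic (fun z : R => c * z ^+ n).
  by move=> n4 c; apply: quarticZ; exact: quartic_exp.
have qa : quartic (fun z : R => c0 + c1 * z) by apply: quartic_lip; exact: lip_affine.
have h2 : 2 * (2 - 1) / 2 = 1 :> R by field.
have h3 : 3 * (3 - 1) / 2 = 3 :> R by field.
have h4 : 4 * (4 - 1) / 2 = 6 :> R by field.
have mon n c : (n <= 4)%N -> Pk h (fun z => c * z ^+ n) x =
    c * (x ^+ n * expR (n%:R * (n%:R - 1) / 2 * (s * h))).
  by move=> n4; rewrite PkZ ?Pk_exp//; exact: quartic_exp.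
rewrite PkD//; [|by do 2 (apply: quarticD; last exact: q)|exact: q].
rewrite PkD//; [|by apply: quarticD; last exact: q|exact: q].
rewrite PkD//; [|exact: q].
by rewrite Pk_affine// !mon// h2 h3 h4 mul1r !mulrA.
Qed.

(** * Second and fourth moments of the displacement *)

Definition Cvar := s * expR (s * T1).

Lemma Cvar_ge0 : 0 <= Cvar. Proof. by rewrite mulr_ge0// expR_ge0. Qed.

Lemma expR_var h : 0 <= h <= T1 -> 0 <= expR (s * h) - 1 <= Cvar * h.
Proof.
move=> /andP[h0 hT]; have sh : 0 <= s * h by rewrite mulr_ge0.
apply/andP; split; first by rewrite subr_ge0 -expR0 ler_expR.
have : 1 - s * h <= expR (- (s * h)) by exact: expR_ge1Dx.
rewrite -(ler_pM2r (expR_gt0 (s * h))) -expRD addNr expR0 => h1.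
have h2 : expR (s * h) <= expR (s * T1) by rewrite ler_expR ler_wpM2l.
rewrite /Cvar; have : s * h * expR (s * h) <= s * h * expR (s * T1) by rewrite ler_wpM2l.
lra.
Qed.

Lemma Pk_sq h x y : 0 <= h <= T1 ->
  Pk h (fun z => (z - y) ^+ 2) x = (x - y) ^+ 2 + x ^+ 2 * (expR (s * h) - 1).
Proof.
move=> hT.
rewrite (@Pk_eq _ _ (fun z => y ^+ 2 + (- (2 * y)) * z + 1 * z ^+ 2 + 0 * z ^+ 3 + 0 * z ^+ 4)).
  by rewrite Pk_poly//; ring.
by move=> z; ring.
Qed.

Lemma quartic_sq y : quartic (fun z : R => (z - y) ^+ 2).
Proof.
have := quartic_poly (y ^+ 2) (- (2 * y)) 1 0 0.
by congr (quartic _); apply/funext => z; ring.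
Qed.

Lemma Pk_sq_le h x y : 0 <= h <= T1 ->
  (x - y) ^+ 2 <= Pk h (fun z => (z - y) ^+ 2) x <= (x - y) ^+ 2 + x ^+ 2 * (Cvar * h).
Proof.
move=> hT; rewrite Pk_sq//; have /andP[h1 h2] := expR_var hT.
by rewrite lerDl lerD2l mulr_ge0 ?sqr_ge0//= ler_wpM2l ?sqr_ge0.
Qed.

(** From |v| <= e + v^2 / e: the free [e] stands in for a square root of the variance and is fixed
    before the step [h] is made small. *)
Lemma Pk_near h L phi x e : 0 <= h <= T1 -> 0 <= L -> lip L phi -> 0 <= x -> 0 < e ->
  `|Pk h phi x - phi x| <= L * (e + x ^+ 2 * (Cvar * h) / e).
Proof.
move=> hT L0 lp x0 e0.
have q1 := quartic_lip lp.
have q2 : quartic (fun z : R => L * e + L / e * (z - x) ^+ 2).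
  by apply: quarticD; [exact: quartic_cst|apply: quarticZ; exact: quartic_sq].
have Le0 : 0 <= L / e by rewrite divr_ge0// ltW.
have E : Pk h (fun z : R => L * e + L / e * (z - x) ^+ 2) x <=
    L * (e + x ^+ 2 * (Cvar * h) / e).
  rewrite PkD ?Pk_cst ?PkZ//; [|exact: quartic_sq|exact: quartic_cst|by apply: quarticZ; exact: quartic_sq].
  have /andP[_] := Pk_sq_le x x hT; rewrite subrr expr0n add0r => h2.
  rewrite mulrDr lerD2l (le_trans (ler_wpM2l Le0 h2))//.
  by rewrite le_eqVlt; apply/orP; left; apply/eqP; ring.
have key z : `|phi z - phi x| <= L * e + L / e * (z - x) ^+ 2.
  apply: (le_trans (lp _ _)); rewrite -mulrA -mulrDr ler_wpM2l//.
  rewrite -(ler_pM2l e0) mulrDr mulrA mulfV ?gt_eqF// mul1r -[(z - x) ^+ 2]real_normK ?num_real//.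
  have := sqr_ge0 (`|z - x| - e); have := normr_ge0 (z - x); nra.
rewrite ler_distl; apply/andP; split.
  rewrite lerBlDr; apply: le_trans (lerD (lexx _) E).
  rewrite -(Pk_cst h (phi x) x) -PkD//.
  apply: Pk_le => //; [exact: quartic_cst|exact: quarticD|].
  by move=> y _; have := key y; rewrite ler_distl => /andP[]; rewrite lerBlDr.
apply: le_trans (lerD (lexx _) E).
rewrite -[X in X + _](Pk_cst h (phi x) x) -PkD//; last exact: quartic_cst.
apply: Pk_le => //; first by apply: quarticD => //; exact: quartic_cst.
by move=> y _; have := key y; rewrite ler_distl => /andP[_].
Qed.

(* [R4 h y x] is [E (x M_h - y)^4]. *)
Definition R4 h y x : R :=
  x ^+ 4 * expR (6 * (s * h)) - 4 * y * x ^+ 3 * expR (3 * (s * h)) +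
  6 * y ^+ 2 * x ^+ 2 * expR (s * h) - 4 * y ^+ 3 * x + y ^+ 4.

Let R4E h y : R4 h y = (fun z => y ^+ 4 + (- (4 * y ^+ 3)) * z +
  (6 * y ^+ 2 * expR (s * h)) * z ^+ 2 + (- (4 * y * expR (3 * (s * h)))) * z ^+ 3 +
  expR (6 * (s * h)) * z ^+ 4).
Proof. by apply/funext => z; rewrite /R4; ring. Qed.

Lemma R4_quartic h y : quartic (R4 h y).
Proof. by rewrite R4E; exact: quartic_poly. Qed.

Lemma R4_0 y x : R4 0 y x = (x - y) ^+ 4.
Proof. by rewrite /R4 !(mulr0, expR0); ring. Qed.

(** The family is closed under the kernel, with times adding up. Hence [fun a => R4 (t1 - a) y]
    solves the backward equation without reward exactly and adds no error when it is part of a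
    barrier. *)
Lemma Pk_R4 h k y x : 0 <= h <= T1 -> Pk h (R4 k y) x = R4 (k + h) y x.
Proof.
move=> hT; rewrite R4E Pk_poly// /R4 !mulrDr !expRD; ring.
Qed.

(** Jensen for the fourth power, with the tangent line made explicit: the difference is a square
    times a sum of squares. *)
Lemma R4_ge h y x : 0 <= h <= T1 -> 0 <= x -> (x - y) ^+ 4 <= R4 h y x.
Proof.
move=> hT x0; rewrite -[h]add0r -Pk_R4//.
have q : quartic (fun z => ((x - y) ^+ 4 - 4 * (x - y) ^+ 3 * x) + 4 * (x - y) ^+ 3 * z).
  by apply: quartic_lip; exact: lip_affine.
have : Pk h (fun z => ((x - y) ^+ 4 - 4 * (x - y) ^+ 3 * x) + 4 * (x - y) ^+ 3 * z) x
   <= Pk h (R4 0 y) x.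
  apply: Pk_le => //; first exact: R4_quartic.
  move=> z _; rewrite R4_0 -subr_ge0.
  have -> : (z - y) ^+ 4 - ((x - y) ^+ 4 - 4 * (x - y) ^+ 3 * x + 4 * (x - y) ^+ 3 * z) =
    (z - x) ^+ 2 * (((z - y) + (x - y)) ^+ 2 + 2 * (x - y) ^+ 2) by ring.
  by rewrite mulr_ge0 ?sqr_ge0// addr_ge0 ?sqr_ge0// mulr_ge0 ?sqr_ge0.
by rewrite Pk_affine//; apply: le_trans; rewrite le_eqVlt; apply/orP; left; apply/eqP; ring.
Qed.

Lemma R4_ge0 h y x : 0 <= h <= T1 -> 0 <= x -> 0 <= R4 h y x.
Proof. by move=> hT x0; apply: le_trans (R4_ge y hT x0); rewrite exprn_even_ge0. Qed.

Definition C4 := Cvar ^+ 2 * (6 * expR (s * T1) ^+ 4).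

Lemma C4_ge0 : 0 <= C4.
Proof. by rewrite mulr_ge0 ?sqr_ge0// mulr_ge0// exprn_ge0// expR_ge0. Qed.

(** On the diagonal the fourth moment has the factor [(expR (s * h) - 1) ^+ 2], which is O(h^2).
    This is what makes the error terms of the barriers negligible against [h]. *)
Lemma R4_diag h y : 0 <= h <= T1 -> R4 h y y <= C4 * h ^+ 2 * y ^+ 4.
Proof.
move=> hT; have /andP[h0 hT'] := hT; have /andP[v0 v1] := expR_var hT.
have -> : R4 h y y = (expR (s * h) - 1) ^+ 2 *
    (expR (s * h) ^+ 4 + 2 * expR (s * h) ^+ 3 + 3 * expR (s * h) ^+ 2 - 3) * y ^+ 4.
  rewrite /R4 !expRM_natl; ring.
rewrite ler_wpM2r ?exprn_even_ge0//.
have E0 := expR_ge0 (s * h).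
have E1 : 1 <= expR (s * h) by lra.
have Em : expR (s * h) <= expR (s * T1) by rewrite ler_expR ler_wpM2l.
set E := expR (s * h) in v0 v1 E0 E1 Em *; set m := expR (s * T1) in Em *.
have m4 : E ^+ 4 <= m ^+ 4 by rewrite lerXn2r// ?nnegrE// (le_trans E0).
have e3 : E ^+ 3 <= E ^+ 4 by rewrite ler_weXn2l.
have e2 : E ^+ 2 <= E ^+ 4 by rewrite ler_weXn2l.
have p0 : 0 <= E ^+ 4 + 2 * E ^+ 3 + 3 * E ^+ 2 - 3.
  have : 1 <= E ^+ 4 by rewrite exprn_ege1.
  have : 1 <= E ^+ 3 by rewrite exprn_ege1.
  have : 1 <= E ^+ 2 by rewrite exprn_ege1.
  lra.
have sq : (E - 1) ^+ 2 <= Cvar ^+ 2 * h ^+ 2.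
  by rewrite -exprMn lerXn2r// nnegrE// mulr_ge0// Cvar_ge0.
have -> : C4 * h ^+ 2 = (Cvar ^+ 2 * h ^+ 2) * (6 * m ^+ 4) by rewrite /C4 -/m; ring.
by apply: (ler_pM (sqr_ge0 _) p0 sq); lra.
Qed.

(** * The gain over finite sets of exercise dates *)

Variables (W F w f : R -> R) (CW CF : R).
Hypotheses (T1_gt0 : 0 < T1)
  (W_lip : forall a b, 0 <= a -> a <= b -> b <= T1 -> 0 <= W a - W b <= CW * (b - a))
  (F_lip : forall a b, 0 <= a -> a <= b -> b <= T1 -> 0 <= F a - F b <= CF * (b - a))
  (W_T1 : W T1 = 0) (F_T1 : F T1 = 0) (CF_ge0 : 0 <= CF) (CW_ge0 : 0 <= CW).

Implicit Types (a b : R).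

(** As the process is a martingale, this is the mean gain of stopping at [b] rather than at [a]: [W]
    is saved and [F * x] is lost. *)
Definition rw a b x : R := (W a - W b) - (F a - F b) * x.

(** The gain over stopping at [a], when stopping is allowed at [a] and at the dates in the list.
    Subtracting the immediate payoff makes stopping worth zero at every date. *)
Fixpoint Vb (l : seq R) (a x : R) : R :=
  if l is b :: l' then Num.max 0 (rw a b x + Pk (b - a) (Vb l' b) x) else 0.

Fixpoint okl (a : R) (l : seq R) : Prop :=
  if l is b :: l' then [/\ a <= b, b <= T1 & okl b l'] else True.

Definition G a x : R := sup [set y | exists2 l, okl a l & y = Vb l a x].

Lemma rw_add a b c x : rw a b x + rw b c x = rw a c x.
Proof. by rewrite /rw; ring. Qed.

Lemma rw_affine a b x : rw a b x = (W a - W b) + (- (F a - F b)) * x.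
Proof. by rewrite /rw; ring. Qed.

Lemma Pk_rw h a b x : 0 <= h <= T1 -> Pk h (rw a b) x = rw a b x.
Proof.
move=> hT; rewrite (Pk_eq _ _ (rw_affine a b)) Pk_affine//.
by rewrite -rw_affine.
Qed.

Lemma F_ge0 a : 0 <= a -> a <= T1 -> 0 <= F a.
Proof. by move=> a0 aT; have := F_lip a0 aT (lexx _); rewrite F_T1 subr0 => /andP[]. Qed.

Lemma W_ge0 a : 0 <= a -> a <= T1 -> 0 <= W a.
Proof. by move=> a0 aT; have := W_lip a0 aT (lexx _); rewrite W_T1 subr0 => /andP[]. Qed.

Lemma F_le a b : 0 <= a -> a <= b -> b <= T1 -> F b <= F a.
Proof. by move=> a0 ab bT; have := F_lip a0 ab bT; rewrite subr_ge0 => /andP[]. Qed.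

Lemma lip_rw a b : 0 <= a -> a <= b -> b <= T1 -> lip (F a - F b) (rw a b).
Proof.
move=> a0 ab bT x y; rewrite !rw_affine; have := lip_affine (W a - W b) (- (F a - F b)) x y.
have -> // : `|- (F a - F b)| = F a - F b by rewrite normrN ger0_norm// subr_ge0 F_le.
Qed.

Lemma rw_le_W a b x : 0 <= a -> a <= b -> b <= T1 -> 0 <= x -> rw a b x <= W a - W b.
Proof. by move=> a0 ab bT x0; rewrite lerBlDr lerDl mulr_ge0// subr_ge0 F_le. Qed.

Lemma rw_ge_F a b x : 0 <= a -> a <= b -> b <= T1 -> - ((F a - F b) * x) <= rw a b x.
Proof. by move=> a0 ab bT; rewrite /rw; have /andP[] := W_lip a0 ab bT; lra. Qed.

Lemma subT a b : 0 <= a -> a <= b -> b <= T1 -> 0 <= b - a <= T1.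
Proof. by move=> *; lra. Qed.

Lemma Vb_ge0 l a x : 0 <= Vb l a x.
Proof. by case: l => [|b l] //=; rewrite le_max lexx. Qed.

(** The constants telescope: [F a - F b] from the reward and [F b] from the continuation. The sum
    depends on the starting time alone, so the bound survives the supremum over lists. *)
Lemma Vb_lip l a : 0 <= a -> a <= T1 -> okl a l -> lip (F a) (Vb l a).
Proof.
elim: l a => [|b l IH] a a0 aT /=.
  by move=> _ x y; rewrite subrr normr0 mulr_ge0// F_ge0.
move=> [ab bT ol]; apply: lip_max0.
have -> : F a = (F a - F b) + F b by rewrite subrK.
apply: lipD; first exact: lip_rw.
by apply: Pk_lip; [exact: subT|apply: IH => //; lra].
Qed.

Lemma Vb_quartic l a : 0 <= a -> a <= T1 -> okl a l -> quartic (Vb l a).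
Proof. by move=> a0 aT ol; exact: quartic_lip (Vb_lip a0 aT ol). Qed.

Lemma Vb_le_W l a x : 0 <= a -> a <= T1 -> okl a l -> 0 <= x -> Vb l a x <= W a.
Proof.
elim: l a x => [|b l IH] a x a0 aT /=; first by move=> _ _; exact: W_ge0.
move=> [ab bT ol] x0; have b0 : 0 <= b by lra.
rewrite ge_max W_ge0//=.
have -> : W a = (W a - W b) + W b by rewrite subrK.
apply: lerD; first exact: rw_le_W.
rewrite -(Pk_cst (b - a) (W b) x); apply: Pk_le => //; [exact: subT|exact: Vb_quartic|exact: quartic_cst|].
by move=> y y0; exact: IH.
Qed.

Lemma Vb_nincr l a x y : 0 <= a -> a <= T1 -> okl a l -> x <= y -> Vb l a y <= Vb l a x.
Proof.
elim: l a x y => [|b l IH] a x y a0 aT //= [ab bT ol] xy; have b0 : 0 <= b by lra.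
have : rw a b y + Pk (b - a) (Vb l b) y <= rw a b x + Pk (b - a) (Vb l b) x.
  apply: lerD; first by rewrite /rw lerD2l lerN2 ler_wpM2l// subr_ge0 F_le.
  apply: Pk_nincr => //; [exact: subT|exact: Vb_quartic|].
  by move=> u v uv; exact: IH.
by rewrite ge_max le_max lexx /= le_max orbC => ->.
Qed.

Lemma Vb_le_abs l a x : 0 <= a -> a <= T1 -> okl a l -> Vb l a x <= W a + F a * `|x|.
Proof.
move=> a0 aT ol; have := Vb_lip a0 aT ol x 0; rewrite subr0 ler_distl => /andP[_ h].
by rewrite (le_trans h)// lerD2r Vb_le_W.
Qed.

Lemma G_has_sup a x : 0 <= a -> a <= T1 -> has_sup [set y | exists2 l, okl a l & y = Vb l a x].
Proof.
move=> a0 aT; split; first by exists 0; exists [::].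
by exists (W a + F a * `|x|) => _ [l ol ->]; exact: Vb_le_abs.
Qed.

Lemma G_ub l a x : 0 <= a -> a <= T1 -> okl a l -> Vb l a x <= G a x.
Proof. by move=> a0 aT ol; apply: sup_upper_bound; [exact: G_has_sup|exists l]. Qed.

Lemma G_le a x c : (forall l, okl a l -> Vb l a x <= c) -> G a x <= c.
Proof. by move=> h; apply: sup_le_ub; [exists 0; exists [::]|move=> _ [l ol ->]; exact: h]. Qed.

Lemma G_ge0 a x : 0 <= a -> a <= T1 -> 0 <= G a x.
Proof. by move=> a0 aT; exact: (@G_ub [::]). Qed.

Lemma G_le_W a x : 0 <= a -> a <= T1 -> 0 <= x -> G a x <= W a.
Proof. by move=> a0 aT x0; apply: G_le => l ol; exact: Vb_le_W. Qed.

Lemma G_T1_eq0 x : 0 <= x -> G T1 x = 0.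
Proof.
move=> x0; have T0 := ltW T1_gt0; apply/eqP; rewrite eq_le G_ge0// andbT.
by rewrite -W_T1 G_le_W.
Qed.

Lemma G_nincr a x y : 0 <= a -> a <= T1 -> x <= y -> G a y <= G a x.
Proof.
move=> a0 aT xy; apply: G_le => l ol; apply: (le_trans (Vb_nincr a0 aT ol xy)).
exact: G_ub.
Qed.

Lemma G_lip a : 0 <= a -> a <= T1 -> lip (F a) (G a).
Proof.
move=> a0 aT x y; have key u v : G a u <= G a v + F a * `|u - v|.
  apply: G_le => l ol; have := Vb_lip a0 aT ol u v; rewrite ler_distl => /andP[_ h].
  by rewrite (le_trans h)// lerD2r G_ub.
by rewrite ler_distl; apply/andP; split; [rewrite lerBlDr distrC|]; exact: key.
Qed.

Lemma G_quartic a : 0 <= a -> a <= T1 -> quartic (G a).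
Proof. by move=> a0 aT; exact: quartic_lip (G_lip a0 aT). Qed.

(* [G] is the least supersolution; every bound on [G] below is obtained by
   exhibiting a supersolution on a window [a0, t0]. *)
Lemma G_comparison (phi : R -> R -> R) (a0 t0 : R) :
  0 <= a0 -> a0 <= t0 -> t0 <= T1 ->
  (forall a x, a0 <= a -> a <= t0 -> 0 <= x -> 0 <= phi a x) ->
  (forall a, a0 <= a -> a <= t0 -> quartic (phi a)) ->
  (forall a b x, a0 <= a -> a <= b -> b <= t0 -> 0 <= x ->
     rw a b x + Pk (b - a) (phi b) x <= phi a x) ->
  (forall x, 0 <= x -> G t0 x <= phi t0 x) ->
  forall a x, a0 <= a -> a <= t0 -> 0 <= x -> G a x <= phi a x.
Proof.
move=> a00 at0 tT p0 pq psup pt a x; move=> ha hat hx; apply: G_le => l.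
elim: l a x ha hat hx => [|b l IH] a x ha hat x0 /=; first by move=> _; exact: p0.
move=> [ab bT ol]; have a'0 : 0 <= a by lra.
have b0 : 0 <= b by lra. have t00 : 0 <= t0 by lra.
rewrite ge_max p0//=.
have [bt|tb] := leP b t0.
  apply: le_trans (psup a b x ha ab bt x0); rewrite lerD2l.
  apply: Pk_le => //; [exact: subT|exact: Vb_quartic|by apply: pq => //; lra|].
  by move=> y y0; apply: IH => //; lra.
(* A step across [t0] is cut at [t0]. From there on it is a date list at time [t0], so it is bounded
   by [G t0] and thus by [phi t0]. *)
apply: le_trans (psup a t0 x ha hat (lexx _) x0).
rewrite -(rw_add a t0 b) -addrA lerD2l.
have -> : b - a = (t0 - a) + (b - t0) by ring.
have lV := Vb_lip b0 bT ol.
have hTa : 0 <= t0 - a <= T1 by apply/andP; split; lra.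
have hTb : 0 <= b - t0 <= T1 by apply/andP; split; lra.
rewrite -(@Pk_semigroup (t0 - a) (b - t0) (F b))//; [|lra|lra|lra].
rewrite -(Pk_rw t0 b x hTa) -PkD//; last 2 first.
- by apply: quartic_lip (lip_rw _ _ _) => //; exact: ltW.
- exact: quartic_lip (Pk_lip hTb lV).
apply: Pk_le => //.
- apply: quarticD; first by apply: quartic_lip (lip_rw _ _ _) => //; exact: ltW.
  exact: quartic_lip (Pk_lip hTb lV).
- by apply: pq => //; lra.
move=> y y0; apply: le_trans (pt y y0).
have ok' : okl t0 (b :: l) by split => //; exact: ltW.
by apply: le_trans (G_ub y t00 tT ok'); rewrite /= le_max lexx orbT.
Qed.

(* Value of the scheme on the grid [l] when, at an intermediate time, one must wait
   until the next grid point before stopping. *)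
Fixpoint Wc (l : seq R) (a x : R) : R :=
  if l is b :: l' then
    if a <= b then rw a b x + Pk (b - a) (Vb l' b) x else Wc l' a x
  else 0.

Fixpoint finegrid (D a : R) (l : seq R) : Prop :=
  if l is b :: l' then [/\ a <= b, b <= T1, b - a <= D & finegrid D b l'] else a = T1.

Lemma finegrid_okl D a l : finegrid D a l -> okl a l.
Proof. by elim: l a => [//|b l IH] a [ab bT _ /IH]. Qed.

Lemma Wc_lip D o l a : 0 <= o -> finegrid D o l -> o <= a -> a <= T1 ->
  lip (F a) (Wc l a).
Proof.
elim: l o a => [|b l IH] o a o0 /=.
  by move=> oT oa aT x y; rewrite subrr normr0 mulr_ge0// F_ge0//; lra.
move=> [ob bT _ fl] oa aT; have [ab|ba] := leP a b.
  have -> : F a = (F a - F b) + F b by rewrite subrK.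
  apply: lipD; first by apply: lip_rw => //; lra.
  apply: Pk_lip; first by apply: subT => //; lra.
  by apply: Vb_lip => //; [lra|exact: finegrid_okl fl].
by apply: IH fl _ _ => //; lra.
Qed.

(** Being forced to wait until the next grid point costs at most the loss of [F * x] over one mesh
    width. *)
Lemma Wc_ge D o l a x : 0 <= o -> 0 <= D -> finegrid D o l -> o <= a -> a <= T1 ->
  0 <= x -> - (CF * D * x) <= Wc l a x.
Proof.
move=> o0 D0; elim: l o o0 => [|b l IH] o o0 /=.
  by move=> _ _ _ x0; rewrite oppr_le0 mulr_ge0// mulr_ge0.
move=> [ob bT bD fl] oa aT x0; have [ab|ba] := leP a b; last first.
  by apply: IH fl _ _ _ => //; lra.
have a0 : 0 <= a by lra.
have := rw_ge_F x a0 ab bT; have /andP[_] := F_lip a0 ab bT.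
have : 0 <= Pk (b - a) (Vb l b) x by apply: Pk_ge0 => y; exact: Vb_ge0.
move=> h1 h2 h3.
have h4 : CF * (b - a) <= CF * D by rewrite ler_wpM2l//; lra.
have : (F a - F b) * x <= CF * D * x by rewrite ler_wpM2r//; lra.
lra.
Qed.

(** Between grid points nothing is decided and the semigroup law gives equality. When a grid point
    is crossed, the value [Vb] there is at least that of waiting on. *)
Lemma Wc_super D o l a b x : 0 <= o -> finegrid D o l -> o <= a -> a <= b -> b <= T1 ->
  0 <= x -> rw a b x + Pk (b - a) (Wc l b) x <= Wc l a x.
Proof.
elim: l o a x => [|c l IH] o a x o0 /=.
  move=> oT oa ab bT x0; have -> : a = T1 by lra.
  have -> : b = T1 by lra.
  by rewrite Pk_cst addr0 /rw !subrr mul0r subrr.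
move=> [oc cT _ fl] oa ab bT x0; have a0 : 0 <= a by lra.
have b0 : 0 <= b by lra. have c0 : 0 <= c by lra.
have ol := finegrid_okl fl; have lV := Vb_lip c0 cT ol.
have hab : 0 <= b - a <= T1 by exact: subT.
have [bc|cb] := leP b c.
  have ac : a <= c by lra.
  have hbc : 0 <= c - b <= T1 by exact: subT.
  rewrite ac PkD//; last 2 first.
  - exact: quartic_lip (lip_rw _ _ _).
  - exact: quartic_lip (Pk_lip hbc lV).
  rewrite Pk_rw// addrA rw_add (@Pk_semigroup (b - a) (c - b) (F c))//; [|lra|lra|lra].
  by have -> : b - a + (c - b) = c - a by ring.
have [ac|ca] := leP a c; last by apply: IH fl _ _ _ _ => //; lra.
have cb' := ltW cb.
have hac : 0 <= c - a <= T1 by exact: subT.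
have hcb : 0 <= b - c <= T1 by exact: subT.
have lW : lip (F b) (Wc l b) by exact: (Wc_lip c0 fl).
rewrite -(rw_add a c b) -addrA lerD2l.
have -> : b - a = (c - a) + (b - c) by ring.
rewrite -(@Pk_semigroup (c - a) (b - c) (F b))//; [|lra|lra|lra].
rewrite -(Pk_rw c b x hac) -PkD//; last 2 first.
- exact: quartic_lip (lip_rw _ _ _).
- exact: quartic_lip (Pk_lip hcb lW).
apply: Pk_le => //; [|exact: quartic_lip lV|].
  by apply: quarticD; [exact: quartic_lip (lip_rw _ _ _)|exact: quartic_lip (Pk_lip hcb lW)].
move=> y y0; apply: (le_trans (IH c c y c0 fl (lexx _) cb' bT y0)).
by case: l fl {IH ol lV lW} => [//|e l'] /= [ce _ _ _]; rewrite ce le_max lexx orbT.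
Qed.

(** Adding [CF * D * x], which the kernel fixes, makes [Wc] nonnegative and hence a supersolution
    for [G_comparison]. One fine grid is therefore optimal up to this error, for all starting points
    at once. *)
Lemma G_le_grid D o l x : 0 <= o -> o <= T1 -> 0 <= D -> finegrid D o l -> 0 <= x ->
  G o x <= Vb l o x + CF * D * x.
Proof.
move=> o0 oT D0 fl x0.
have q a : o <= a -> a <= T1 -> quartic (Wc l a).
  by move=> oa aT; exact: quartic_lip (Wc_lip o0 fl oa aT).
have qx : quartic (fun y : R => CF * D * y) by apply: quarticZ; exact: (@quartic_exp _ 1).
have := @G_comparison (fun a x => Wc l a x + CF * D * x) o T1 o0 oT (lexx _) _ _ _ _ o x
  (lexx _) oT x0.
move=> h; apply: le_trans (h _ _ _ _) _.
- by move=> a y oa aT y0; have := Wc_ge o0 D0 fl oa aT y0; lra.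
- by move=> a oa aT; apply: quarticD => //; exact: q.
- move=> a b y oa ab bT y0; have oa' : 0 <= a by lra.
  have hab := subT oa' ab bT.
  rewrite PkD//; last by apply: q; lra.
  rewrite PkZ ?Pk_id//; last exact: (@quartic_exp _ 1).
  by have := Wc_super o0 fl oa ab bT y0; lra.
- by move=> y y0; rewrite G_T1_eq0//; have := Wc_ge o0 D0 fl oT (lexx _) y0; lra.
rewrite lerD2r; case: l fl {q h} => [//|e l'] /= [ce _ _ _].
by rewrite ce le_max lexx orbT.
Qed.

Lemma finegrid_exists o (n : nat) : 0 <= o -> o <= T1 ->
  exists l, finegrid ((T1 - o) / n.+1%:R) o l.
Proof.
move=> o0 oT; set D := (T1 - o) / n.+1%:R.
have D0 : 0 <= D by rewrite divr_ge0// subr_ge0.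
have : o + n.+1%:R * D = T1 by rewrite mulrC divfK ?pnatr_eq0// addrC subrK.
clearbody D => {o0 oT}; elim: n.+1 o => [|m IH] o oD.
  by exists [::]; rewrite /= -oD mul0r addr0.
have [|l hl] := IH (o + D).
  by rewrite -oD -natr1; ring.
have mD : 0 <= m%:R * D by rewrite mulr_ge0.
exists (o + D :: l); split => //; [lra| |lra].
by rewrite -oD -natr1 mulrDl mul1r; lra.
Qed.

Lemma le_by_inv (A B C : R) : (forall n : nat, A <= B + C / n.+1%:R) -> A <= B.
Proof.
move=> h; apply/ler_addgt0Pr => e e0.
have [C0|C0] := leP C 0.
  have := h 0%N; rewrite divr1; lra.
have [n hn] : exists n : nat, C / e < n.+1%:R.
  exists (Num.truncn (C / e)); exact: truncnS_gt.
apply: (le_trans (h n)); rewrite lerD2l ler_pdivrMr//.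
by move: hn; rewrite ltr_pdivrMr// mulrC => /ltW.
Qed.

(** A supremum has to be moved through the kernel. As one grid at time [b] is nearly optimal for all
    starting points, [G b] is replaced by a single [Vb], with an error that vanishes with the
    mesh. *)
Lemma G_super a b x : 0 <= a -> a <= b -> b <= T1 -> 0 <= x ->
  rw a b x + Pk (b - a) (G b) x <= G a x.
Proof.
move=> a0 ab bT x0; have b0 : 0 <= b by lra.
have aT : a <= T1 by lra.
have hab := subT a0 ab bT.
apply: (@le_by_inv _ _ (CF * (T1 - b) * x)) => n.
have [l fl] := finegrid_exists n b0 bT.
have ol := finegrid_okl fl.
have D0 : 0 <= (T1 - b) / n.+1%:R by rewrite divr_ge0// subr_ge0.
have qx : quartic (fun y : R => CF * ((T1 - b) / n.+1%:R) * y).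
  by apply: quarticZ; exact: (@quartic_exp _ 1).
have qV := Vb_quartic b0 bT ol.
have : Pk (b - a) (G b) x <= Pk (b - a) (fun y => Vb l b y + CF * ((T1 - b) / n.+1%:R) * y) x.
  apply: Pk_le => //; [exact: G_quartic|exact: quarticD|].
  by move=> y y0; exact: G_le_grid.
rewrite PkD// PkZ ?Pk_id//; last exact: (@quartic_exp _ 1).
have := @G_ub (b :: l) a x a0 aT (And3 ab bT ol); rewrite /= ge_max => /andP[_].
have -> : CF * ((T1 - b) / n.+1%:R) * x = CF * (T1 - b) * x / n.+1%:R by rewrite -!mulrA [x / _]mulrC !mulrA.
by move=> h1 h2; apply: le_trans (lerD h1 (lexx _)); rewrite -[X in _ <= X]addrA lerD2l.
Qed.

(** The supersolution credits all savings of [W] and never charges the loss of [F]: its reward terms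
    add up to [W c - W b]. *)
Lemma G_le_excess a b x : 0 <= a -> a <= b -> b <= T1 -> 0 <= x ->
  G a x <= rw a b x + Pk (b - a) (G b) x + (F a - F b) * x.
Proof.
move=> a0 ab bT x0; have b0 : 0 <= b by lra. 
have lG := G_lip b0 bT.
have qP c : a <= c -> c <= b -> quartic (Pk (b - c) (G b)).
  move=> ac cb; apply: (@quartic_lip _ (F b)); apply: Pk_lip => //.
  by apply: subT => //; lra.
have qr c : a <= c -> c <= b -> quartic (rw c b).
  by move=> ac cb; apply: quartic_lip (lip_rw _ _ _) => //; lra.
have q1 c : quartic (fun y : R => c * y) by apply: quarticZ; exact: (@quartic_exp _ 1).
apply: (@G_comparison (fun c x => rw c b x + Pk (b - c) (G b) x + (F c - F b) * x) a b) => //.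
- move=> c y ac cb y0.
  have : 0 <= Pk (b - c) (G b) y by apply: Pk_ge0 => z; exact: G_ge0.
  have : - ((F c - F b) * y) <= rw c b y by apply: rw_ge_F => //; lra.
  lra.
- by move=> c ac cb; apply: quarticD => //; apply: quarticD; [exact: qr|exact: qP].
- move=> c e y ac ce eb y0; have c0 : 0 <= c by lra.
  have eT : e <= T1 by lra.
  have hce := subT c0 ce eT.
  have cT : c <= e by [].
  rewrite PkD//; last by apply: quarticD; [apply: qr|apply: qP]; lra.
  rewrite PkD//; [|by apply: qr; lra|by apply: qP; lra].
  rewrite PkZ ?Pk_id//; last exact: (@quartic_exp _ 1).
  rewrite Pk_rw// (@Pk_semigroup (e - c) (b - e) (F b))//; [|lra|lra|lra].
  have -> : e - c + (b - e) = b - c by ring.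
  rewrite 2!addrA rw_add lerD2l ler_wpM2r// lerD2r F_le//.
- move=> y y0; by rewrite subrr Pk0 /rw !subrr !mul0r subr0 add0r addr0.
Qed.

Lemma G_le_W_excess a b x : 0 <= a -> a <= b -> b <= T1 -> 0 <= x ->
  G a x <= Pk (b - a) (G b) x + (W a - W b).
Proof.
move=> a0 ab bT x0; have := G_le_excess a0 ab bT x0; rewrite /rw; lra.
Qed.

Lemma G_cont (t x e : R) : 0 <= t -> t <= T1 -> 0 <= x -> 0 < e ->
  exists2 eta : R, 0 < eta & forall u : R, 0 <= u -> u <= T1 -> `|u - t| < eta ->
    `|G u x - G t x| <= e.
Proof.
move=> t0 tT x0 e0.
have F00 : 0 <= F 0 by apply: F_ge0 => //; exact: ltW.
(* The spatial tolerance for [Pk_near], with [F 0 * e1 <= e / 4]. [K] then collects the coefficients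
   of [b - a], and its last summand keeps it positive. *)
pose e1 := e / (4 * (F 0 + 1)).
have e10 : 0 < e1 by rewrite divr_gt0// mulr_gt0// ltr_wpDl.
pose K := F 0 * (x ^+ 2 * Cvar / e1) + CW + CF * x + 1.
have K0 : 0 < K.
  have C0 := Cvar_ge0; have e1V : 0 <= e1^-1 by rewrite invr_ge0 ltW.
  by rewrite ltr_wpDl//; pos.
exists (e / (4 * K)); first by rewrite divr_gt0// mulr_gt0.
have key a b : 0 <= a -> a <= b -> b <= T1 -> b - a < e / (4 * K) -> `|G a x - G b x| <= e.
  move=> a0 ab bT ba; have b0 : 0 <= b by lra.
  have hab := subT a0 ab bT.
  have Fb0 : 0 <= F b by exact: F_ge0.
  have := Pk_near hab Fb0 (G_lip b0 bT) x0 e10.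
  rewrite ler_distl => /andP[h1 h2].
  have h3 := G_le_W_excess a0 ab bT x0.
  have h4 := G_super a0 ab bT x0.
  have h5 := rw_ge_F x a0 ab bT.
  have /andP[_ h6] := W_lip a0 ab bT.
  have /andP[_ h7] := F_lip a0 ab bT.
  have h8 : F b * (e1 + x ^+ 2 * (Cvar * (b - a)) / e1) <=
      F 0 * e1 + F 0 * (x ^+ 2 * Cvar / e1) * (b - a).
    have -> : F 0 * e1 + F 0 * (x ^+ 2 * Cvar / e1) * (b - a) =
      F 0 * (e1 + x ^+ 2 * (Cvar * (b - a)) / e1) by ring.
    rewrite ler_wpM2r ?F_le// addr_ge0 ?(ltW e10)// mulr_ge0 ?invr_ge0 ?(ltW e10)//.
    by rewrite mulr_ge0 ?sqr_ge0// mulr_ge0 ?Cvar_ge0//; lra.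
  have h9 : F 0 * e1 <= e / 4.
    rewrite /e1 mulrCA -[X in _ <= X]mulr1 -[4 * _]mulrC invfM.
    have -> : e * (F 0 * ((F 0 + 1)^-1 / 4)) = e / 4 * (F 0 / (F 0 + 1)) by ring.
    rewrite ler_wpM2l ?divr_ge0 ?(ltW e0)// ler_pdivrMr ?mul1r ?lerDl//.
    by rewrite ltr_wpDl.
  have h10 : K * (b - a) <= e / 4.
    rewrite -ler_pdivlMl// (le_trans (ltW ba))// invfM [K^-1 * _]mulrC.
    by rewrite mulrA.
  have h11 : (F a - F b) * x <= CF * x * (b - a) by rewrite mulrAC ler_wpM2r.
  have h12 : K * (b - a) = F 0 * (x ^+ 2 * Cvar / e1) * (b - a) + CW * (b - a)
      + CF * x * (b - a) + (b - a) by rewrite /K; ring.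
  have h13 : 0 <= F 0 * (x ^+ 2 * Cvar / e1) * (b - a).
    rewrite mulr_ge0 ?subr_ge0// mulr_ge0// mulr_ge0 ?invr_ge0 ?(ltW e10)//.
    by rewrite mulr_ge0 ?sqr_ge0 ?Cvar_ge0.
  have h14 : 0 <= CW * (b - a) by rewrite mulr_ge0 ?subr_ge0.
  have h15 : 0 <= CF * x * (b - a) by rewrite mulr_ge0 ?subr_ge0// mulr_ge0.
  rewrite ler_distl; apply/andP; split; lra.
move=> u u0 uT; have [ut|tu] := leP u t.
  by rewrite distrC ger0_norm ?subr_ge0//; exact: key.
by rewrite gtr0_norm ?subr_gt0// distrC; apply: key => //; exact: ltW.
Qed.

(** * Barriers and the local behaviour of the gain *)

Hypotheses (w_gt0 : forall t : R, 0 <= t <= T1 -> 0 < w t)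
  (f_gt0 : forall t : R, 0 <= t <= T1 -> 0 < f t)
  (WF_slope : forall t e : R, 0 <= t <= T1 -> 0 < e -> exists2 eta : R, 0 < eta &
     forall a b, 0 <= a -> a <= b -> b <= T1 -> `|a - t| < eta -> `|b - t| < eta ->
       `|W a - W b - w t * (b - a)| <= e * (b - a) /\
       `|F a - F b - f t * (b - a)| <= e * (b - a)).

(** A single date [t + h0] suffices: by the slopes of [W] and [F] its reward is positive for small
    [h0]. The choice of [e] lets the slope errors eat half of [w t - f t * x]. *)
Lemma G_gt0 (t x : R) : 0 <= t -> t < T1 -> 0 <= x -> f t * x < w t -> 0 < G t x.
Proof.
move=> t0 tT x0 fx.
pose e := (w t - f t * x) / (2 * (1 + x)).
have e0 : 0 < e by rewrite divr_gt0 ?subr_gt0// mulr_gt0// ltr_wpDr.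
have tT' : 0 <= t <= T1 by lra.
have [eta eta0 h] := WF_slope tT' e0.
pose h0 := Num.min (eta / 2) (T1 - t).
have h00 : 0 < h0 by rewrite lt_min divr_gt0//= subr_gt0.
have h01 : h0 <= eta / 2 by rewrite ge_min lexx.
have h02 : h0 <= T1 - t by rewrite ge_min lexx orbT.
have n1 : t <= t + h0 by lra.
have n2 : t + h0 <= T1 by lra.
have n3 : `|t - t| < eta by rewrite subrr normr0.
have n4 : `|t + h0 - t| < eta by rewrite addrAC subrr add0r gtr0_norm//; lra.
have [] := h t (t + h0) t0 n1 n2 n3 n4.
have h0E : t + h0 - t = h0 by ring.
rewrite h0E => h1 h2.
have := @G_ub [:: t + h0] t x t0 (ltW tT); rewrite /= Pk_cst addr0 => h3.
apply: lt_le_trans (h3 _); last by split => //; lra.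
rewrite lt_max; apply/orP; right; rewrite /rw.
move: h1 h2; rewrite !ler_distl => /andP[h1 _] /andP[_ h2].
have h4 : (F t - F (t + h0)) * x <= (f t * h0 + e * h0) * x by rewrite ler_wpM2r.
have h5 : e * (1 + x) = (w t - f t * x) / 2.
  by rewrite /e; field; rewrite gt_eqF// ltr_wpDr.
have h6 : 0 < (w t - f t * x) / 2 * h0 by rewrite mulr_gt0// divr_gt0// subr_gt0.
have : e * (1 + x) * h0 = (w t - f t * x) / 2 * h0 by rewrite h5.
nra.
Qed.

Lemma rw_neg (t x1 : R) : 0 <= t <= T1 -> 0 <= x1 -> forall e : R, 0 < e ->
  exists2 eta : R, 0 < eta & forall a b x, 0 <= a -> a <= b -> b <= T1 ->
    `|a - t| < eta -> `|b - t| < eta -> x1 <= x ->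
    rw a b x <= - ((f t * x1 - w t - e * (1 + x1)) * (b - a)).
Proof.
move=> tT x10 e e0; have [eta eta0 h] := WF_slope tT e0.
exists eta => // a b x a0 ab bT ha hb xx1.
have [] := h a b a0 ab bT ha hb; rewrite !ler_distl => /andP[_ h1] /andP[h2 _].
have h3 : (F a - F b) * x1 <= (F a - F b) * x.
  by rewrite ler_wpM2l// subr_ge0 F_le.
have h4 : (f t * (b - a) - e * (b - a)) * x1 <= (F a - F b) * x1 by rewrite ler_wpM2r.
rewrite /rw; nra.
Qed.

Lemma rw_upper (t x0 : R) : 0 <= t <= T1 -> 0 <= x0 -> forall e : R, 0 < e ->
  exists2 eta : R, 0 < eta & forall a b, 0 <= a -> a <= b -> b <= T1 ->
    `|a - t| < eta -> `|b - t| < eta ->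
    - rw a b x0 <= (f t * x0 - w t + e * (1 + x0)) * (b - a).
Proof.
move=> tT x10 e e0; have [eta eta0 h] := WF_slope tT e0.
exists eta => // a b a0 ab bT ha hb.
have [] := h a b a0 ab bT ha hb; rewrite !ler_distl => /andP[h1 _] /andP[_ h2].
have h4 : (F a - F b) * x0 <= (f t * (b - a) + e * (b - a)) * x0 by rewrite ler_wpM2r.
rewrite /rw; nra.
Qed.

(** Comparison with the barrier [A * (T1 - a) * (x - y) ^+ 2], which vanishes at [x = y] and at
    [T1]. One half of its decrease in time pays for the reward below [y1], where the reward may be
    positive; the other half, with the margin [c], pays for the variance, which is small close to
    [T1]. *)
Lemma G_eq0_near_T1 y : 0 <= y -> w T1 < f T1 * y ->
  exists2 eta : R, 0 < eta & forall t : R, 0 <= t -> t <= T1 -> T1 - t < eta -> G t y = 0.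
Proof.
move=> y0 wfy; have T10 := ltW T1_gt0.
have TT : 0 <= T1 <= T1 by rewrite T10 lexx.
have fT := f_gt0 TT; have wT := w_gt0 TT.
pose g := f T1 * y - w T1.
have g0 : 0 < g by rewrite subr_gt0.
have y_gt0 : 0 < y by nra.
pose y1 := (y + w T1 / f T1) / 2.
have wf : w T1 / f T1 < y by rewrite ltr_pdivrMr// mulrC.
have wf0 : 0 < w T1 / f T1 by rewrite divr_gt0.
have y10 : 0 <= y1 by rewrite /y1; lra.
have yy1 : y1 < y by rewrite /y1; lra.
have fy1 : f T1 * y1 - w T1 = g / 2.
  by rewrite /y1 /g; field; rewrite gt_eqF.
pose e := g / (4 * (1 + y1)).
have e0 : 0 < e by rewrite divr_gt0// mulr_gt0// ltr_wpDr.
have [eta1 eta10 hneg] := rw_neg TT y10 e0.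
pose c := g / 4.
have c0 : 0 < c by rewrite divr_gt0.
have ce : f T1 * y1 - w T1 - e * (1 + y1) = c.
  by rewrite fy1 /e /c; field; rewrite gt_eqF// ltr_wpDr.
rewrite ce in hneg.
(* Below [y1], half of the rate of decrease, [A * (x - y) ^+ 2 / 2], is then at least [CW + c]. *)
pose A := 2 * (CW + c) / (y - y1) ^+ 2.
have yy : 0 < (y - y1) ^+ 2 by rewrite exprn_gt0// subr_gt0.
have A0 : 0 < A by rewrite divr_gt0// mulr_gt0// ltr_wpDl.
(* Once [x ^+ 2] is split as at most [2 * (x - y) ^+ 2 + 2 * y ^+ 2], the first term of [K] controls
   the variance due to the distance and the second the one due to [y]. *)
pose K := 4 * Cvar + 2 * A * Cvar * y ^+ 2 / c + 1.
have K1 : 0 <= 2 * A * Cvar * y ^+ 2 / c.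
  by have C0 := Cvar_ge0; have A0' := ltW A0; rewrite divr_ge0 ?(ltW c0)//; pos.
have K0 : 0 < K by rewrite ltr_wpDl// addr_ge0// mulr_ge0// Cvar_ge0.
pose eta := Num.min eta1 (K^-1).
exists eta; first by rewrite lt_min eta10 invr_gt0.
move=> t t0 tT; rewrite lt_min => /andP[t1 t2].
apply/eqP; rewrite eq_le G_ge0// andbT.
have small b : t <= b -> b <= T1 -> (T1 - b) * (4 * Cvar) <= 1 /\
    (T1 - b) * (2 * A * Cvar * y ^+ 2) <= c.
  move=> tb bT; have : (T1 - b) * K <= 1.
    by rewrite -ler_pdivlMr// mul1r; lra.
  have C0 := Cvar_ge0.
  have h1 : 0 <= (T1 - b) * (4 * Cvar) by rewrite mulr_ge0 ?subr_ge0// mulr_ge0.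
  have h2 : 0 <= (T1 - b) * (2 * A * Cvar * y ^+ 2 / c) by rewrite mulr_ge0 ?subr_ge0.
  rewrite /K !mulrDr mulr1 => h3; split; first lra.
  have : (T1 - b) * (2 * A * Cvar * y ^+ 2 / c) <= 1 by lra.
  by rewrite mulrA ler_pdivrMr// mul1r.
have Ay : A * (y - y1) ^+ 2 = 2 * (CW + c) by rewrite /A divfK// gt_eqF.
clearbody eta K A c e y1 g; clear K1 K0 wf wf0 fy1 ce e0 t2 wfy fT wT.
have := @G_comparison (fun a x => A * (T1 - a) * (x - y) ^+ 2) t T1 t0 tT (lexx _).
move=> h; rewrite [X in _ <= X](_ : 0 = A * (T1 - t) * (y - y) ^+ 2); last by ring.
apply: (h _ _ _ _ t y (lexx _) tT y0).
- by move=> a x ta aT x0; rewrite mulr_ge0 ?sqr_ge0// mulr_ge0 ?(ltW A0)// subr_ge0.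
- by move=> a ta aT; apply: quarticZ; exact: quartic_sq.
- move=> a b x ta ab bT x0; have a0 : 0 <= a by exact: le_trans ta.
  have hab := subT a0 ab bT.
  rewrite PkZ//; last exact: quartic_sq.
  have tb := le_trans ta ab; have aT := le_trans ab bT.
  have [s1 s2] := small b tb bT.
  have /andP[_ h2] := Pk_sq_le x y hab.
  have AT : 0 <= A * (T1 - b) by rewrite mulr_ge0 ?(ltW A0)// subr_ge0.
  have h3 := ler_wpM2l AT h2.
  set p := (x - y) ^+ 2 in h2 h3 *.
  have p0 : 0 <= p by exact: sqr_ge0.
  have x2 : x ^+ 2 <= 2 * p + 2 * y ^+ 2.
    rewrite -subr_ge0 /p.
    have -> : 2 * (x - y) ^+ 2 + 2 * y ^+ 2 - x ^+ 2 = (x - 2 * y) ^+ 2 by ring.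
    exact: sqr_ge0.
  have C0 := Cvar_ge0.
  have h4 : A * (T1 - b) * (x ^+ 2 * (Cvar * (b - a))) <=
      A * (b - a) * (p / 2) + c * (b - a).
    have -> : A * (T1 - b) * (x ^+ 2 * (Cvar * (b - a))) =
      (b - a) * (A * ((T1 - b) * Cvar * x ^+ 2)) by ring.
    have -> : A * (b - a) * (p / 2) + c * (b - a) = (b - a) * (A * (p / 2) + c) by ring.
    rewrite ler_wpM2l ?subr_ge0//.
    have h5 : (T1 - b) * Cvar * x ^+ 2 <= (T1 - b) * Cvar * (2 * p + 2 * y ^+ 2).
      by rewrite ler_wpM2l// mulr_ge0// subr_ge0.
    have h6 : (T1 - b) * (4 * Cvar) * (p / 2) <= 1 * (p / 2) by rewrite ler_wpM2r// divr_ge0.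
    have h7 : A * ((T1 - b) * Cvar * x ^+ 2) <= A * (p / 2 + 2 * (T1 - b) * Cvar * y ^+ 2).
      by rewrite ler_wpM2l ?(ltW A0)//; lra.
    apply: (le_trans h7); rewrite mulrDr lerD2l; apply: le_trans s2.
    by rewrite le_eqVlt; apply/orP; left; apply/eqP; ring.
  have rwle : rw a b x <= A * (b - a) * (p / 2) - c * (b - a).
    have na : `|a - T1| < eta1.
      by rewrite distrC ger0_norm ?subr_ge0//; apply: le_lt_trans t1; rewrite lerD2l lerN2.
    have nb : `|b - T1| < eta1.
      by rewrite distrC ger0_norm ?subr_ge0//; apply: le_lt_trans t1; rewrite lerD2l lerN2.
    have [x1|x1] := leP y1 x.
      have := hneg a b x a0 ab bT na nb x1.
      have : 0 <= A * (b - a) * (p / 2).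
        by rewrite mulr_ge0 ?divr_ge0// mulr_ge0 ?subr_ge0// ltW.
      lra.
    have r1 := rw_le_W a0 ab bT x0; have /andP[_ r2] := W_lip a0 ab bT.
    have py : (y - y1) ^+ 2 <= p.
      rewrite /p -[(x - y) ^+ 2]sqrrN opprB lerXn2r ?nnegrE ?subr_ge0 ?(ltW yy1)//.
        by rewrite ltW// (lt_trans x1).
      by rewrite lerD2l lerN2 ltW.
    have : CW + c <= A * (p / 2).
      by have := ler_wpM2l (ltW A0) py; rewrite Ay -ler_pdivlMl// mulrCA [2^-1 * _]mulrC.
    move=> r3; have r4 : (CW + c) * (b - a) <= A * (p / 2) * (b - a).
      by rewrite ler_wpM2r// subr_ge0.
    lra.
  have -> : A * (T1 - a) * p = A * (T1 - b) * p + A * (b - a) * p by ring.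
  lra.
- by move=> x x0; rewrite G_T1_eq0// subrr mulr0 mul0r.
Qed.

Lemma W_le0 a : 0 <= a -> a <= T1 -> W a <= W 0.
Proof. by move=> a0 aT; have := W_lip (lexx _) a0 aT; rewrite subr_ge0 => /andP[]. Qed.

(* Left of its kink the excess [G - rw - P G] is o(h) where [G > 0]. *)
Lemma G_excess_small (t x : R) : 0 <= t -> t < T1 -> 0 <= x -> 0 < G t x ->
  exists C : R, exists2 eta : R, 0 < eta & forall h : R, 0 < h -> h < eta -> t + h <= T1 /\
    G t x <= rw t (t + h) x + Pk h (G (t + h)) x + C * h ^+ 2.
Proof.
move=> t0 tT x0 Gt; have tT' := ltW tT.
have F00 : 0 <= F 0 by apply: F_ge0 => //; exact: ltW.
pose g := G t x.
have g4 : 0 < g / 4 by rewrite divr_gt0.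
have [eta1 eta10 hc] := G_cont t0 tT' x0 g4.
(* Moving at most [D] in space, less than [eta1] in time, and losing [CF * (x + D) * h] cost at most
   [g / 4] each, so the candidate below stays nonnegative near [x]. *)
pose D := g / (4 * (F 0 + 1)).
have D0 : 0 < D by rewrite divr_gt0// mulr_gt0// ltr_wpDl.
have FD : F 0 * D <= g / 4.
  have -> : F 0 * D = g / 4 * (F 0 / (F 0 + 1)) by rewrite /D invfM; ring.
  rewrite -[X in _ <= X]mulr1 ler_wpM2l ?(ltW g4)// ler_pdivrMr ?mul1r ?lerDl//.
  by rewrite ltr_wpDl.
(* For |z - x| > D, [z] is at most the bracket times [(z - x) ^+ 4], so the quartic term covers the
   loss [CF * h * z] there. *)
pose B := CF * (x / D ^+ 4 + 1 / D ^+ 3).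
have xD0 : 0 <= x / D ^+ 4 + 1 / D ^+ 3.
  by rewrite addr_ge0// divr_ge0// ?exprn_ge0// ltW.
have B0 : 0 <= B by rewrite mulr_ge0.
pose eta := Num.min (T1 - t) (Num.min eta1 (g / (4 * (CF * (x + D) + 1)))).
have CFx : 0 < CF * (x + D) + 1 by rewrite ltr_wpDl// mulr_ge0// addr_ge0// ltW.
exists (B * T1 * C4 * x ^+ 4 + B * C4 * x ^+ 4 * T1), eta.
  by rewrite !lt_min subr_gt0 tT eta10 divr_gt0// mulr_gt0.
move=> h h0; rewrite !lt_min => /andP[h1 /andP[h2 h3]].
have thT : t + h <= T1 by lra.
split => //.
have th0 : 0 <= t + h by lra.
have hT : 0 <= h <= T1 by lra.
have lG := G_lip th0 thT.
have small : CF * (x + D) * h <= g / 4.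
  have : (CF * (x + D) + 1) * h <= g / 4.
    by rewrite -ler_pdivlMl// (le_trans (ltW h3))// invfM mulrA mulrC.
  by rewrite mulrDl; lra.
clearbody eta D.
(* The value of waiting until [t + h] satisfies the recursion with equality and lacks nonnegativity
   to be a supersolution. The quartic term restores it far from [x] and costs O(h^3) at [x]
   itself. *)
pose Dn a z := rw a (t + h) z + Pk (t + h - a) (G (t + h)) z.
have qDn a : t <= a -> a <= t + h -> quartic (Dn a).
  move=> ta ah; have a0 : 0 <= a by lra.
  apply: quarticD; first exact: quartic_lip (lip_rw _ _ _).
  by apply: (@quartic_lip _ (F (t + h))); apply: Pk_lip => //; exact: subT.
have th : t <= t + h by lra.
have := @G_comparison (fun a z => Dn a z + h * B * R4 (t + h - a) x z) t (t + h) t0 th thT.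
move=> hcmp; have hthE : t + h - t = h by ring.
have hfin : Dn t x + h * B * R4 (t + h - t) x x <=
    rw t (t + h) x + Pk h (G (t + h)) x +
    (B * T1 * C4 * x ^+ 4 + B * C4 * x ^+ 4 * T1) * h ^+ 2.
  rewrite /Dn hthE lerD2l.
  have := R4_diag x hT => h4.
  have hB : 0 <= h * B by rewrite mulr_ge0// ltW.
  apply: (le_trans (ler_wpM2l hB h4)).
  have C40 := C4_ge0; have x4 : 0 <= x ^+ 4 by rewrite exprn_ge0.
  have u0 : 0 <= B * C4 * x ^+ 4 * h ^+ 2 by rewrite mulr_ge0 ?sqr_ge0//; pos.
  have u1 : B * C4 * x ^+ 4 * h ^+ 2 * h <= B * C4 * x ^+ 4 * h ^+ 2 * T1.
    by rewrite ler_wpM2l//; lra.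
  have -> : h * B * (C4 * h ^+ 2 * x ^+ 4) = B * C4 * x ^+ 4 * h ^+ 2 * h by ring.
  have -> : (B * T1 * C4 * x ^+ 4 + B * C4 * x ^+ 4 * T1) * h ^+ 2 =
    B * C4 * x ^+ 4 * h ^+ 2 * T1 + B * C4 * x ^+ 4 * h ^+ 2 * T1 by ring.
  by rewrite (le_trans u1)// lerDl mulr_ge0// ltW.
apply: le_trans hfin.
apply: (hcmp _ _ _ _ t x (lexx _) th x0).
- move=> a z ta ah z0; have a0 : 0 <= a by lra.
  have aT := le_trans ah thT.
  have hR : 0 <= t + h - a <= T1 by lra.
  have R0 := R4_ge x hR z0.
  have e1 := G_le_excess a0 ah thT z0.
  have /andP[_ e2] := F_lip a0 ah thT.
  have e3 : (F a - F (t + h)) * z <= CF * h * z.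
    rewrite ler_wpM2r//; apply: (le_trans e2); rewrite ler_wpM2l//; lra.
  have Gaz := G_ge0 z a0 aT.
  have [zx|zx] := leP `|z - x| D.
    have na : `|a - t| < eta1.
      by rewrite ger0_norm ?subr_ge0//; apply: le_lt_trans h2; rewrite lerBlDl.
    have := hc a a0 aT na; rewrite ler_distl => /andP[e4 _].
    have := G_lip a0 aT z x; rewrite ler_distl => /andP[e5 _].
    have e6 : F a * `|z - x| <= F 0 * D.
      by apply: ler_pM => //; [exact: F_ge0|apply: F_le].
    have e7 : CF * h * z <= CF * (x + D) * h.
      rewrite mulrAC ler_wpM2r ?(ltW h0)// ler_wpM2l//.
      by move: zx; rewrite ler_distl => /andP[_].
    have e8 : 0 <= h * B * R4 (t + h - a) x z.
      by rewrite mulr_ge0 ?R4_ge0// mulr_ge0// ltW.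
    rewrite /Dn; rewrite -/g in e4; lra.
  have e9 : z <= (x / D ^+ 4 + 1 / D ^+ 3) * (z - x) ^+ 4.
    have := ler_norm (z - x); set n := `|z - x| in zx * => e10.
    have -> : (z - x) ^+ 4 = n ^+ 4.
      by rewrite /n -normrX ger0_norm// exprn_even_ge0.
    have n0 : 0 < n := lt_trans D0 zx.
    have p4 : 1 <= n ^+ 4 / D ^+ 4.
      by rewrite ler_pdivlMr ?mul1r ?exprn_gt0// lerXn2r// ?nnegrE ltW.
    have p3 : 1 <= n ^+ 3 / D ^+ 3.
      by rewrite ler_pdivlMr ?mul1r ?exprn_gt0// lerXn2r// ?nnegrE ltW.
    have -> : (x / D ^+ 4 + 1 / D ^+ 3) * n ^+ 4 = x * (n ^+ 4 / D ^+ 4) + n * (n ^+ 3 / D ^+ 3).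
      by ring.
    have := ler_wpM2l x0 p4; have := ler_wpM2l (ltW n0) p3; lra.
  have e10 : CF * h * z <= h * B * R4 (t + h - a) x z.
    have -> : CF * h * z = h * (CF * z) by ring.
    rewrite -mulrA ler_wpM2l ?(ltW h0)// /B -mulrA ler_wpM2l//.
    by apply: (le_trans e9); rewrite ler_wpM2l.
  rewrite /Dn; lra.
- move=> a ta ah; apply: quarticD; first exact: qDn.
  by apply: quarticZ; exact: R4_quartic.
- move=> a b z ta ab bh z0; have a0 : 0 <= a by lra.
  have b0 : 0 <= b by lra.
  have bT : b <= T1 by lra.
  have tb : t <= b by lra.
  have hab := subT a0 ab bT.
  have hb : 0 <= t + h - b <= T1 by lra.
  rewrite PkD//; [|exact: qDn|by apply: quarticZ; exact: R4_quartic].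
  rewrite PkZ ?Pk_R4//; last exact: R4_quartic.
  have -> : t + h - b + (b - a) = t + h - a by ring.
  rewrite addrA lerD2r /Dn PkD//; last 2 first.
  - exact: quartic_lip (lip_rw _ _ _).
  - by apply: (@quartic_lip _ (F (t + h))); apply: Pk_lip.
  rewrite Pk_rw// addrA rw_add lerD2l (@Pk_semigroup (b - a) (t + h - b) (F (t + h)))//; [|lra|lra|lra].
  by have -> : b - a + (t + h - b) = t + h - a by ring.
- move=> z z0; rewrite /Dn subrr Pk0 R4_0 /rw !subrr mul0r subr0 add0r lerDl.
  by rewrite mulr_ge0 ?exprn_even_ge0// mulr_ge0// ltW.
Qed.

(** Above [x1] waiting costs at rate [c], so a bound [q] at time [t1] is worn down going backwards.
    The quartic term pays for paths that leave the strip: its coefficient, scaled by [kap], starts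
    at [W 0] and grows backwards at the rate [CW + c]. *)
Lemma G_strip_bound (a0 t1 x1 y c q : R) : 0 <= a0 -> a0 <= t1 -> t1 <= T1 ->
  0 <= x1 -> x1 < y -> 0 <= c -> 0 <= q ->
  (forall a b x, a0 <= a -> a <= b -> b <= t1 -> x1 <= x -> rw a b x <= - (c * (b - a))) ->
  G t1 x1 <= q ->
  G a0 y <= Num.max 0 (q - c * (t1 - a0)) +
    (W 0 + (CW + c) * (t1 - a0)) / (y - x1) ^+ 4 * R4 (t1 - a0) y y.
Proof.
move=> a00 at1 t1T x10 x1y c0 q0 hneg Gq; have y0 : 0 <= y by lra.
have T10 := ltW T1_gt0; have W00 : 0 <= W 0 by exact: W_ge0.
set kap := (y - x1) ^+ 4.
have kap0 : 0 < kap by rewrite exprn_gt0// subr_gt0.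
have kapE z : 0 <= z -> z < x1 -> 1 <= (z - y) ^+ 4 / kap.
  move=> z0 zx; rewrite ler_pdivlMr// mul1r.
  have -> : (z - y) ^+ 4 = (y - z) ^+ 4 by ring.
  by rewrite lerXn2r// ?nnegrE ?subr_ge0 ?lerD2l ?lerN2 ?ltW// (lt_trans zx).
clearbody kap.
pose m a := Num.max 0 (q - c * (t1 - a)).
have m0 a : 0 <= m a by rewrite le_max lexx.
pose Cw := CW + c; have Cw0 : 0 <= Cw by rewrite addr_ge0.
pose lam a := (W 0 + Cw * (t1 - a)) / kap.
have lam0 a : a <= t1 -> 0 <= lam a.
  by move=> ?; rewrite divr_ge0 ?(ltW kap0)// addr_ge0// mulr_ge0// subr_ge0.
apply: (@G_comparison (fun a z => m a + lam a * R4 (t1 - a) y z) a0 t1) => //.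
- move=> a z ta ht z0; apply: addr_ge0 => //; apply: mulr_ge0; first exact: lam0.
  by apply: R4_ge0 => //; apply: subT => //; exact: le_trans ta.
- move=> a ta ht; apply: quarticD; first exact: quartic_cst.
  by apply: quarticZ; exact: R4_quartic.
- move=> a b z ta ab bt1 z0; have a0' : 0 <= a := le_trans a00 ta.
  have bT : b <= T1 := le_trans bt1 t1T.
  have hab := subT a0' ab bT.
  have hR : 0 <= t1 - a <= T1 by apply: subT => //; exact: le_trans bt1.
  rewrite PkD//; [|exact: quartic_cst|by apply: quarticZ; exact: R4_quartic].
  rewrite Pk_cst PkZ ?Pk_R4//; last exact: R4_quartic.
  have -> : t1 - b + (b - a) = t1 - a by ring.
  have r0 := R4_ge y hR z0.
  set r := R4 (t1 - a) y z in r0 *.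
  have -> : lam a * r = lam b * r + Cw * (b - a) * (r / kap) by rewrite /lam; ring.
  have mm : m b <= m a + c * (b - a).
    rewrite /m ge_max; apply/andP; split.
      by apply: addr_ge0; [exact: m0|rewrite mulr_ge0// subr_ge0].
    have -> : q - c * (t1 - b) = q - c * (t1 - a) + c * (b - a) by ring.
    by rewrite lerD2r le_max lexx orbT.
  suff h0 : rw a b z <= - (c * (b - a)) + Cw * (b - a) * (r / kap).
    by move: h0 mm; lra.
  have rk : (z - y) ^+ 4 / kap <= r / kap by rewrite ler_wpM2r// invr_ge0 ltW.
  have ba0 : 0 <= b - a by rewrite subr_ge0.
  have Cb0 : 0 <= Cw * (b - a) by rewrite mulr_ge0.
  have [zx|zx] := leP x1 z.
    apply: (le_trans (hneg a b z ta ab bt1 zx)); rewrite lerDl mulr_ge0//.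
    by apply: le_trans rk; rewrite divr_ge0 ?exprn_even_ge0// ltW.
  have rk1 := le_trans (kapE z z0 zx) rk.
  have h4 := rw_le_W a0' ab bT z0; have /andP[_ h5] := W_lip a0' ab bT.
  have h6 := ler_wpM2l Cb0 rk1.
  by move: h4 h5 h6; rewrite /Cw; lra.
- move=> z z0; rewrite subrr R4_0 /m /lam subrr !mulr0 subr0 addr0 (max_idPr q0).
  have t10 : 0 <= t1 := le_trans a00 at1.
  have [zx|zx] := leP x1 z.
    apply: (le_trans (G_nincr t10 t1T zx)); apply: (le_trans Gq); rewrite lerDl.
    by rewrite mulr_ge0 ?exprn_even_ge0// divr_ge0// ltW.
  apply: (le_trans (G_le_W t10 t1T z0)); apply: (le_trans (W_le0 t10 t1T)).
  apply: ler_wpDl => //; rewrite mulrAC -mulrA -[X in X <= _]mulr1.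
  by rewrite ler_wpM2l// kapE.
Qed.

(** Stopping is optimal at (t, x0), so [G_super] bounds the mean of [G (t + h)] from [x0] by [- rw],
    which is linear in [h]. As [G] is nonincreasing in space and the process stays below [x1] up to
    an error O(h^2), the bound passes to the point [x1]. *)
Lemma G_right_linear (t x0 x1 e : R) : 0 <= t -> t < T1 -> 0 <= x0 -> x0 < x1 ->
  G t x0 = 0 -> 0 < e ->
  exists2 eta : R, 0 < eta & forall h : R, 0 < h -> h < eta -> t + h <= T1 /\
    G (t + h) x1 <= (f t * x0 - w t + e * (1 + x0) + e) * h.
Proof.
move=> t0 tT x00 x01 Gt0 e0; have tT' : 0 <= t <= T1 by lra.
have x10 : 0 <= x1 by lra.
have W00 : 0 <= W 0 by apply: W_ge0 => //; exact: ltW.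
have [eta2 eta20 hup] := rw_upper tT' x00 e0.
set kap := (x1 - x0) ^+ 4.
have kap0 : 0 < kap by rewrite exprn_gt0// subr_gt0.
have kapE z : x1 < z -> 1 <= (z - x0) ^+ 4 / kap.
  move=> zx; rewrite ler_pdivlMr// mul1r.
  by rewrite lerXn2r ?nnegrE ?subr_ge0 ?lerD2r ?ltW// (lt_trans x01).
clearbody kap.
have Wx : 0 <= W 0 / kap by rewrite divr_ge0// ltW.
pose K := W 0 / kap * (C4 * x0 ^+ 4).
have K0 : 0 <= K by rewrite mulr_ge0// mulr_ge0 ?C4_ge0// exprn_ge0.
have K1 : 0 < K + 1 by rewrite ltr_wpDl.
exists (Num.min (Num.min (T1 - t) eta2) (e / (K + 1))).
  by rewrite !lt_min subr_gt0 tT eta20 divr_gt0.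
move=> h h0; rewrite !lt_min => /andP[/andP[h1 h2] h3].
have thT : t + h <= T1 by rewrite addrC -lerBrDr ltW.
split=> //.
have tth : t <= t + h by rewrite lerDl ltW.
have th0 : 0 <= t + h := le_trans t0 tth.
have hE : t + h - t = h by ring.
have hT : 0 <= h <= T1 by rewrite -hE subT.
have := G_super t0 tth thT x00; rewrite Gt0 hE => s1.
have nt : `|t - t| < eta2 by rewrite subrr normr0.
have nth : `|t + h - t| < eta2 by rewrite hE gtr0_norm.
have := hup t (t + h) t0 tth thT nt nth; rewrite hE => s2.
have q4 : quartic (fun z => W 0 / kap * R4 0 x0 z).
  by apply: quarticZ; exact: R4_quartic.
have qG := G_quartic th0 thT.
have : G (t + h) x1 <= Pk h (fun z => G (t + h) z + W 0 / kap * R4 0 x0 z) x0.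
  rewrite -[X in X <= _](Pk_cst h _ x0).
  apply: Pk_le => //; [exact: quartic_cst|exact: quarticD|].
  move=> z z0; rewrite R4_0.
  have [zx|zx] := leP z x1.
    apply: (le_trans (G_nincr th0 thT zx)); rewrite lerDl mulr_ge0// exprn_even_ge0//.
  apply: (le_trans (G_le_W th0 thT x10)); apply: (le_trans (W_le0 th0 thT)).
  apply: ler_wpDl; first exact: G_ge0.
  by rewrite mulrAC -mulrA -[X in X <= _]mulr1 ler_wpM2l// kapE.
rewrite PkD// PkZ//; last exact: R4_quartic.
rewrite Pk_R4// add0r => s3.
have s5 := ler_wpM2l Wx (R4_diag x0 hT).
have s6 : W 0 / kap * (C4 * h ^+ 2 * x0 ^+ 4) = K * h * h by rewrite /K; ring.
have s7 : K * h <= e.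
  apply: (@le_trans _ _ ((K + 1) * h)); first by rewrite ler_wpM2r ?(ltW h0)// lerDl.
  by rewrite -ler_pdivlMl// mulrC ltW.
have s8 : K * h * h <= e * h by rewrite ler_wpM2r ?(ltW h0).
by move: s1 s2 s3 s5 s8; rewrite s6; lra.
Qed.

(** The linear bound of [G_right_linear], of slope [c1] at an intermediate [x1], is too large by
    itself. But above [x1] waiting costs at a rate [c > c1], because [f t > 0] and [x1 > x0]. Going
    back from the linear bound at the later time [t + h * N] to [t + h] therefore uses it up, and
    the quartic remainder is all that is left. *)
Lemma G_right_small (t x0 y : R) : 0 <= t -> t < T1 -> 0 <= x0 -> x0 < y -> G t x0 = 0 ->
  exists C : R, exists2 eta : R, 0 < eta & forall h : R, 0 < h -> h < eta -> t + h <= T1 /\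
    G (t + h) y <= C * h ^+ 2.
Proof.
move=> t0 tT x00 x0y Gt0; have tT' : 0 <= t <= T1 by lra.
have ft := f_gt0 tT'.
pose x1 := (x0 + y) / 2.
have x01 : x0 < x1 by rewrite /x1; lra.
have x1y : x1 < y by rewrite /x1; lra.
have x10 : 0 <= x1 by lra.
clearbody x1.
(* The slope errors in [c - c1] total [e * (2 + x0 + x1) + e], at most 3/8 of [f t * (x1 - x0)]. *)
pose e := f t * (x1 - x0) / (4 * (2 + x0 + x1)).
have d0 : 0 < 2 + x0 + x1 by lra.
have fx : 0 < f t * (x1 - x0) by rewrite mulr_gt0// subr_gt0.
have e0 : 0 < e by rewrite divr_gt0// mulr_gt0.
have eE : e * (2 + x0 + x1) = f t * (x1 - x0) / 4 by rewrite /e; field; rewrite gt_eqF.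
have ele : e <= f t * (x1 - x0) / 8.
  have : e * 2 <= e * (2 + x0 + x1) by rewrite ler_wpM2l ?(ltW e0)//; lra.
  by rewrite eE; lra.
clearbody e.
have [eta1 eta10 hneg] := rw_neg tT' x10 e0.
have [eta3 eta30 step1] := G_right_linear t0 tT x00 x01 Gt0 e0.
have W00 : 0 <= W 0 by apply: W_ge0 => //; exact: ltW.
pose c1 := f t * x0 - w t + e * (1 + x0) + e.
pose c := f t * x1 - w t - e * (1 + x1).
have cc : 0 < c - c1.
  have -> : c - c1 = f t * (x1 - x0) - e * (2 + x0 + x1) - e by rewrite /c /c1; ring.
  by rewrite eE; move: ele fx; lra.
rewrite -/c1 in step1; rewrite -/c in hneg; clearbody c c1.
(* A nonnegative [G] cannot lie below a line of negative slope through zero. *)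
have c10 : 0 <= c1.
  have h0 : 0 < eta3 / 2 by rewrite divr_gt0.
  have h1 : eta3 / 2 < eta3 by move: eta30; lra.
  have [thT h2] := step1 _ h0 h1.
  have th0 : 0 <= t + eta3 / 2 by rewrite addr_ge0// ltW.
  have := le_trans (G_ge0 x1 th0 thT) h2.
  by rewrite pmulr_lge0.
have c0 : 0 < c by move: c10 cc; lra.
(* The solution of [c1 * N = c * (N - 1)]: the bound [c1 * (h * N)] is spent exactly over the time
   [h * (N - 1)]. *)
pose N := c / (c - c1).
have N1 : 1 <= N by rewrite /N ler_pdivlMr// mul1r; move: c10; lra.
have cN : c1 * N = c * (N - 1) by rewrite /N; field; rewrite gt_eqF.
have N0 : 0 < N := lt_le_trans ltr01 N1.
clearbody N.
pose kap := (y - x1) ^+ 4.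
have kap0 : 0 < kap by rewrite exprn_gt0// subr_gt0.
have T10 := ltW T1_gt0.
exists ((W 0 + (CW + c) * T1) / kap * (C4 * N ^+ 2 * y ^+ 4)).
exists (Num.min eta1 eta3 / N).
  by apply: divr_gt0; [rewrite lt_min eta10 eta30|].
move=> h h0; rewrite ltr_pdivlMr// lt_min => /andP[hN1 hN3].
have hN : 0 < h * N by rewrite mulr_gt0.
have hh : h <= h * N by rewrite ler_peMr// ltW.
have [thT _] := step1 h h0 (le_lt_trans hh hN3).
split => //.
have [t1T Gt1] := step1 (h * N) hN hN3.
have th0 : 0 <= t + h by rewrite addr_ge0// ltW.
have tht1 : t + h <= t + h * N by rewrite lerD2l.
have q0 : 0 <= c1 * (h * N) by rewrite mulr_ge0// ltW.
have near1 a : t + h <= a -> a <= t + h * N -> `|a - t| < eta1.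
  by move=> ha ha'; rewrite ger0_norm; move: ha ha' h0 hN1; lra.
have hstrip a b x : t + h <= a -> a <= b -> b <= t + h * N -> x1 <= x ->
    rw a b x <= - (c * (b - a)).
  move=> ha ab hb hx; apply: hneg => //.
  - exact: le_trans ha.
  - exact: le_trans hb t1T.
  - by apply: near1 => //; exact: le_trans hb.
  - by apply: near1 => //; exact: le_trans ab.
apply: (le_trans (G_strip_bound th0 tht1 t1T x10 x1y (ltW c0) q0 hstrip Gt1)).
have t1h : t + h * N - (t + h) = h * (N - 1) by ring.
rewrite t1h.
have -> : c1 * (h * N) - c * (h * (N - 1)) = h * (c1 * N - c * (N - 1)) by ring.
rewrite cN subrr mulr0 maxxx add0r.
have hR : 0 <= h * (N - 1) <= T1 by rewrite -t1h subT.
have /andP[hR0 hRT] := hR.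
have y0 : 0 <= y by move: x10 x1y; lra.
rewrite -/kap -[X in _ <= X]mulrA; apply: ler_pM.
- by rewrite divr_ge0 ?(ltW kap0)// addr_ge0// mulr_ge0// addr_ge0// ltW.
- exact: R4_ge0.
- by rewrite ler_wpM2r ?invr_ge0 ?(ltW kap0)// lerD2l ler_wpM2l// addr_ge0// ltW.
apply: (le_trans (R4_diag y hR)).
have -> : C4 * (h * (N - 1)) ^+ 2 * y ^+ 4 = (C4 * y ^+ 4 * h ^+ 2) * (N - 1) ^+ 2 by ring.
have -> : C4 * N ^+ 2 * y ^+ 4 * h ^+ 2 = (C4 * y ^+ 4 * h ^+ 2) * N ^+ 2 by ring.
have C40 := C4_ge0.
rewrite ler_wpM2l//; first by pos.
rewrite lerXn2r// ?nnegrE ?subr_ge0// ?(ltW N0)//.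
by rewrite gerBl.
Qed.

(** From [x] the process falls below the midpoint of [x0] and [x] at a cost O(h^2), by the fourth
    moment; above it [G_right_small] applies. *)
Lemma PG_right_small (t x0 x : R) : 0 <= t -> t < T1 -> 0 <= x0 -> x0 < x -> G t x0 = 0 ->
  exists C : R, exists2 eta : R, 0 < eta & forall h : R, 0 < h -> h < eta -> t + h <= T1 /\
    Pk h (G (t + h)) x <= C * h ^+ 2.
Proof.
move=> t0 tT x00 x0x Gt0.
pose y := (x0 + x) / 2.
have x0y : x0 < y by rewrite /y; lra.
have yx : y < x by rewrite /y; lra.
have y0 : 0 <= y by lra.
have x_ge0 : 0 <= x by lra.
have W00 : 0 <= W 0 by apply: W_ge0 => //; exact: ltW.
have [C [eta eta0 hC]] := G_right_small t0 tT x00 x0y Gt0.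
exists (C + W 0 / (x - y) ^+ 4 * (C4 * x ^+ 4)), eta => // h h0 heta.
have [thT Gy] := hC h h0 heta; split => //.
have th0 : 0 <= t + h by lra.
have hT : 0 <= h <= T1 by lra.
have xy4 : 0 < (x - y) ^+ 4 by rewrite exprn_gt0// subr_gt0.
have Wx : 0 <= W 0 / (x - y) ^+ 4 by rewrite divr_ge0// ltW.
have q4 : quartic (fun z => W 0 / (x - y) ^+ 4 * R4 0 x z).
  by apply: quarticZ; exact: R4_quartic.
have : Pk h (G (t + h)) x <= Pk h (fun z => C * h ^+ 2 + W 0 / (x - y) ^+ 4 * R4 0 x z) x.
  apply: Pk_le => //; [exact: G_quartic|by apply: quarticD => //; exact: quartic_cst|].
  move=> z z0; rewrite R4_0.
  have [zy|zy] := leP y z.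
    apply: (le_trans (G_nincr th0 thT zy)); apply: (le_trans Gy).
    by rewrite lerDl mulr_ge0// exprn_even_ge0.
  apply: (le_trans (G_le_W th0 thT z0)); apply: (le_trans (W_le0 th0 thT)).
  apply: ler_wpDl; first exact: le_trans (G_ge0 y th0 thT) Gy.
  rewrite mulrAC ler_pdivlMr// ler_wpM2l//.
  have -> : (z - x) ^+ 4 = (x - z) ^+ 4 by ring.
  by rewrite lerXn2r ?nnegrE ?subr_ge0//; lra.
rewrite PkD//; last exact: quartic_cst.
rewrite Pk_cst PkZ ?Pk_R4//; last exact: R4_quartic.
rewrite add0r => h1; apply: (le_trans h1).
have := ler_wpM2l Wx (R4_diag x hT); lra.
Qed.

(** * Optional stopping *)

Variable Fi : R -> set (set Om).
Hypotheses (Fi_filt : is_filtration Fi)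
  (M_adapted : forall t V, 0 <= t -> measurable V -> Fi t (M t @^-1` V))
  (M_cont : forall w, continuous (M ^~ w))
  (M_indep : forall (a b : R) (A : set Om) (X : Om -> R) (phi : R -> R),
     0 <= a -> a <= b -> b <= T1 -> Fi a A ->
     (forall V, measurable V -> Fi a (X @^-1` V)) ->
     measurable_fun setT phi -> (forall y, 0 <= phi y) ->
     (\int[Q]_(w in A) (phi (X w * (M b w / M a w)))%:E =
      \int[Q]_(w in A) \int[Q]_v (phi (X w * M (b - a) v))%:E)%E).

Variables (t x : R).
Hypotheses (t_ge0 : 0 <= t) (t_leT1 : t <= T1) (x_ge0 : 0 <= x).

Definition Xp (u : R) (om : Om) : R := x * (M u om / M t om).

Lemma Xp_ge0 u om : 0 <= Xp u om.
Proof. by rewrite mulr_ge0// divr_ge0// ltW. Qed.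

Lemma Xp_t om : Xp t om = x.
Proof. by rewrite /Xp divff ?mulr1// gt_eqF. Qed.

Lemma XpM a b om : Xp b om = Xp a om * (M b om / M a om).
Proof. by rewrite /Xp; field; rewrite !gt_eqF. Qed.

Lemma mXp u : measurable_fun setT (Xp u).
Proof.
apply: measurable_funM => //; apply: measurable_funM => //.
have -> : (fun om => (M t om)^-1) = (fun om => M t om `^ (-1)).
  by apply/funext => om; rewrite powR_inv1// ltW.
exact: measurableT_comp (measurable_powR _) _.
Qed.

Lemma Xp_adapted u : t <= u -> Fmeasurable Fi u (Xp u).
Proof.
move=> tu; have mg : measurable_fun setT (fun z : R * R => x * (z.1 * z.2 `^ (-1))).
  apply: measurable_funM => //; apply: measurable_funM => //.
  exact: measurableT_comp (measurable_powR _) _.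
have -> : Xp u = (fun om => x * (M u om * M t om `^ (-1))).
  by apply/funext => om; rewrite powR_inv1// ltW.
have fM v : 0 <= v -> Fmeasurable Fi v (M v) by move=> v0 V; exact: M_adapted.
have := Fmeasurable_comp (Fmeasurable_pair Fi_filt (fM u (le_trans t_ge0 tu))
  (Fmeasurable_sub Fi_filt tu (fM t t_ge0))) mg.
exact.
Qed.

Lemma Xp_cond a b A (phi : R -> R) : t <= a -> a <= b -> b <= T1 -> Fi a A ->
  quartic phi -> (forall y, 0 <= phi y) ->
  (\int[Q]_(w in A) (phi (Xp b w))%:E = \int[Q]_(w in A) (Pk (b - a) phi (Xp a w))%:E)%E.
Proof.
move=> ta ab bT hA qp p0; have a0 : 0 <= a := le_trans t_ge0 ta.
have hab := subT a0 ab bT.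
under eq_integral do rewrite (XpM a).
rewrite M_indep//; last 2 first.
- exact: Xp_adapted.
- by case: qp.
by apply: eq_integral => om _; rewrite PkE.
Qed.

Lemma rint_Xp b (phi : R -> R) : t <= b -> b <= T1 -> quartic phi ->
  rint Q setT (fun w => phi (Xp b w)).
Proof.
move=> tb bT qp; have hab := subT t_ge0 tb bT.
have qn : quartic (fun y => `|phi y|).
  by case: qp => mp [C hC]; split; [exact: measurableT_comp|exists C => y; rewrite normr_id].
have mp : measurable_fun setT (fun w => phi (Xp b w)).
  by case: qp => mp _; apply: measurableT_comp => //; exact: mXp.
suff : rint Q setT (fun w => `|phi (Xp b w)|) by apply: rint_le => // om _.
apply: rint_ge0_lty => //; first exact: measurableT_comp.
have := @Xp_cond t b setT (fun y => `|phi y|) (lexx _) tb bT (FiT Fi_filt t) qn (fun=> normr_ge0 _).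
move=> ->.
under eq_integral do rewrite Xp_t.
by rewrite EFin_Rintegral ?ltry//; exact: rint_cst.
Qed.

Lemma Xp_condR a b A (phi : R -> R) : t <= a -> a <= b -> b <= T1 -> Fi a A ->
  quartic phi -> (forall y, 0 <= phi y) ->
  \int[Q]_(w in A) phi (Xp b w) = \int[Q]_(w in A) Pk (b - a) phi (Xp a w).
Proof. by move=> ta ab bT hA qp p0; rewrite /Rintegral (Xp_cond ta ab bT hA). Qed.

Lemma rint_XpA b A (phi : R -> R) : t <= b -> b <= T1 -> measurable A -> quartic phi ->
  rint Q A (fun w => phi (Xp b w)).
Proof. by move=> tb bT mA qp; apply: integrableS (rint_Xp tb bT qp). Qed.

Lemma Xp_martingale a b A : t <= a -> a <= b -> b <= T1 -> Fi a A ->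
  \int[Q]_(om in A) Xp b om = \int[Q]_(om in A) Xp a om.
Proof.
move=> ta ab bT hA; have hab := subT (le_trans t_ge0 ta) ab bT.
have qn : quartic (fun y : R => `|y|).
  split; first exact: normr_measurable.
  by exists 1 => y; rewrite normr_id mul1r normr_le_quartic.
have nX c om : `|Xp c om| = Xp c om by rewrite ger0_norm// Xp_ge0.
have := Xp_condR ta ab bT hA qn (fun y => normr_ge0 y).
under eq_Rintegral do rewrite nX.
move=> ->; apply: eq_Rintegral => om _.
rewrite -[RHS](Pk_id _ hab); apply: eq_Rintegral => om' _.
by rewrite ger0_norm// mulr_ge0 ?Xp_ge0// ltW.
Qed.

Lemma Xp_sq_martingale a b A : t <= a -> a <= b -> b <= T1 -> Fi a A ->
  \int[Q]_(om in A) (expR (- (s * b)) * Xp b om ^+ 2) =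
  \int[Q]_(om in A) (expR (- (s * a)) * Xp a om ^+ 2).
Proof.
move=> ta ab bT hA; have hab := subT (le_trans t_ge0 ta) ab bT.
have mA := Fi_meas Fi_filt hA; have aT := le_trans ab bT; have tb := le_trans ta ab.
have qs : quartic (fun y : R => y ^+ 2) by exact: quartic_exp.
have i2 c : t <= c -> c <= T1 -> rint Q A (fun om => Xp c om ^+ 2).
  by move=> tc cT; exact: (@rint_XpA c A (fun y => y ^+ 2)).
rewrite !RintegralZl//; [|exact: i2|exact: i2].
rewrite (Xp_condR ta ab bT hA qs (fun y => sqr_ge0 y)).
under eq_Rintegral do rewrite Pk_exp//.
rewrite RintegralZr//; last exact: i2.
have e : expR (- (s * b)) * expR (2 * (2 - 1) / 2 * (s * (b - a))) = expR (- (s * a)).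
  by rewrite -expRD; congr expR; field.
by rewrite mulrCA e mulrC.
Qed.

(** The payoff of stopping at [u] plus the gain: the Snell envelope of the payoff, whose
    supermartingale property is [G_super]. *)
Definition Yp u om : R := G u (Xp u om) + (F u * Xp u om - W u).

Lemma rint_Yp u A : t <= u -> u <= T1 -> measurable A -> rint Q A (Yp u).
Proof.
move=> tu uT mA; have u0 := le_trans t_ge0 tu.
apply: (@rint_XpA u A (fun y => G u y + (F u * y - W u))) => //.
apply: quarticD; first exact: G_quartic.
apply: quarticB; last exact: quartic_cst.
by apply: quarticZ; exact: (@quartic_exp _ 1).
Qed.

Lemma Yp_supermartingale a b A : t <= a -> a <= b -> b <= T1 -> Fi a A ->
  \int[Q]_(om in A) Yp b om <= \int[Q]_(om in A) Yp a om.
Proof.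
move=> ta ab bT hA; have a0 := le_trans t_ge0 ta; have hab := subT a0 ab bT.
have mA := Fi_meas Fi_filt hA; have aT := le_trans ab bT; have tb := le_trans ta ab.
have b0 := le_trans a0 ab.
have qG := G_quartic b0 bT.
have q1 c : quartic (fun y : R => c * y) by apply: quarticZ; exact: (@quartic_exp _ 1).
have iG : rint Q A (fun om => G b (Xp b om)) by exact: rint_XpA.
have iX c : t <= c -> c <= T1 -> rint Q A (Xp c).
  by move=> tc cT; apply: (@rint_XpA c A id) => //; exact: (@quartic_exp _ 1).
have iFX c : t <= c -> c <= T1 -> rint Q A (fun om => F b * Xp c om - W b).
  by move=> tc cT; apply: rintB => //; [apply: rintZ => //; exact: iX|exact: rint_cst].
have iP : rint Q A (fun om => Pk (b - a) (G b) (Xp a om)).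
  apply: (@rint_XpA a A (Pk (b - a) (G b))) => //.
  by apply: quartic_lip; apply: Pk_lip => //; exact: G_lip.
have -> : \int[Q]_(om in A) Yp b om =
    \int[Q]_(om in A) (Pk (b - a) (G b) (Xp a om) + (F b * Xp a om - W b)).
  rewrite /Yp (RintegralD mA iG (iFX b tb bT)) (RintegralD mA iP (iFX a ta aT)).
  rewrite (Xp_condR ta ab bT hA qG (fun y => G_ge0 y b0 bT)); congr (_ + _).
  have ic : rint Q A (fun=> W b) by exact: rint_cst.
  rewrite (RintegralB mA (rintZ (F b) mA (iX b tb bT)) ic).
  rewrite (RintegralB mA (rintZ (F b) mA (iX a ta aT)) ic).
  rewrite (RintegralZl _ mA (iX b tb bT)) (RintegralZl _ mA (iX a ta aT)).
  by rewrite (Xp_martingale ta ab bT hA).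
apply: le_Rintegral => //; [|exact: rint_Yp|].
  by apply: rintD => //; exact: iFX.
move=> om _; have := G_super a0 ab bT (Xp_ge0 a om).
by rewrite /Yp /rw; lra.
Qed.

Lemma rint_id u : t <= u -> u <= T1 -> rint Q setT (Xp u).
Proof. by move=> tu uT; apply: (@rint_Xp u id) => //; exact: (@quartic_exp _ 1). Qed.

Section stopping.
Variable tau : Om -> R.
Hypotheses (tau_stop : is_stopping_time Fi tau) (tau_bd : forall om, t <= tau om <= T1).

Lemma Fi_tau a : Fi a [set om | a < tau om].
Proof.
have -> : [set om | a < tau om] = ~` [set om | tau om <= a].
  apply/seteqP; split => om /=; first by rewrite ltNge => /negP.
  by move=> /negP; rewrite -ltNge.
by apply: (FiC Fi_filt); exact: tau_stop.
Qed.

Definition grid (n k : nat) : R := t + (T1 - t) / n.+1%:R * k%:R.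

Lemma grid0 n : grid n 0 = t. Proof. by rewrite /grid mulr0 addr0. Qed.

Lemma gridn n : grid n n.+1 = T1.
Proof. by rewrite /grid divfK ?pnatr_eq0// addrC subrK. Qed.

Lemma grid_mesh_ge0 n : 0 <= (T1 - t) / n.+1%:R.
Proof. by rewrite divr_ge0// subr_ge0. Qed.

Lemma grid_le n k l : (k <= l)%N -> grid n k <= grid n l.
Proof. by move=> kl; rewrite lerD2l ler_wpM2l ?grid_mesh_ge0// ler_nat. Qed.

Lemma grid_ge n k : t <= grid n k.
Proof. by rewrite -{1}(grid0 n) grid_le. Qed.

Lemma grid_leT n k : (k <= n.+1)%N -> grid n k <= T1.
Proof. by move=> kn; rewrite -(gridn n) grid_le. Qed.

(* [gidx n om] is the index of the first grid point not smaller than [tau om]. *)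
Definition gidx n om : nat := (\sum_(0 <= k < n.+1) (grid n k < tau om)%R)%N.

Definition taun n om : R := grid n (gidx n om).

Lemma gidx_le n om : (gidx n om <= n.+1)%N.
Proof.
rewrite /gidx -[X in (_ <= X)%N]subn0 -[X in (_ <= X)%N]muln1 -sum_nat_const_nat.
by apply: leq_sum => k _; case: (_ < _).
Qed.

Lemma gidx_telescope n om (y : nat -> R) :
  \sum_(0 <= k < n.+1) (grid n k < tau om)%R%:R * (y k.+1 - y k) = y (gidx n om) - y 0%N.
Proof.
rewrite /gidx; elim: n.+1 => [|m IH]; first by rewrite !big_geq// subrr.
rewrite !big_nat_recr//= IH; case: ltP => h; last by rewrite mul0r addr0 addn0.
have -> : (\sum_(0 <= k < m) (grid n k < tau om)%R)%N = m.
  rewrite -[RHS]subn0 -[RHS]muln1 -sum_nat_const_nat; apply: eq_big_nat => k /andP[_ km].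
  by rewrite (le_lt_trans _ h)// grid_le// ltnW.
by rewrite mul1r addn1; ring.
Qed.

Lemma taun_ge n om : t <= taun n om. Proof. exact: grid_ge. Qed.

Lemma taun_le n om : taun n om <= T1. Proof. by apply: grid_leT; exact: gidx_le. Qed.

Lemma taun_tau n om : tau om <= taun n om <= tau om + (T1 - t) / n.+1%:R.
Proof.
have /andP[tt tT] := tau_bd om.
have D0 := grid_mesh_ge0 n.
have gS k : grid n k.+1 = grid n k + (T1 - t) / n.+1%:R by rewrite /grid -natr1; ring.
(* Induction over the grid points counted so far: either the count has reached a point not before
   [tau], or all points so far lie before [tau]. In the latter case the final index is [n.+1], which
   is the point [T1]. *)
suff H m : let K := (\sum_(0 <= k < m) (grid n k < tau om)%R)%N in
    (tau om <= grid n K \/ K = m /\ (m = 0%N \/ grid n m.-1 < tau om)) /\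
    grid n K <= tau om + (T1 - t) / n.+1%:R.
  have [[h1|[h1 h2]] h3] := H n.+1; rewrite /taun /gidx; apply/andP; split => //.
  by rewrite h1 gridn.
elim: m => [|m [IH1 IH2]] /=.
  rewrite big_geq//; split; last by rewrite grid0 (le_trans tt)// lerDl.
  by right; split => //; left.
rewrite big_nat_recr//=; set K := (\sum_(0 <= k < m) _)%N in IH1 IH2 *.
have [h|h] := ltP (grid n m) (tau om); last first.
  rewrite addn0; split => //; left; case: IH1 => // -[-> _] //.
have Km : K = m.
  rewrite /K -[RHS]subn0 -[RHS]muln1 -sum_nat_const_nat; apply: eq_big_nat => k /andP[_ km].
  by rewrite (le_lt_trans _ h)// grid_le// ltnW.
rewrite Km addn1; split; first by right; split => //; right.
by rewrite gS lerD2r ltW.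
Qed.

Lemma taun_cvg om : taun ^~ om @ \oo --> tau om.
Proof.
apply/cvgrPdist_le => e e0; near=> n.
have /andP[h1 h2] := taun_tau n om.
rewrite distrC ger0_norm ?subr_ge0// lerBlDl (le_trans h2)// lerD2l.
have : (T1 - t) / n.+1%:R <= e.
  rewrite ler_pdivrMr// mulrC -ler_pdivrMr//.
  have : (T1 - t) / e < n%:R by near: n; exact: nbhs_infty_gtr.
  by move/ltW/le_trans; apply; rewrite ler_nat.
by [].
Unshelve. all: by end_near. Qed.

(** Discrete optional stopping by telescoping: the increment after [grid n k] is taken on the event
    that [tau] is still ahead, and this event belongs to [Fi (grid n k)]. *)
Lemma grid_stopping_le n (y : nat -> Om -> R) :
  (forall k, (k <= n.+1)%N -> rint Q setT (y k)) ->
  (forall k A, (k < n.+1)%N -> Fi (grid n k) A ->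
     \int[Q]_(om in A) y k.+1 om <= \int[Q]_(om in A) y k om) ->
  rint Q setT (fun om => y (gidx n om) om) /\
  \int[Q]_om y (gidx n om) om <= \int[Q]_om y 0%N om.
Proof.
move=> iy hy.
pose A k := [set om | grid n k < tau om].
have FA k : Fi (grid n k) (A k) by exact: Fi_tau.
have mA k := Fi_meas Fi_filt (FA k).
have E om : y (gidx n om) om = y 0%N om + \sum_(0 <= k < n.+1) \1_(A k) om * (y k.+1 om - y k om).
  have := gidx_telescope n om (y ^~ om).
  rewrite -[X in X = _](_ : \sum_(0 <= k < n.+1) \1_(A k) om * (y k.+1 om - y k om) = _).
    by move=> ->; rewrite addrC subrK.
  by apply: eq_bigr => k _; rewrite indicE mem_setE.
have ik k : (k < n.+1)%N -> rint Q setT (fun om => \1_(A k) om * (y k.+1 om - y k om)).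
  move=> kn; have ii : rint Q setT (fun om => y k.+1 om - y k om).
    by apply: rintB => //; apply: iy => //; exact: ltnW.
  apply: rint_le (rint_norm measurableT ii) => //.
    by apply: measurable_funM => //; exact: rint_measurable ii.
  move=> om _; rewrite normrM indicE; case: (om \in A k); rewrite ?normr1 ?mul1r//.
  by rewrite normr0 mul0r.
have nk k : (k < n.+1)%N -> \int[Q]_om (\1_(A k) om * (y k.+1 om - y k om)) <= 0.
  move=> kn; have i1 := iy k.+1 kn; have i2 := iy k (ltnW kn).
  have -> : \int[Q]_om (\1_(A k) om * (y k.+1 om - y k om)) =
      \int[Q]_(om in A k) (y k.+1 om - y k om).
    rewrite [RHS]Rintegral_mkcond; apply: eq_Rintegral => om _.
    by rewrite patchE indicE; case: (om \in A k); rewrite ?mul1r ?mul0r.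
  rewrite RintegralB//; [|exact: integrableS i1|exact: integrableS i2].
  by rewrite subr_le0 hy.
have [S1 S2] : rint Q setT (fun om => \sum_(0 <= k < n.+1) \1_(A k) om * (y k.+1 om - y k om)) /\
    \int[Q]_om (\sum_(0 <= k < n.+1) \1_(A k) om * (y k.+1 om - y k om)) <= 0.
  have : (n.+1 <= n.+1)%N by [].
  elim: {-2}n.+1 => [|m IH] mn.
    have e0 : (fun om => \sum_(0 <= k < 0) \1_(A k) om * (y k.+1 om - y k om)) = fun=> 0.
      by apply/funext => om; rewrite big_geq.
    by rewrite e0 Rintegral_probability_cst; split => //; exact: rint_cst.
  have [I1 I2] := IH (ltnW mn).
  have eS : (fun om => \sum_(0 <= k < m.+1) \1_(A k) om * (y k.+1 om - y k om)) =
      (fun om => \sum_(0 <= k < m) \1_(A k) om * (y k.+1 om - y k om) +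
        \1_(A m) om * (y m.+1 om - y m om)).
    by apply/funext => om; rewrite big_nat_recr.
  rewrite eS; split; first by apply: rintD => //; exact: ik.
  rewrite RintegralD//; last exact: ik.
  by have := nk m mn; lra.
have eY : (fun om => y (gidx n om) om) =
    (fun om => y 0%N om + \sum_(0 <= k < n.+1) \1_(A k) om * (y k.+1 om - y k om)).
  by apply/funext => om; exact: E.
rewrite eY; split; first by apply: rintD => //; exact: iy.
rewrite RintegralD//; last exact: iy.
by lra.
Qed.

Lemma mtaun n : measurable_fun setT (taun n).
Proof.
rewrite /taun /grid.
apply: measurable_funD => //; apply: measurable_funM => //.
have -> : (fun om => (gidx n om)%:R : R) =
    (fun om => \sum_(0 <= k < n.+1) \1_[set o | grid n k < tau o] om).
  apply/funext => om; rewrite /gidx natr_sum; apply: eq_bigr => k _.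
  by rewrite indicE mem_setE.
apply: measurable_sum => k; apply: measurable_indic.
by apply: (Fi_meas Fi_filt); exact: Fi_tau.
Qed.

Lemma mtau : measurable_fun setT tau.
Proof. by apply: (measurable_fun_cvg mtaun) => om _; exact: taun_cvg. Qed.

Lemma mX_stop (sg : Om -> R) : measurable_fun setT sg ->
  measurable_fun setT (fun om => Xp (sg om) om).
Proof.
move=> msg.
have cX om : continuous (fun u => Xp u om).
  move=> u; rewrite /Xp; apply: cvgMr; apply: cvgMl; exact: M_cont.
have := @measurable_fun_joint_continuous _ _ _ Xp mXp cX.
move=> h; apply: (measurableT_comp h (_ : measurable_fun setT (fun om => (sg om, om)))).
exact: measurable_fun_pair.
Qed.

Lemma Xp_taun_cvg om : (fun n => Xp (taun n om) om) @ \oo --> Xp (tau om) om.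
Proof.
have cX : continuous (fun u => Xp u om).
  by move=> u; rewrite /Xp; apply: cvgMr; apply: cvgMl; exact: M_cont.
exact: (cvg_comp _ _ (@taun_cvg om) (cX (tau om))).
Qed.

Lemma grid_stopping_eq n (y : nat -> Om -> R) :
  (forall k, (k <= n.+1)%N -> rint Q setT (y k)) ->
  (forall k A, (k < n.+1)%N -> Fi (grid n k) A ->
     \int[Q]_(om in A) y k.+1 om = \int[Q]_(om in A) y k om) ->
  rint Q setT (fun om => y (gidx n om) om) /\
  \int[Q]_om y (gidx n om) om = \int[Q]_om y 0%N om.
Proof.
move=> iy hy.
have [|i1 h1] := grid_stopping_le iy.
  by move=> k A kn hA; rewrite hy.
have iN k : (k <= n.+1)%N -> rint Q setT (fun om => -1 * y k om).
  by move=> kn; apply: rintZ => //; exact: iy.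
have [|i2 h2] := grid_stopping_le iN.
  move=> k A kn hA; have mA := Fi_meas Fi_filt hA.
  have j1 := integrableS measurableT mA (@subsetT _ A) (iy k.+1 kn).
  have j2 := integrableS measurableT mA (@subsetT _ A) (iy k (ltnW kn)).
  by rewrite !RintegralZl// hy.
split => //; apply/eqP; rewrite eq_le h1 /=.
by move: h2; rewrite !RintegralZl// ?mulN1r ?lerN2//; exact: iy.
Qed.

Lemma E_Xp_taun n : rint Q setT (fun om => Xp (taun n om) om) /\
  \int[Q]_om Xp (taun n om) om = x.
Proof.
have [|k A kn hA|i h] := @grid_stopping_eq n (fun k => Xp (grid n k)).
- by move=> k kn; apply: rint_id; [exact: grid_ge|exact: grid_leT].
- by apply: Xp_martingale => //; [exact: grid_ge|exact: grid_le|exact: grid_leT].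
split => //; rewrite [LHS]h; under eq_Rintegral do rewrite grid0 Xp_t.
exact: Rintegral_probability_cst.
Qed.

(** A second moment bound uniform in the grid, to be used for uniform integrability:
    [expR (- (s * u))] compensates the square to a martingale, and this factor is bounded below up
    to [T1]. *)
Lemma E_Xp_sq_taun n : rint Q setT (fun om => Xp (taun n om) om ^+ 2) /\
  \int[Q]_om Xp (taun n om) om ^+ 2 <= expR (s * T1) * (expR (- (s * t)) * x ^+ 2).
Proof.
have i2 u : t <= u -> u <= T1 -> rint Q setT (fun om => expR (- (s * u)) * Xp u om ^+ 2).
  move=> tu uT; apply: rintZ => //.
  by apply: (@rint_Xp u (fun y => y ^+ 2)) => //; exact: quartic_exp.
have [|k A kn hA|i h] := @grid_stopping_eq n
    (fun k om => expR (- (s * grid n k)) * Xp (grid n k) om ^+ 2).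
- by move=> k kn; apply: i2; [exact: grid_ge|exact: grid_leT].
- by apply: Xp_sq_martingale => //; [exact: grid_ge|exact: grid_le|exact: grid_leT].
have le1 om : Xp (taun n om) om ^+ 2 <=
    expR (s * T1) * (expR (- (s * taun n om)) * Xp (taun n om) om ^+ 2).
  rewrite mulrA -expRD -[X in X <= _]mul1r ler_wpM2r ?sqr_ge0//.
  by rewrite -expR0 ler_expR -mulrBr mulr_ge0// subr_ge0 taun_le.
have ir : rint Q setT (fun om => expR (s * T1) * (expR (- (s * taun n om)) * Xp (taun n om) om ^+ 2)).
  by apply: rintZ => //.
have il : rint Q setT (fun om => Xp (taun n om) om ^+ 2).
  apply: rint_le ir => //.
    by apply: measurable_funX; apply: mX_stop; exact: mtaun.
  by move=> om _; rewrite ger0_norm ?sqr_ge0.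
split => //; apply: (le_trans (le_Rintegral measurableT il ir (fun om _ => le1 om))).
rewrite RintegralZl// ler_wpM2l ?expR_ge0// [X in X <= _]h.
under eq_Rintegral do rewrite grid0 Xp_t.
by rewrite Rintegral_probability_cst.
Qed.

(** Fatou along the grid times gives a mean of at most [x]. For the converse the process is
    truncated at [L]: the uniform second moment bounds the discarded mean by [K / L], bounded
    convergence treats the rest, and [L] is arbitrary. *)
Lemma optional_stopping : rint Q setT (fun om => Xp (tau om) om) /\
  \int[Q]_om Xp (tau om) om = x.
Proof.
have mX n : measurable_fun setT (fun om => Xp (taun n om) om).
  by apply: mX_stop; exact: mtaun.
have leE n : \int[Q]_om Xp (taun n om) om <= x by rewrite (E_Xp_taun n).2.
have [i h] := @Rintegral_fatou _ _ _ Q setT _ _ measurableT mX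
  (fun om _ => @Xp_taun_cvg om) x (fun n om _ => Xp_ge0 _ _)
  (fun n => (E_Xp_taun n).1) leE.
split => //; apply/eqP; rewrite eq_le h /=.
set K := expR (s * T1) * (expR (- (s * t)) * x ^+ 2).
apply: (@le_by_inv _ _ K) => m; set L := m.+1%:R : R.
have L0 : 0 < L by [].
have mmin n : measurable_fun setT (fun om => Num.min (Xp (taun n om) om) L).
  by apply: measurable_minr.
have cmin om : (fun n => Num.min (Xp (taun n om) om) L) @ \oo --> Num.min (Xp (tau om) om) L.
  rewrite minr_absE; under eq_fun do rewrite minr_absE.
  apply: cvgMl; apply: cvgB; first by apply: cvgD; [exact: Xp_taun_cvg|exact: cvg_cst].
  by apply: cvg_norm; apply: cvgB; [exact: Xp_taun_cvg|exact: cvg_cst].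
have bmin u om : `|Num.min (Xp u om) L| <= L.
  by rewrite ger0_norm ?ge_min ?lexx ?orbT// le_min Xp_ge0 ltW.
have [im cm] := @Rintegral_dominated _ _ _ Q setT _ _ measurableT mmin (fun om _ => cmin om)
  (fun=> L) (rint_cst _ _ measurableT) (fun n om _ => bmin (taun n om) om).
have low n : x - K / L <= \int[Q]_om Num.min (Xp (taun n om) om) L.
  have [i1 e1] := E_Xp_taun n; have [i2 e2] := E_Xp_sq_taun n.
  have i3 : rint Q setT (fun om => Num.min (Xp (taun n om) om) L).
    by apply: rint_bounded (mmin n) (fun om _ => bmin (taun n om) om).
  have i4 : rint Q setT (fun om => L^-1 * Xp (taun n om) om ^+ 2) by apply: rintZ.
  have : \int[Q]_om Xp (taun n om) om <=
      \int[Q]_om (Num.min (Xp (taun n om) om) L + L^-1 * Xp (taun n om) om ^+ 2).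
    apply: le_Rintegral => //; first exact: rintD.
    move=> om _; have := Xp_ge0 (taun n om) om; set z := Xp _ _ => z0.
    have [zL|Lz] := leP z L; first by rewrite lerDl mulr_ge0 ?invr_ge0 ?sqr_ge0// ltW.
    apply: ler_wpDl; first exact: ltW.
    by rewrite mulrC ler_pdivlMr// expr2 ler_wpM2l// ltW.
  rewrite e1 RintegralD// RintegralZl// => h1; rewrite lerBlDr (le_trans h1)// lerD2l.
  by rewrite mulrC ler_wpM2r// invr_ge0 ltW.
rewrite -lerBlDr; apply: (@le_trans _ _ (\int[Q]_om Num.min (Xp (tau om) om) L)).
  rewrite -(cvg_lim _ cm)//; apply: limr_ge; first exact: cvgP cm.
  by apply: nearW => n; exact: low.
by apply: le_Rintegral => // om _; rewrite ge_min lexx.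
Qed.

Lemma lip_clamp (phi : R -> R) (C : R) : 0 <= C ->
  (forall a b, 0 <= a -> a <= b -> b <= T1 -> 0 <= phi a - phi b <= C * (b - a)) ->
  lip C (fun u => phi (Num.max 0 (Num.min u T1))).
Proof.
move=> C0 hphi; have T10 := ltW T1_gt0.
have cl u : 0 <= Num.max 0 (Num.min u T1) <= T1.
  by rewrite le_max lexx /= ge_max T10 ge_min lexx orbT.
have clm u v : u <= v -> 0 <= Num.max 0 (Num.min v T1) - Num.max 0 (Num.min u T1) <= v - u.
  move=> uv; case: (leP v T1) => hv; case: (leP u T1) => hu;
    rewrite ?(max_idPr T10); try (case: (leP 0 u) => h1); try (case: (leP 0 v) => h2); lra.
have key u v : u <= v ->
    `|phi (Num.max 0 (Num.min u T1)) - phi (Num.max 0 (Num.min v T1))| <= C * `|u - v|.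
  move=> uv; have /andP[a1 a2] := clm u v uv; have /andP[b1 b2] := cl u; have /andP[b3 b4] := cl v.
  have ab : Num.max 0 (Num.min u T1) <= Num.max 0 (Num.min v T1) by rewrite -subr_ge0.
  have /andP[c1 c2] := hphi _ _ b1 ab b4.
  rewrite ger0_norm// (le_trans c2)// distrC (ger0_norm (_ : 0 <= v - u)) ?subr_ge0//.
  by rewrite ler_wpM2l.
move=> u v; have [uv|vu] := leP u v; first exact: key.
by rewrite distrC [`|u - v|]distrC; apply: key; exact: ltW.
Qed.

Lemma clamp_id u : t <= u -> u <= T1 -> Num.max 0 (Num.min u T1) = u.
Proof. by move=> tu uT; rewrite (min_idPl uT) (max_idPr _)// (le_trans t_ge0). Qed.

Lemma F_stop_cont (phi : R -> R) (C : R) : 0 <= C ->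
  (forall a b, 0 <= a -> a <= b -> b <= T1 -> 0 <= phi a - phi b <= C * (b - a)) ->
  (forall sg : Om -> R, measurable_fun setT sg -> (forall om, t <= sg om <= T1) ->
     measurable_fun setT (phi \o sg)) /\
  (forall om, phi (taun n om) @[n --> \oo] --> phi (tau om)).
Proof.
move=> C0 hphi; have lp := lip_clamp C0 hphi.
split.
  move=> sg msg bsg; have -> : phi \o sg = (fun u => phi (Num.max 0 (Num.min u T1))) \o sg.
    by apply/funext => om /=; have /andP[h1 h2] := bsg om; rewrite clamp_id.
  by apply: measurableT_comp => //; exact: lip_measurable lp.
move=> om; apply/cvgrPdist_le => e e0; near=> n.
have /andP[h1 h2] := tau_bd om.
have := lp (tau om) (taun n om).
rewrite (clamp_id h1 h2) (clamp_id (taun_ge n om) (taun_le n om)).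
move=> h; apply: (le_trans h).
have : `|tau om - taun n om| <= e / (C + 1).
  by near: n; apply: cvgr_dist_le; [exact: taun_cvg|rewrite divr_gt0// ltr_wpDl].
move=> h3; apply: (le_trans (ler_wpM2l C0 h3)).
by rewrite mulrCA -[X in _ <= X]mulr1 ler_wpM2l ?(ltW e0)// ler_pdivrMr ?mul1r ?lerDl// ltr_wpDl.
Unshelve. all: by end_near. Qed.

(** [Yp] is stopped at grid times approaching [tau] from above. Since [G] is nonnegative and [W]
    nonincreasing, [F * X] at the grid time lies below [Yp + W (tau om)]; this product is
    nonnegative, so Fatou can be applied to it alone. *)
Lemma value_le : rint Q setT (fun om => F (tau om) * Xp (tau om) om) /\
  rint Q setT (fun om => W (tau om)) /\
  \int[Q]_om (F (tau om) * Xp (tau om) om - W (tau om)) <= G t x + (F t * x - W t).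
Proof.
have [mF cF] := F_stop_cont CF_ge0 F_lip.
have [mW cW] := F_stop_cont CW_ge0 W_lip.
have tb n om : t <= taun n om <= T1 by rewrite taun_ge taun_le.
have W00 : 0 <= W 0 by apply: W_ge0 => //; exact: ltW.
have bW sg : measurable_fun setT sg -> (forall om, t <= sg om <= T1) ->
    rint Q setT (fun om => W (sg om)).
  move=> msg bsg; apply: (@rint_bounded _ _ _ Q setT (W \o sg) (W 0) measurableT (mW sg msg bsg)) => om _ /=.
  have /andP[h1 h2] := bsg om; have h0 := le_trans t_ge0 h1.
  by rewrite ger0_norm ?W_ge0//; exact: W_le0.
have iW := bW tau mtau tau_bd.
have step n : rint Q setT (fun om => F (taun n om) * Xp (taun n om) om) /\
    \int[Q]_om (F (taun n om) * Xp (taun n om) om) <=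
    G t x + (F t * x - W t) + \int[Q]_om W (tau om).
  have [|k A kn hA|i h] := @grid_stopping_le n (fun k => Yp (grid n k)).
  - by move=> k kn; apply: rint_Yp => //; [exact: grid_ge|exact: grid_leT].
  - by apply: Yp_supermartingale => //; [exact: grid_ge|exact: grid_le|exact: grid_leT].
  have h0 : \int[Q]_om Yp (taun n om) om <= G t x + (F t * x - W t).
    apply: (le_trans h); under eq_Rintegral do rewrite grid0 /Yp Xp_t.
    by rewrite Rintegral_probability_cst.
  have iS : rint Q setT (fun om => Yp (taun n om) om + W (tau om)) by exact: rintD.
  have Gpt om : 0 <= F (taun n om) * Xp (taun n om) om <= Yp (taun n om) om + W (tau om).
    have /andP[h1 h2] := tb n om; have h3 := le_trans t_ge0 h1.
    have /andP[h4 h5] := tau_bd om; have /andP[h6 _] := taun_tau n om.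
    rewrite mulr_ge0 ?Xp_ge0 ?F_ge0//= /Yp.
    have := G_ge0 (Xp (taun n om) om) h3 h2.
    have /andP[] := W_lip (le_trans t_ge0 h4) h6 h2; lra.
  have iF : rint Q setT (fun om => F (taun n om) * Xp (taun n om) om).
    apply: rint_le iS => //.
      apply: measurable_funM; last by apply: mX_stop; exact: mtaun.
      by apply: (mF (taun n)) => //; exact: mtaun.
    by move=> om _; have /andP[h1 h2] := Gpt om; rewrite ger0_norm.
  split => //; apply: (le_trans (le_Rintegral measurableT iF iS _)).
    by move=> om _; have /andP[] := Gpt om.
  by rewrite RintegralD// lerD2r.
have mFX n : measurable_fun setT (fun om => F (taun n om) * Xp (taun n om) om).
  exact: rint_measurable (step n).1.
have cFX om : setT om -> (fun n => F (taun n om) * Xp (taun n om) om) @ \oo -->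
    F (tau om) * Xp (tau om) om.
  by move=> _; apply: cvgM; [exact: cF|exact: Xp_taun_cvg].
have FX0 n om : setT om -> 0 <= F (taun n om) * Xp (taun n om) om.
  move=> _; have /andP[h1 h2] := tb n om; have h3 := le_trans t_ge0 h1.
  by rewrite mulr_ge0 ?Xp_ge0 ?F_ge0.
have [iF h] := @Rintegral_fatou _ _ _ Q setT _ _ measurableT mFX cFX
    (G t x + (F t * x - W t) + \int[Q]_om W (tau om)) FX0
    (fun n => (step n).1) (fun n => (step n).2).
split => //; split => //.
by rewrite RintegralB// lerBlDr.
Qed.

End stopping.

(** Backward construction of the optimal rule: go on past [a] exactly when the continuation value
    [cv] is positive. The identity is stated on every event of [Fi a] because the induction uses it
    on the event of going on. *)
Lemma stopping_attains l a : t <= a -> a <= T1 -> okl a l ->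
  exists tau : Om -> R, [/\ is_stopping_time Fi tau, forall om, a <= tau om <= T1 &
    forall A, Fi a A -> \int[Q]_(om in A) (F (tau om) * Xp (tau om) om - W (tau om)) =
      \int[Q]_(om in A) (Vb l a (Xp a om) + (F a * Xp a om - W a))].
Proof.
elim: l a => [|b l IH] a ta aT /=.
  move=> _; exists (fun=> a); split.
  - move=> u; have [au|ua] := leP a u.
      by rewrite (_ : [set _ | _] = setT); [exact: (FiT Fi_filt)|apply/seteqP; split].
    by rewrite (_ : [set _ | _] = set0); [exact: (Fi0 Fi_filt)|apply/seteqP; split].
  - by move=> om; rewrite lexx.
  - by move=> A hA; apply: eq_Rintegral => om _; rewrite add0r.
move=> [ab bT ol]; have tb := le_trans ta ab; have a0 := le_trans t_ge0 ta.
have b0 := le_trans a0 ab.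
have [tau [st bd E]] := IH b tb bT ol.
pose cv y := rw a b y + Pk (b - a) (Vb l b) y.
have hab := subT a0 ab bT.
have lV := Vb_lip b0 bT ol.
have lcv : lip ((F a - F b) + F b) cv.
  by apply: lipD; [exact: lip_rw|exact: Pk_lip].
pose D := [set om | 0 < cv (Xp a om)].
have DE : D = Xp a @^-1` (cv @^-1` `]0, +oo[%classic).
  by apply/seteqP; split => om /=; rewrite in_itv/= andbT.
have FD : Fi a D.
  rewrite DE; apply: Xp_adapted => //; rewrite -[X in measurable X]setTI.
  by apply: (lip_measurable lcv) => //; exact: measurable_itv.
pose tau' om := if 0 < cv (Xp a om) then tau om else a.
have bd' om : a <= tau' om <= T1.
  rewrite /tau'; case: ifP => _; last by rewrite lexx.
  by have /andP[h1 h2] := bd om; rewrite (le_trans ab).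
have st' : is_stopping_time Fi tau'.
  move=> u; have [au|ua] := leP a u; last first.
    rewrite (_ : [set _ | _] = set0); first exact: (Fi0 Fi_filt).
    apply/seteqP; split => // om /= h; have /andP[h1 _] := bd' om.
    by move: (le_lt_trans h ua); rewrite ltNge h1.
  have -> : [set om | tau' om <= u] = (D `&` [set om | tau om <= u]) `|` ~` D.
    apply/seteqP; split => om /=; rewrite /tau' /D /=.
      by case: ifP => h1 h2; [left|right].
    by move=> [[-> //]|/negP/negbTE ->].
  by apply: (FiU Fi_filt); [apply: (FiI Fi_filt); [exact: (Fi_sub Fi_filt) FD|exact: st]|apply: (FiC Fi_filt); exact: (Fi_sub Fi_filt) FD].
exists tau'; split => // A hA.
have mA := Fi_meas Fi_filt hA; have mD := Fi_meas Fi_filt FD.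
have bdT om : t <= tau' om <= T1 by have /andP[h1 h2] := bd' om; rewrite (le_trans ta).
have [iF [iW _]] := value_le st' bdT.
have iL B : measurable B -> rint Q B (fun om => F (tau' om) * Xp (tau' om) om - W (tau' om)).
  by move=> mB; apply: (integrableS measurableT mB) => //; exact: rintB.
have iR B : measurable B -> rint Q B (fun om => Num.max 0 (cv (Xp a om)) + (F a * Xp a om - W a)).
  move=> mB; apply: (@rint_XpA a B (fun y => Num.max 0 (cv y) + (F a * y - W a))) => //.
  apply: quarticD; first by apply: (@quartic_lip _ ((F a - F b) + F b)); exact: lip_max0.
  apply: quarticB; last exact: quartic_cst.
  by apply: quarticZ; exact: (@quartic_exp _ 1).
have mA1 : measurable (A `&` D) by exact: measurableI.
have mA2 : measurable (A `&` ~` D) by apply: measurableI => //; exact: measurableC.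
have AE : A = (A `&` D) `|` (A `&` ~` D) by rewrite -setIUr setUv setIT.
have dis : [disjoint A `&` D & A `&` ~` D].
  by apply/disj_setPS => om [[_ h1] [_ h2]].
rewrite {1 2}AE !Rintegral_setU//; [|by apply: iR; rewrite -AE|by apply: iL; rewrite -AE].
congr (_ + _); last first.
  apply: eq_Rintegral => om; rewrite inE => -[_ h]; rewrite /tau'.
  move: h; rewrite /D /= => /negP; rewrite -leNgt => h.
  by rewrite ltNge h /= (max_idPl h) add0r.
have FAD : Fi b (A `&` D) by apply: (Fi_sub Fi_filt) ab _; exact: (FiI Fi_filt).
transitivity (\int[Q]_(om in A `&` D) (F (tau om) * Xp (tau om) om - W (tau om))).
  by apply: eq_Rintegral => om; rewrite inE => -[_ h]; rewrite /tau' h.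
rewrite (E _ FAD).
have iX c : t <= c -> c <= T1 -> rint Q (A `&` D) (Xp c).
  by move=> tc cT; apply: (@rint_XpA c (A `&` D) id) => //; exact: (@quartic_exp _ 1).
have iFX c : t <= c -> c <= T1 -> rint Q (A `&` D) (fun om => F b * Xp c om - W b).
  by move=> tc cT; apply: rintB => //; [apply: rintZ => //; exact: iX|exact: rint_cst].
have iV : rint Q (A `&` D) (fun om => Vb l b (Xp b om)).
  by apply: (@rint_XpA b _ (Vb l b)) => //; exact: quartic_lip lV.
have iP : rint Q (A `&` D) (fun om => Pk (b - a) (Vb l b) (Xp a om)).
  by apply: (@rint_XpA a _ (Pk (b - a) (Vb l b))) => //; apply: quartic_lip; exact: Pk_lip lV.
have qV := quartic_lip lV.
have FADa : Fi a (A `&` D) by exact: (FiI Fi_filt).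
have ic : rint Q (A `&` D) (fun=> W b) by exact: rint_cst.
rewrite (RintegralD mA1 iV (iFX b tb bT)).
rewrite (Xp_condR ta ab bT FADa qV (fun y => Vb_ge0 l b y)).
rewrite (RintegralB mA1 (rintZ (F b) mA1 (iX b tb bT)) ic).
rewrite (RintegralZl _ mA1 (iX b tb bT)) (Xp_martingale ta ab bT FADa).
rewrite -(RintegralZl _ mA1 (iX a ta aT)) -(RintegralB mA1 (rintZ (F b) mA1 (iX a ta aT)) ic).
rewrite -(RintegralD mA1 iP (iFX a ta aT)).
apply: eq_Rintegral => om; rewrite inE => -[_]; rewrite /D /= => h.
by rewrite (max_idPr (ltW h)) /cv /rw; ring.
Qed.

Lemma G_gt0_stopping : 0 < G t x ->
  exists tau : Om -> R, [/\ is_stopping_time Fi tau, forall om, t <= tau om <= T1 &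
    F t * x - W t < \int[Q]_om (F (tau om) * Xp (tau om) om - W (tau om))].
Proof.
move=> Gt.
have [_ [l ol ->] Vl] := sup_gt (ex_intro _ 0 (ex_intro2 _ _ [::] I erefl)) Gt.
have [tau [st bd E]] := stopping_attains (lexx t) t_leT1 ol.
exists tau; split => //; rewrite (E _ (FiT Fi_filt t)).
under eq_Rintegral do rewrite Xp_t.
by rewrite Rintegral_probability_cst ltrDr.
Qed.

(** * The boundary representation *)

(** The step 1/(n+1), cut so that it never passes [T1]; for fixed [u < T1] the cut disappears for
    large [n]. *)
Definition hstep (n : nat) (u : R) : R := Num.min n.+1%:R^-1 (T1 - u).

Definition quot (n : nat) (u y : R) : R :=
  n.+1%:R * (Pk (hstep n u) (G (u + hstep n u)) y - G u y).

Lemma hstep_near (u eta : R) : u < T1 -> 0 < eta ->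
  \forall n \near \oo, 0 < hstep n u < eta /\ hstep n u = n.+1%:R^-1.
Proof.
move=> uT e0.
have h_cvg : (fun n : nat => n.+1%:R^-1) @ \oo --> (0 : R) by exact: cvg_harmonic.
have m0 : 0 < Num.min eta (T1 - u) by rewrite lt_min e0 subr_gt0.
near=> n.
have : `|0 - n.+1%:R^-1 : R| < Num.min eta (T1 - u).
  by near: n; exact: cvgr_dist_lt.
rewrite sub0r normrN gtr0_norm ?invr_gt0// lt_min => /andP[h1 h2].
by rewrite /hstep (min_idPl (ltW h2)) h1 andbT invr_gt0; split => //; exact: ltr0Sn.
Unshelve. all: by end_near. Qed.

Lemma hstep_bd n u : u <= T1 -> 0 <= hstep n u /\ u + hstep n u <= T1 /\ n.+1%:R * hstep n u <= 1.
Proof.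
move=> uT; split; first by rewrite le_min subr_ge0 uT andbT invr_ge0.
split; first by rewrite addrC -lerBrDr ge_min lexx orbT.
by rewrite -ler_pdivlMl// mulr1 ge_min lexx.
Qed.

Lemma G_diff_bound a b y : 0 <= a -> a <= b -> b <= T1 -> 0 <= y ->
  `|Pk (b - a) (G b) y - G a y| <= (CW + CF * y) * (b - a).
Proof.
move=> a0 ab bT y0.
have g1 := G_super a0 ab bT y0; have g2 := G_le_W_excess a0 ab bT y0.
have [_ w2] := andP (W_lip a0 ab bT); have [_ f2] := andP (F_lip a0 ab bT).
have r1 := @rw_ge_F a b y a0 ab bT.
have fy := ler_wpM2r y0 f2.
have cy : 0 <= CF * (b - a) * y by rewrite !mulr_ge0 ?subr_ge0.
have cw : 0 <= CW * (b - a) by rewrite mulr_ge0 ?subr_ge0.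
rewrite ler_norml mulrDl [CF * y * _]mulrAC; apply/andP; split; lra.
Qed.

Lemma quot_bound n u y : 0 <= u -> u <= T1 -> 0 <= y -> `|quot n u y| <= CW + CF * y.
Proof.
move=> u0 uT y0; have [h0 [hT hn]] := hstep_bd n uT.
have uh : u <= u + hstep n u by rewrite lerDl.
have := G_diff_bound u0 uh hT y0; rewrite addrAC subrr add0r => gb.
rewrite /quot normrM ger0_norm//.
apply: (le_trans (ler_wpM2l _ gb)) => //; rewrite mulrCA -[leRHS]mulr1 ler_wpM2l//.
by rewrite addr_ge0// mulr_ge0.
Qed.

Lemma rw_slope (u y e : R) : 0 <= u -> u < T1 -> 0 <= y -> 0 < e ->
  exists2 eta : R, 0 < eta & forall h : R, 0 < h -> h < eta -> u + h <= T1 ->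
    `|rw u (u + h) y - (w u - f u * y) * h| <= e * h.
Proof.
move=> u0 uT y0 e0.
have y1 : 0 < 1 + y by rewrite ltr_wpDr.
have e1 : 0 < e / (1 + y) by rewrite divr_gt0.
have ub : 0 <= u <= T1 by rewrite u0 ltW.
have [eta eta0 H] := WF_slope ub e1; exists eta => // h h0 he uhT.
have uh : u <= u + h by rewrite lerDl ltW.
have d1 : `|u - u| < eta by rewrite subrr normr0.
have d2 : `|u + h - u| < eta by rewrite addrAC subrr add0r gtr0_norm.
have [] := H u (u + h) u0 uh uhT d1 d2.
rewrite [u + h - u]addrAC subrr add0r => H1 H2.
have -> : rw u (u + h) y - (w u - f u * y) * h =
    (W u - W (u + h) - w u * h) - (F u - F (u + h) - f u * h) * y by rewrite /rw; ring.
apply: (le_trans (ler_normB _ _)); rewrite normrM (ger0_norm y0).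
apply: (le_trans (lerD H1 (ler_wpM2r y0 H2))).
have -> : e / (1 + y) * h + e / (1 + y) * h * y = e * h.
  by field; rewrite gt_eqF.
exact: lexx.
Qed.

(** [G_super] bounds the increment [P G - G] above by [- rw], [G_excess_small] bounds it below by
    [- rw - C h^2], and [rw] has slope [w u - f u * y]. *)
Lemma quot_cvg_pos u y : 0 <= u -> u < T1 -> 0 <= y -> 0 < G u y ->
  (fun n => quot n u y) @ \oo --> - (w u - f u * y).
Proof.
move=> u0 uT y0 G0; apply/cvgrPdist_le => eps eps0.
have [C [eta1 eta10 H1]] := G_excess_small u0 uT y0 G0.
have eps2 : 0 < eps / 2 by rewrite divr_gt0.
have [eta2 eta20 H2] := rw_slope u0 uT y0 eps2.
have C1 : 0 < `|C| + 1 by rewrite ltr_wpDl.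
near=> n.
have [/andP[h0 hm] hn] : 0 < hstep n u < Num.min eta1 (Num.min eta2 (eps / 2 / (`|C| + 1))) /\
    hstep n u = n.+1%:R^-1.
  by near: n; apply: hstep_near => //; rewrite !lt_min eta10 eta20 divr_gt0.
move: hm; rewrite !lt_min => /and3P[h1 h2 h3].
have [hT E1] := H1 _ h0 h1; have E2 := H2 _ h0 h2 hT.
have uh : u <= u + hstep n u by rewrite lerDl ltW.
have := G_super u0 uh hT y0; rewrite [_ - u]addrAC subrr add0r => E3.
have E4 : C * hstep n u ^+ 2 <= eps / 2 * hstep n u.
  rewrite expr2 mulrA ler_wpM2r ?(ltW h0)//.
  move: h3; rewrite ltr_pdivlMr// mulrC => /ltW; apply: le_trans.
  by rewrite ler_wpM2r ?(ltW h0)// (le_trans (ler_norm C))// lerDl.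
have E5 : `|- (w u - f u * y) * hstep n u - (Pk (hstep n u) (G (u + hstep n u)) y - G u y)|
    <= eps * hstep n u.
  move: E2; rewrite !ler_norml => /andP[E21 E22]; apply/andP; split; lra.
have -> : - (w u - f u * y) - quot n u y = n.+1%:R * (- (w u - f u * y) * hstep n u -
    (Pk (hstep n u) (G (u + hstep n u)) y - G u y)).
  rewrite /quot [RHS]mulrBr; congr (_ - _).
  by rewrite hn mulrCA mulfV ?mulr1// pnatr_eq0.
rewrite normrM ger0_norm// (le_trans (ler_wpM2l _ E5))//.
by rewrite mulrCA hn mulfV ?mulr1// pnatr_eq0.
Unshelve. all: by end_near. Qed.

Lemma quot_cvg_zero u x0 y : 0 <= u -> u < T1 -> 0 <= x0 -> x0 < y -> G u x0 = 0 ->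
  (fun n => quot n u y) @ \oo --> (0 : R).
Proof.
move=> u0 uT x00 xy G0; apply/cvgrPdist_le => eps eps0.
have y0 : 0 <= y by rewrite (le_trans x00)// ltW.
have [C [eta1 eta10 H1]] := PG_right_small u0 uT x00 xy G0.
have C1 : 0 < `|C| + 1 by rewrite ltr_wpDl.
have Gy : G u y = 0.
  apply/eqP; rewrite eq_le G_ge0 ?(ltW uT)// andbT -G0.
  by apply: G_nincr; rewrite // ltW.
near=> n.
have [/andP[h0 hm] hn] : 0 < hstep n u < Num.min eta1 (eps / (`|C| + 1)) /\
    hstep n u = n.+1%:R^-1.
  by near: n; apply: hstep_near => //; rewrite !lt_min eta10 divr_gt0.
move: hm; rewrite !lt_min => /andP[h1 h3].
have [hT E1] := H1 _ h0 h1.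
have P0 : 0 <= Pk (hstep n u) (G (u + hstep n u)) y.
  by apply: Pk_ge0 => z; rewrite G_ge0// addr_ge0// ltW.
have E4 : C * hstep n u ^+ 2 <= eps * hstep n u.
  rewrite expr2 mulrA ler_wpM2r ?(ltW h0)//.
  move: h3; rewrite ltr_pdivlMr// mulrC => /ltW; apply: le_trans.
  by rewrite ler_wpM2r ?(ltW h0)// (le_trans (ler_norm C))// lerDl.
rewrite /quot Gy subr0 sub0r normrN normrM !ger0_norm//.
rewrite (le_trans (ler_wpM2l _ (le_trans E1 E4)))//.
by rewrite mulrCA hn mulfV ?mulr1// pnatr_eq0.
Unshelve. all: by end_near. Qed.

(* Only a first zero of [G u] is left out of the two limits above. *)
Lemma quot_cvg u y : 0 <= u -> u < T1 -> 0 <= y ->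
  (G u y = 0 -> exists2 x0 : R, 0 <= x0 < y & G u x0 = 0) ->
  (fun n => quot n u y) @ \oo --> - (w u - f u * y) * (0 < G u y)%R%:R.
Proof.
move=> u0 uT y0 H; have := G_ge0 y u0 (ltW uT); rewrite le_eqVlt => /orP[/eqP G0|G0].
  rewrite -G0 ltxx mulr0; have [x0 /andP[x00 xy] Gx0] := H (esym G0).
  exact: quot_cvg_zero x00 xy Gx0.
by rewrite G0 mulr1; exact: quot_cvg_pos.
Qed.

(** * The mean gain as a Lipschitz function of time *)

Definition EG (u : R) : R := \int[Q]_om G u (Xp u om).

Lemma quartic_PkG a b : 0 <= a -> a <= b -> b <= T1 -> quartic (Pk (b - a) (G b)).
Proof.
move=> a0 ab bT; apply: (@quartic_lip _ (F b)); apply: Pk_lip.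
  by rewrite subr_ge0 ab /=; lra.
by apply: G_lip => //; exact: le_trans ab.
Qed.

Lemma E_Xp u : t <= u -> u <= T1 -> \int[Q]_om Xp u om = x.
Proof.
move=> tu uT; rewrite (Xp_martingale (lexx t) tu uT (FiT Fi_filt t)).
by under eq_Rintegral => om _ do rewrite Xp_t; exact: Rintegral_probability_cst.
Qed.

Lemma EG_diff a b : t <= a -> a <= b -> b <= T1 ->
  EG b - EG a = \int[Q]_om (Pk (b - a) (G b) (Xp a om) - G a (Xp a om)).
Proof.
move=> ta ab bT; have a0 : 0 <= a by exact: le_trans ta.
have b0 : 0 <= b by exact: le_trans ab.
have aT : a <= T1 by exact: le_trans bT.
rewrite RintegralB//; last 2 first.
- by apply: rint_Xp => //; exact: quartic_PkG.
- by apply: rint_Xp => //; exact: G_quartic.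
congr (_ - _); apply: (Xp_condR ta ab bT (FiT Fi_filt a)); first exact: G_quartic.
by move=> y; exact: G_ge0.
Qed.

Lemma EG_lip_le a b : t <= a -> a <= b -> b <= T1 ->
  `|EG b - EG a| <= (CW + CF * x) * (b - a).
Proof.
move=> ta ab bT; have a0 : 0 <= a by exact: le_trans ta.
have b0 : 0 <= b by exact: le_trans ab.
have aT : a <= T1 by exact: le_trans bT.
have i1 : rint Q setT (fun om => Pk (b - a) (G b) (Xp a om)).
  by apply: rint_Xp => //; exact: quartic_PkG.
have i2 : rint Q setT (fun om => G a (Xp a om)) by apply: rint_Xp => //; exact: G_quartic.
have i3 : rint Q setT (fun om => CF * Xp a om) by apply: rintZ => //; exact: rint_id.
have i4 : rint Q setT (fun om => (CW + CF * Xp a om) * (b - a)).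
  by apply: rintZr => //; apply: rintD => //; exact: rint_cst.
rewrite EG_diff//; apply: (le_trans (le_normr_Rintegral _ (rintB measurableT i1 i2))) => //.
have -> : (CW + CF * x) * (b - a) = \int[Q]_om ((CW + CF * Xp a om) * (b - a)).
  rewrite RintegralZr//; last by apply: rintD => //; exact: rint_cst.
  rewrite RintegralD//; last exact: rint_cst.
  by rewrite Rintegral_probability_cst RintegralZl ?E_Xp//; exact: rint_id.
apply: le_Rintegral => //; first by apply: rint_norm => //; exact: rintB.
by move=> om _; apply: G_diff_bound => //; exact: Xp_ge0.
Qed.

Definition clampT (u : R) : R := Num.max t (Num.min u T1).

Lemma clampT_id u : t <= u -> u <= T1 -> clampT u = u.
Proof. by move=> tu uT; rewrite /clampT (min_idPl uT) (max_idPr tu). Qed.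

Lemma clampT_bd u : t <= clampT u /\ clampT u <= T1.
Proof. by rewrite /clampT le_max lexx ge_max t_leT1 ge_min lexx orbT. Qed.

Lemma clampT_le u v : u <= v -> 0 <= clampT v - clampT u <= v - u.
Proof.
move=> uv; rewrite /clampT /Num.max /Num.min.
case: (ltP u T1) => h1; case: (ltP v T1) => h2; case: ltP => h3; case: ltP => h4;
  apply/andP; split; lra.
Qed.

Lemma lip_of_le (C : R) (phi : R -> R) : 0 <= C ->
  (forall a b, t <= a -> a <= b -> b <= T1 -> `|phi b - phi a| <= C * (b - a)) ->
  lip C (phi \o clampT).
Proof.
move=> C0 H; suff S (u v : R) : u <= v -> `|phi (clampT v) - phi (clampT u)| <= C * `|v - u|.
  move=> u v; case/orP: (le_total u v) => uv /=; last exact: S.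
  by rewrite distrC [X in _ * X]distrC; exact: S.
move=> uv; have [c0 c1] := andP (clampT_le uv).
rewrite subr_ge0 in c0.
apply: (le_trans (H _ _ (clampT_bd u).1 c0 (clampT_bd v).2)).
by rewrite ler_wpM2l// ger0_norm// subr_ge0.
Qed.

Lemma EG_lip : lip (CW + CF * x) (EG \o clampT).
Proof.
apply: lip_of_le; last exact: EG_lip_le.
by rewrite addr_ge0// mulr_ge0.
Qed.

Lemma EG_quot n u : t <= u -> u <= T1 ->
  \int[Q]_om quot n u (Xp u om) = n.+1%:R * (EG (u + hstep n u) - EG u).
Proof.
move=> tu uT; have [h0 [hT _]] := hstep_bd n uT.
have uh : u <= u + hstep n u by rewrite lerDl.
rewrite (EG_diff tu uh hT) [u + _ - u]addrAC subrr add0r.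
rewrite -RintegralZl//; apply: rintB => //; apply: rint_Xp => //.
  have := quartic_PkG (le_trans t_ge0 tu) uh hT.
  by rewrite [u + _ - u]addrAC subrr add0r.
by apply: G_quartic => //; exact: le_trans tu.
Qed.

Lemma EG_step_near u : t < u -> u < T1 ->
  \forall n \near \oo, n.+1%:R * ((EG \o clampT) (u + n.+1%:R^-1) - (EG \o clampT) u) =
    \int[Q]_om quot n u (Xp u om).
Proof.
move=> tu uT; near=> n.
have [/andP[h0 _] hn] : 0 < hstep n u < 1 /\ hstep n u = n.+1%:R^-1.
  by near: n; exact: hstep_near.
have [_ [hT _]] := hstep_bd n (ltW uT).
rewrite EG_quot ?(ltW tu) ?(ltW uT)//= -hn !clampT_id ?(ltW tu) ?(ltW uT)//.
by rewrite (le_trans (ltW tu))// lerDl ltW.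
Unshelve. all: by end_near. Qed.

Definition jump (u : R) (om : Om) : R := (w u - f u * Xp u om) * (0 < G u (Xp u om))%R%:R.

Lemma EG_T1 : EG T1 = 0.
Proof.
rewrite /EG; under eq_Rintegral => om _ do rewrite G_T1_eq0 ?Xp_ge0//.
exact: Rintegral_probability_cst.
Qed.

Lemma EG_t : EG t = G t x.
Proof.
rewrite /EG; under eq_Rintegral => om _ do rewrite Xp_t.
exact: Rintegral_probability_cst.
Qed.

Hypotheses (M_atom : s != 0 -> forall h c : R, 0 < h -> Q (M h @^-1` [set c]) = 0%E)
  (M_det : s = 0 -> forall h om, M h om = 1)
  (w_cont : continuous w) (f_cont : continuous f) (t_ltT1 : t < T1) (x_gt0 : 0 < x).

Let clampT_continuous : continuous clampT.
Proof.
have l1 : lip 1 (id \o clampT).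
  by apply: lip_of_le => // a b _ ab _; rewrite mul1r ger0_norm// subr_ge0.
exact: lip_continuous l1.
Qed.

Let mXc : measurable_fun setT (fun z : R * Om => Xp (clampT z.1) z.2).
Proof.
apply: (measurable_fun_joint_continuous (X := fun u om => Xp (clampT u) om)).
  by move=> u; exact: mXp.
move=> om u; apply: cvgMr; apply: cvgMl.
by apply: (@cvg_comp _ _ _ clampT (M ^~ om)); [exact: clampT_continuous|exact: M_cont].
Qed.

(** Continuity of [G] in time is known for nonnegative space arguments, hence the absolute value,
    which changes nothing along the process. *)
Let mGc : measurable_fun setT (fun z : R * R => G (clampT z.1) `|z.2|).
Proof.
have Gc (y u : R) : (fun v : R => G (clampT v) `|y|) @ u --> G (clampT u) `|y|.
  have [c1 c2] := clampT_bd u; have c0 := le_trans t_ge0 c1.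
  apply/cvgrPdist_le => e e0.
  have [eta eta0 H] := G_cont c0 c2 (normr_ge0 y) e0.
  near=> v; have [d1 d2] := clampT_bd v; have d0 := le_trans t_ge0 d1.
  rewrite distrC; apply: H => //; rewrite distrC; near: v.
  by move/cvgrPdist_lt : (@clampT_continuous u); exact.
apply: (measurable_fun_joint_continuous (X := fun u y => G (clampT u) `|y|)); last exact: Gc.
move=> u; have [c1 c2] := clampT_bd u.
apply: measurableT_comp; last exact: normr_measurable.
by apply: lip_measurable; apply: G_lip => //; exact: le_trans c1.
Unshelve. all: by end_near. Qed.

Lemma jump_joint_measurable :
  measurable_fun setT (fun z : R * Om => jump (clampT z.1) z.2).
Proof.
have mG' : measurable_fun setT (fun z : R * Om => G (clampT z.1) (Xp (clampT z.1) z.2)).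
  have := measurableT_comp mGc (measurable_fun_pair (@measurable_fst _ _ _ _) mXc).
  by apply: eq_measurable_fun => z _ /=; rewrite ger0_norm ?Xp_ge0.
have mc (g : R -> R) : continuous g -> measurable_fun setT (fun z : R * Om => g (clampT z.1)).
  move=> cg; apply: (@measurableT_comp _ _ _ _ _ _ (g \o clampT)) => //.
  apply: continuous_measurable_fun => u.
  by apply: (@cvg_comp _ _ _ clampT g); [exact: clampT_continuous|exact: cg].
apply: measurable_funM.
  apply: measurable_funB; first exact: mc.
  by apply: measurable_funM => //; exact: mc.
have mS : measurable ((fun z : R * Om => G (clampT z.1) (Xp (clampT z.1) z.2)) @^-1` `]0, +oo[).
  by rewrite -[X in measurable X]setTI; exact: mG'.
have := measurable_indic mS (R := R) (D := setT).
apply: eq_measurable_fun => z _ /=.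
rewrite indicE; congr (nat_of_bool _)%:R.
by apply/idP/idP; rewrite inE /= in_itv/= andbT.
Qed.

Lemma jump_measurable u : t <= u -> u <= T1 -> measurable_fun setT (jump u).
Proof.
move=> tu uT; have h := measurableT_comp jump_joint_measurable
  (measurable_fun_pair (measurable_cst u) (@measurable_id _ Om setT)).
by apply: eq_measurable_fun h => om _ /=; rewrite clampT_id.
Qed.

(** The kernel from time [t] turns an atom of [Xp u] at [c] into an atom of [M (u - t)] at
    [c / x]. *)
Lemma Xp_atom u c : s != 0 -> t < u -> u <= T1 -> Q (Xp u @^-1` [set c]) = 0%E.
Proof.
move=> sn0 tu uT; pose phi : R -> R := \1_[set c].
have phi0 y : 0 <= phi y by rewrite /phi indicE.
have qphi : quartic phi.
  split; first exact: measurable_indic.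
  exists 1 => y; rewrite mul1r ger0_norm// /phi indicE.
  by apply: (@le_trans _ _ 1); [case: (_ \in _)|rewrite lerDl exprn_even_ge0].
have ut : 0 <= u - t <= T1 by rewrite subr_ge0 (ltW tu) lerBlDr (le_trans uT)// lerDl.
have Pphi : Pk (u - t) phi x = 0.
  rewrite /Pk /Rintegral.
  have -> : (\int[Q]_om (phi (x * M (u - t) om))%:E =
             \int[Q]_om (\1_(M (u - t) @^-1` [set (c / x)%R]) om)%:E)%E.
    apply: eq_integral => om _; rewrite /phi !indicE; congr (nat_of_bool _)%:R%:E.
    apply/idP/idP; rewrite !inE /=.
      by move=> <-; rewrite [_ * _ / _]mulrAC mulfV ?mul1r// gt_eqF.
    by move=> ->; rewrite mulrCA mulfV ?mulr1// gt_eqF.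
  rewrite integral_indic//; last by rewrite -[X in measurable X]setTI; exact: mM.
  by rewrite -[RHS]/(fine 0%E) setIT; congr fine; apply: M_atom; rewrite ?subr_gt0.
have mXu : measurable (Xp u @^-1` [set c]) by rewrite -[X in measurable X]setTI; exact: mXp.
have := Xp_cond (lexx t) (ltW tu) uT (FiT Fi_filt t) qphi phi0.
under [in RHS]eq_integral => om _ do rewrite Xp_t Pphi.
rewrite integral0 => <-.
transitivity (\int[Q]_om (\1_(Xp u @^-1` [set c]) om)%:E)%E.
  by rewrite integral_indic// setIT.
by apply: eq_integral => om _; rewrite /phi !indicE; congr (nat_of_bool _)%:R%:E;
  apply/idP/idP; rewrite !inE.
Qed.

(** Where [G] is positive the jump is minus the limit of the quotients and inherits their bound;
    elsewhere it is zero. *)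
Lemma jump_bound u om : 0 <= u -> u < T1 -> `|jump u om| <= CW + CF * Xp u om.
Proof.
move=> u0 uT; have y0 := Xp_ge0 u om; rewrite /jump.
have := G_ge0 (Xp u om) u0 (ltW uT); rewrite le_eqVlt => /orP[/eqP <-|G0].
  by rewrite ltxx mulr0 normr0 addr_ge0// mulr_ge0.
rewrite G0 mulr1 -normrN.
have := quot_cvg_pos u0 uT y0 G0 => /cvg_norm hc.
rewrite -(cvg_lim _ hc)//; apply: limr_le; first by apply/cvg_ex; eexists; exact: hc.
by near=> n; apply: quot_bound => //; exact: ltW.
Unshelve. all: by end_near. Qed.

(** The one zero of [G u] without a smaller zero is a smallest one. If there is no smallest zero, no
    point is exceptional and any [c] will do. *)
Lemma first_zero u : 0 <= u -> u <= T1 -> exists c, forall y, 0 <= y -> y != c ->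
  G u y = 0 -> exists2 x0 : R, 0 <= x0 < y & G u x0 = 0.
Proof.
move=> u0 uT.
case: (pselect (exists2 c, 0 <= c & G u c = 0 /\ forall z, 0 <= z < c -> G u z != 0)).
  move=> [c c0 [Gc zc]]; exists c => y y0 yc Gy; exists c => //; rewrite c0 lt_neqAle eq_sym yc /=.
  by rewrite leNgt; apply/negP => yc'; have := zc y; rewrite y0 yc' Gy eqxx => /(_ isT).
move=> h; exists 0 => y y0 _ Gy; apply: contrapT => h2; apply: h.
exists y => //; split => // z zy; apply/negP => /eqP Gz.
by apply: h2; exists z.
Qed.

(** The exceptional point of [first_zero] carries no mass because the law of [Xp u] has no atoms.
    The quotients thus converge almost everywhere, and [quot_bound] dominates them. *)
Lemma EG_deriv_random u : s != 0 -> t < u -> u < T1 ->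
  (fun n => n.+1%:R * ((EG \o clampT) (u + n.+1%:R^-1) - (EG \o clampT) u)) @ \oo -->
    - \int[Q]_om jump u om.
Proof.
move=> sn0 tu uT; have u0 : 0 <= u by exact: le_trans (ltW tu).
have [c Hc] := first_zero u0 (ltW uT).
pose N := Xp u @^-1` [set c].
have mN : measurable N by rewrite -[X in measurable X]setTI; exact: mXp.
have N0 : Q N = 0%E by exact: Xp_atom (ltW uT).
have ig : rint Q setT (fun om => CW + CF * Xp u om).
  apply: rintD => //; first exact: rint_cst.
  by apply: rintZ => //; apply: rint_id => //; exact: ltW.
have mq n : measurable_fun setT (fun om => quot n u (Xp u om)).
  have [h0 [hT _]] := hstep_bd n (ltW uT).
  have uh : u <= u + hstep n u by rewrite lerDl.
  apply: (@measurableT_comp _ _ _ _ _ _ (quot n u)); last exact: mXp.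
  apply: measurable_funM => //; apply: measurable_funB.
    by have := (quartic_PkG u0 uh hT).1; rewrite [u + _ - u]addrAC subrr add0r.
  by apply: lip_measurable; apply: G_lip => //; exact: ltW.
have qb n om : `|quot n u (Xp u om)| <= CW + CF * Xp u om.
  by apply: quot_bound (ltW uT) (Xp_ge0 _ _).
have iq n : rint Q setT (fun om => quot n u (Xp u om)) by apply: rint_le ig.
have ij : rint Q setT (jump u).
  apply: rint_le ig => //; first by apply: jump_measurable; exact: ltW.
  by move=> om _; exact: jump_bound.
have RN (g : Om -> R) : rint Q setT g -> \int[Q]_om g om = \int[Q]_(om in setT `\` N) g om.
  by move=> ig'; rewrite /Rintegral; congr fine; exact: negligible_integral.
have mD : measurable (setT `\` N) by exact: measurableD.
have mq' n : measurable_fun (setT `\` N) (fun om => quot n u (Xp u om)) by exact: measurable_funTS.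
have cq om : (setT `\` N) om -> (fun n => quot n u (Xp u om)) @ \oo --> - jump u om.
  move=> [_ hom]; rewrite /jump -mulNr; apply: quot_cvg => //; first exact: Xp_ge0.
  by move=> Gy; apply: Hc => //; [exact: Xp_ge0|apply/eqP => /hom].
have ig' : rint Q (setT `\` N) (fun om => CW + CF * Xp u om) by apply: integrableS ig.
have [_ cv] := @Rintegral_dominated _ _ _ Q _ _ _ mD mq' cq _ ig' (fun n om _ => qb n om).
have -> : - (\int[Q]_om jump u om) = \int[Q]_(om in setT `\` N) (- jump u om).
  rewrite RN// -[LHS]mulN1r -RintegralZl//; first by apply: eq_Rintegral => om _; rewrite mulN1r.
  by apply: integrableS ij.
apply: cvg_trans cv; apply: near_eq_cvg; near=> n.
rewrite -RN//; symmetry; near: n; exact: EG_step_near.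
Unshelve. all: by end_near. Qed.

Lemma EGc_ge0 u : 0 <= (EG \o clampT) u.
Proof.
have [c1 c2] := clampT_bd u; apply: Rintegral_ge0 => // om _.
by apply: G_ge0 => //; exact: le_trans c1.
Qed.

(* In the deterministic case the path may run along the boundary, where [EG] need not
   be differentiable; the damping [y |-> y ^ 2 / (y + eps)] removes these points. *)
Definition damp (eps y : R) : R := y - eps + eps ^+ 2 / (y + eps).

Lemma dampB eps a b : 0 < eps -> 0 <= a -> 0 <= b ->
  damp eps a - damp eps b = (a - b) * (1 - eps ^+ 2 / ((a + eps) * (b + eps))).
Proof.
move=> e0 a0 b0; have a1 : a + eps != 0 by rewrite gt_eqF// ltr_wpDl.
have b1 : b + eps != 0 by rewrite gt_eqF// ltr_wpDl.
by rewrite /damp; field; rewrite a1 b1.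
Qed.

Lemma damp_factor eps a b : 0 < eps -> 0 <= a -> 0 <= b ->
  0 <= 1 - eps ^+ 2 / ((a + eps) * (b + eps)) <= 1.
Proof.
move=> e0 a0 b0; have ab : 0 < (a + eps) * (b + eps) by rewrite mulr_gt0// ltr_wpDl.
rewrite subr_ge0 ler_pdivrMr// mul1r gerBl divr_ge0 ?sqr_ge0 ?(ltW ab)// andbT.
by rewrite expr2 ler_pM ?lerDr// ltW.
Qed.

Let E0 := EG \o clampT.
Let Lc := CW + CF * x.

Let Lc_ge0 : 0 <= Lc. Proof. by rewrite addr_ge0// mulr_ge0. Qed.

Lemma damp_lip eps : 0 < eps -> lip Lc (damp eps \o E0).
Proof.
move=> e0 u v /=; rewrite dampB ?EGc_ge0// normrM.
have /andP[k0 k1] := damp_factor e0 (EGc_ge0 u) (EGc_ge0 v).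
rewrite (ger0_norm k0); apply: le_trans (EG_lip u v).
by rewrite -[leRHS]mulr1 ler_wpM2l.
Qed.

Lemma EG_det u om : s = 0 -> jump u om = (w u - f u * x) * (0 < EG u)%R%:R /\ EG u = G u x.
Proof.
move=> sE; have Xx o : Xp u o = x by rewrite /Xp !M_det// divff ?mulr1// oner_neq0.
have EE : EG u = G u x.
  by rewrite /EG; under eq_Rintegral => o _ do rewrite Xx; exact: Rintegral_probability_cst.
by rewrite EE /jump Xx.
Qed.

Let Jd (u : R) : R := - ((w u - f u * x) * (0 < EG u)%R%:R).

Let Dn (n : nat) (u : R) : R := n.+1%:R * (E0 (u + n.+1%:R^-1) - E0 u).

Let Dn_bound n u : `|Dn n u| <= Lc.
Proof.
rewrite normrM ger0_norm// -ler_pdivlMl//.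
apply: (le_trans (EG_lip _ _)); rewrite addrAC subrr add0r gtr0_norm ?invr_gt0//.
by rewrite mulrC.
Qed.

Let Dn_cvg u : s = 0 -> t < u -> u < T1 -> 0 < EG u -> Dn ^~ u @ \oo --> Jd u.
Proof.
move=> sE tu uT EG0; have u0 : 0 <= u by exact: le_trans (ltW tu).
have EGE v : EG v = G v x by case: (EG_det v point sE).
have G0 : 0 < G u x by rewrite -EGE.
have := quot_cvg_pos u0 uT x_ge0 G0; rewrite /Jd EG0 mulr1.
apply: cvg_trans; apply: near_eq_cvg; near=> n.
rewrite /Dn; transitivity (\int[Q]_om quot n u (Xp u om)).
  have -> : (fun om => quot n u (Xp u om)) = (fun=> quot n u x).
    by apply/funext => om; congr quot; rewrite /Xp !M_det// divff ?mulr1// oner_neq0.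
  by rewrite Rintegral_probability_cst.
by symmetry; near: n; exact: EG_step_near.
Unshelve. all: by end_near. Qed.

(** By [dampB] the quotient of the damped function is the bounded quotient [Dn] times a factor.
    Where [E0 u > 0] both converge; where [E0 u = 0] the factor tends to zero and boundedness of
    [Dn] suffices. *)
Let damp_deriv eps u : s = 0 -> 0 < eps -> t < u -> u < T1 ->
  (fun n => n.+1%:R * ((damp eps \o E0) (u + n.+1%:R^-1) - (damp eps \o E0) u)) @ \oo -->
    Jd u * (1 - eps ^+ 2 / ((E0 u + eps) * (E0 u + eps))).
Proof.
move=> sE e0 tu uT.
have -> : (fun n => n.+1%:R * ((damp eps \o E0) (u + n.+1%:R^-1) - (damp eps \o E0) u)) =
    (fun n => Dn n u * (1 - eps ^+ 2 / ((E0 (u + n.+1%:R^-1) + eps) * (E0 u + eps)))).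
  by apply/funext => n; rewrite /= dampB ?EGc_ge0// mulrA.
have ep : 0 < E0 u + eps by rewrite ltr_wpDl// EGc_ge0.
have ck : (fun n => 1 - eps ^+ 2 / ((E0 (u + n.+1%:R^-1) + eps) * (E0 u + eps))) @ \oo -->
    1 - eps ^+ 2 / ((E0 u + eps) * (E0 u + eps)).
  apply: cvgB; first exact: cvg_cst.
  apply: cvgMr; apply: cvgV; first by rewrite mulf_neq0 ?gt_eqF.
  apply: cvgMl; apply: cvgD; last exact: cvg_cst.
  apply: (@cvg_comp _ _ _ (fun n : nat => u + n.+1%:R^-1) E0 _ (nbhs u)); last first.
    exact: (lip_continuous EG_lip).
  have : (fun n : nat => u + n.+1%:R^-1) @ \oo --> u + 0.
    by apply: cvgD; [exact: cvg_cst|exact: cvg_harmonic].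
  by rewrite addr0.
have := EGc_ge0 u; rewrite le_eqVlt => /orP[/eqP Eu|Eu]; last first.
  by apply: cvgM ck; apply: Dn_cvg; rewrite // -(@clampT_id u) ?ltW.
have Eu0 : E0 u = 0 by [].
have J0 : Jd u = 0.
  by rewrite /Jd -(@clampT_id u) ?ltW// -[EG _]/(E0 u) Eu0 ltxx mulr0 oppr0.
rewrite J0 mul0r; move: ck; rewrite Eu0 !add0r -expr2 divff ?subrr ?expf_eq0/= ?gt_eqF// => ck.
apply/norm_cvg0P.
apply: (@squeeze_cvgr _ _ _ _ (fun=> 0)
  (fun n => Lc * (1 - eps ^+ 2 / ((E0 (u + n.+1%:R^-1) + eps) * eps)))).
- near=> n; rewrite normr_ge0 normrM /=.
  have /andP[k0 k1] := damp_factor e0 (EGc_ge0 (u + n.+1%:R^-1)) (lexx (0 : R)).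
  by rewrite add0r in k0; rewrite (ger0_norm k0) ler_wpM2r ?Dn_bound.
- exact: cvg_cst.
- by rewrite -[X in _ --> X](mulr0 Lc); apply: cvgMr.
Unshelve. all: by end_near. Qed.

Let mu := @lebesgue_measure R.

(** The fundamental theorem is applied to [damp eps \o E0], which vanishes at both ends. As [eps]
    tends to zero, the damping factor tends to one where [E0 u] is nonzero, while [Jd u] vanishes at
    all other points. *)
Lemma R1_det : s = 0 -> G t x = 0 -> rint mu `]t, T1[ Jd /\ \int[mu]_(u in `]t, T1[) Jd u = 0.
Proof.
move=> sE Gt.
pose ep (k : nat) : R := k.+1%:R^-1.
have ep0 k : 0 < ep k by rewrite invr_gt0.
have damp0 eps : 0 < eps -> damp eps 0 = 0.
  by move=> e0; rewrite /damp sub0r add0r expr2 mulfK ?addNr// gt_eqF.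
have E0t : E0 t = 0 by rewrite /E0 /= clampT_id// EG_t.
have E0T : E0 T1 = 0 by rewrite /E0 /= clampT_id// EG_T1.
have H k := lip_FTC Lc_ge0 t_leT1 (damp_lip (ep0 k))
  (fun u tuT => damp_deriv sE (ep0 k) (andP tuT).1 (andP tuT).2).
have J1 u : t < u < T1 -> `|Jd u| <= Lc.
  move=> /andP[tu uT]; have u0 : 0 <= u by exact: le_trans (ltW tu).
  have [jE _] := EG_det u point sE.
  rewrite /Jd -jE normrN; apply: (le_trans (jump_bound point u0 uT)).
  by rewrite /Xp !M_det// divff ?mulr1// oner_neq0.
have mab : measurable (`]t, T1[%classic : set R) by exact: measurable_itv.
have iC : rint mu `]t, T1[ (fun=> Lc).
  apply: (@integrableS _ _ _ mu `[t, T1]) => //; first exact: subset_itv_oo_cc.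
  by apply: rint_continuous => z; exact: cvg_cst.
have cJ u : (`]t, T1[%classic : set R) u ->
    (fun k => Jd u * (1 - ep k ^+ 2 / ((E0 u + ep k) * (E0 u + ep k)))) @ \oo --> Jd u.
  rewrite /= in_itv/= => /andP[tu uT].
  have [Eu|Eu] := eqVneq (E0 u) 0.
    have -> : Jd u = 0.
      by rewrite /Jd -(@clampT_id u) ?ltW// -[EG _]/(E0 u) Eu ltxx mulr0 oppr0.
    by under eq_fun do rewrite mul0r; exact: cvg_cst.
  have ce : ep @ \oo --> (0 : R) by exact: cvg_harmonic.
  rewrite -[X in _ --> X]mulr1; apply: cvgMr; rewrite -[X in _ --> X]subr0.
  apply: cvgB; first exact: cvg_cst.
  rewrite -[X in _ --> X](mul0r ((E0 u + 0) * (E0 u + 0))^-1).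
  apply: cvgM; first by have := cvgM ce ce; rewrite mulr0; exact.
  apply: cvgV; first by rewrite addr0 mulf_neq0.
  by apply: cvgM; apply: cvgD => //; exact: cvg_cst.
have mJ k := rint_measurable (H k).1.
have bJ k u : (`]t, T1[%classic : set R) u ->
    `|Jd u * (1 - ep k ^+ 2 / ((E0 u + ep k) * (E0 u + ep k)))| <= Lc.
  rewrite /= in_itv/= => tuT.
  have /andP[k0 k1] := damp_factor (ep0 k) (EGc_ge0 u) (EGc_ge0 u).
  rewrite normrM (ger0_norm k0); apply: le_trans (J1 _ tuT).
  by rewrite -[leRHS]mulr1 ler_wpM2l.
have [iJ cv] := @Rintegral_dominated _ _ _ mu `]t, T1[%classic _ Jd mab mJ cJ (fun=> Lc) iC bJ.
split => //; have c0 : (fun k : nat => (0 : R)) @ \oo --> \int[mu]_(u in `]t, T1[) Jd u.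
  apply: cvg_trans cv; apply: near_eq_cvg; apply: nearW => k.
  by rewrite (H k).2 /= E0t E0T !damp0// subrr.
have c1 : (fun k : nat => (0 : R)) @ \oo --> (0 : R) by exact: cvg_cst.
exact: cvg_unique c0 c1.
Qed.

Lemma representation_mean : G t x = 0 ->
  rint mu `]t, T1[ (fun u => \int[Q]_om jump u om) /\
  \int[mu]_(u in `]t, T1[) (\int[Q]_om jump u om) = 0.
Proof.
move=> Gt; have neg (j : R -> R) : rint mu `]t, T1[ (fun u => - j u) ->
    \int[mu]_(u in `]t, T1[) (- j u) = 0 ->
    rint mu `]t, T1[ j /\ \int[mu]_(u in `]t, T1[) j u = 0.
  have mab : measurable (`]t, T1[%classic : set R) by exact: measurable_itv.
  move=> i1 i2; have := @rintZ _ _ _ mu `]t, T1[%classic (-1) _ mab i1.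
  rewrite (_ : (fun u => -1 * - j u) = j); last by apply/funext => u; rewrite mulN1r opprK.
  move=> i3; split => //.
  have := @RintegralZl _ _ _ mu `]t, T1[%classic _ (-1) mab i1.
  rewrite i2 mulr0; apply: etrans; apply: eq_Rintegral => u _.
  by rewrite mulN1r opprK.
suff [] : rint mu `]t, T1[ (fun u => - \int[Q]_om jump u om) /\
    \int[mu]_(u in `]t, T1[) (- \int[Q]_om jump u om) = 0 by exact: neg.
have [sE|sn0] := eqVneq s 0.
  have [i1 i2] := R1_det sE Gt.
  suff -> : (fun u => - \int[Q]_om jump u om) = Jd by [].
  apply/funext => u; congr (- _).
  under eq_Rintegral => om _ do rewrite (EG_det u om sE).1.
  exact: Rintegral_probability_cst.
have E0t : E0 t = 0 by rewrite /E0 /= clampT_id// EG_t.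
have E0T : E0 T1 = 0 by rewrite /E0 /= clampT_id// EG_T1.
have [i1 i2] := lip_FTC Lc_ge0 t_leT1 EG_lip
  (fun u tuT => EG_deriv_random sn0 (andP tuT).1 (andP tuT).2).
by split; [exact: i1|rewrite i2 -/E0 E0t E0T subrr].
Qed.

Lemma representation : G t x = 0 ->
  Q.-integrable setT (fun om => \int[mu]_(u in `[t, T1]) (jump u om)%:E)%E /\
  (\int[Q]_om \int[mu]_(u in `[t, T1]) (jump u om)%:E = 0)%E.
Proof.
move=> Gt.
have jE om : (\int[mu]_(u in `[t, T1]) (jump (clampT u) om)%:E =
    \int[mu]_(u in `[t, T1]) (jump u om)%:E)%E.
  by apply: eq_integral => u; rewrite inE /= in_itv/= => /andP[tu uT]; rewrite clampT_id.
have jT om : jump T1 om = 0 by rewrite /jump G_T1_eq0 ?Xp_ge0// ltxx mulr0.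
have bd u om : t <= u -> u <= T1 -> `|jump u om| <= CW + CF * Xp u om.
  rewrite [u <= T1]le_eqVlt => tu /orP[/eqP ->|uT].
    by rewrite jT normr0 addr_ge0// mulr_ge0// Xp_ge0.
  by apply: jump_bound => //; exact: le_trans tu.
have i1 u : t <= u -> u <= T1 -> rint Q setT (fun om => CW + CF * Xp u om).
  move=> tu uT; apply: rintD => //; first exact: rint_cst.
  by apply: rintZ => //; exact: rint_id.
have [] := @Fubini_itv _ _ _ Q (fun u om => jump (clampT u) om) t T1 Lc t_leT1 Lc_ge0
  jump_joint_measurable.
  move=> u /andP[tu uT]; rewrite clampT_id//.
  have ij : rint Q setT (jump u).
    apply: rint_le (i1 _ tu uT) => //; first exact: jump_measurable.
    by move=> om _; exact: bd.
  split => //; have -> : Lc = \int[Q]_om (CW + CF * Xp u om).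
    rewrite RintegralD//; last 2 first.
    - exact: rint_cst.
    - by apply: rintZ => //; exact: rint_id.
    by rewrite Rintegral_probability_cst RintegralZl ?E_Xp//; exact: rint_id.
  apply: le_Rintegral => //; [exact: rint_norm|exact: i1|].
  by move=> om _; exact: bd.
rewrite -/mu (funext jE) => ij ->; split => //.
have [i2 i0] := representation_mean Gt.
have mab : measurable (`]t, T1[%classic : set R) by exact: measurable_itv.
have eE : (\int[mu]_(u in `]t, T1[) (\int[Q]_om jump u om)%:E = 0)%E.
  by have := @EFin_Rintegral _ _ _ mu `]t, T1[%classic _ mab i2; rewrite i0.
(* The mean is treated on the open interval, where its integrability is known; the endpoints do not
   contribute. *)
apply: etrans eE; rewrite -[RHS](@integral_itv_bndoo _ t T1 _ true false); last first.
  by apply/measurable_EFinP; exact: rint_measurable i2.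
apply: eq_integral => u; rewrite inE /= in_itv/= => /andP[tu uT]; rewrite clampT_id//.
Qed.
End kernel.

(** * Girsanov transformation of Brownian motion *)

Lemma max_continuous {R : realType} (a : R) : continuous (fun u => Num.max a u).
Proof.
move=> u; apply: (@lip_continuous _ 1) => x y.
rewrite mul1r /Num.max; case: (ltP a x) => h1; case: (ltP a y) => h2;
  rewrite ?subrr ?normr0 //.
- by rewrite !gtr0_norm ?subr_gt0; lra.
- by rewrite distrC [X in _ <= X]distrC !gtr0_norm ?subr_gt0; lra.
Qed.

Section brownian_measure_change.
Context d (Om : measurableType d) (R : realType) (P : probability Om R)
  (Fi : R -> set (set Om)) (B : R -> Om -> R).
Hypotheses (Fi_filt : is_filtration Fi) (BM : is_brownian P Fi B).
Variables (T1 c b : R).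
Hypothesis T1_gt0 : 0 < T1.

Lemma B_Fmeasurable u : 0 <= u -> Fmeasurable Fi u (B u).
Proof. by case: BM => _ _ h _ u0 U mU; exact: h. Qed.

Lemma BM_max_continuous (a : R) w : 0 <= a -> continuous (fun u : R => B (Num.max a u) w).
Proof.
move=> a0; have up_cont := @max_continuous R a.
have a_ge u : a <= Num.max a u by rewrite le_max lexx.
case: BM => _ hc _ _ u; have := hc w.
move=> /subspace_continuousP /(_ (Num.max a u)).
rewrite /= in_itv/= andbT (le_trans a0 (a_ge u)) => /(_ isT) cv.
move/cvgrPdist_lt: cv => cv; apply/cvgrPdist_lt => e e0; have := cv e e0.
rewrite near_withinE => h.
have h2 : \forall v \near u, Num.max a v \in `[0, +oo[ ->
  `|B (Num.max a u) w - B (Num.max a v) w| < e := up_cont u _ h.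
near=> v; have h3 : Num.max a v \in `[0, +oo[ -> `|B (Num.max a u) w - B (Num.max a v) w| < e.
  by near: v.
by apply: h3; rewrite in_itv/= andbT (le_trans a0 (a_ge v)).
Unshelve. all: by end_near. Qed.

Lemma increment_integral d' (S : measurableType d') (V : Om -> S) a e
    (phi : S * R -> \bar R) :
  0 <= a -> a < e -> Fmeasurable Fi a V -> measurable_fun setT phi -> (forall z, 0 <= phi z)%E ->
  (\int[P]_w phi (V w, B e w - B a w)%R =
   \int[P]_w \int[normal_prob 0%R (Num.sqrt (e - a))]_y phi (V w, y))%E.
Proof.
move=> a0 ae hV mphi phi0.
have e0 : 0 <= e by rewrite (le_trans a0)// ltW.
have mB u : 0 <= u -> measurable_fun setT (B u).
  by move=> u0; exact: (Fmeasurable_meas Fi_filt (B_Fmeasurable u0)).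
have mD : measurable_fun setT (fun w => B e w - B a w) by apply: measurable_funB; exact: mB.
have ind U U' : measurable U -> measurable U' ->
    P (V @^-1` U `&` (fun w => B e w - B a w) @^-1` U') =
    (P (V @^-1` U) * normal_prob 0%R (Num.sqrt (e - a)) U')%E.
  by move=> mU mU'; case: BM => _ _ _ hi; exact: hi a0 ae (hV _ mU) mU'.
exact: (@ge0_integral_indep _ Om R _ _ S (measurableTypeR R) P V (fun w => B e w - B a w)
  (normal_prob 0%R (Num.sqrt (e - a))) (Fmeasurable_meas Fi_filt hV) mD ind phi mphi phi0).
Qed.

Definition dens (u : R) (om : Om) : R := expR (- (1 / 2) * c ^+ 2 * u + c * B u om).

Lemma normal_dens (h : R) : 0 < h ->
  (\int[normal_prob 0%R (Num.sqrt h)]_y (expR (- (1 / 2) * c ^+ 2 * h + c * y))%:E = 1)%E.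
Proof.
move=> h0; under eq_integral => y _ do rewrite expRD EFinM.
rewrite ge0_integralZl//; last first.
  by apply/measurable_EFinP; apply: measurableT_comp => //; exact: measurable_funM.
rewrite normal_mgf ?sqrtr_gt0// sqr_sqrtr ?ltW// -EFinM -expRD.
by rewrite (_ : _ + _ = 0) ?expR0//; field.
Qed.

Lemma dens0 om : dens 0 om = 1.
Proof. by case: BM => B0 _ _ _; rewrite /dens B0 !mulr0 addr0 expR0. Qed.

Lemma dens_split a e om :
  dens e om = dens a om * expR (- (1 / 2) * c ^+ 2 * (e - a) + c * (B e om - B a om)).
Proof. by rewrite /dens -expRD; congr expR; ring. Qed.

Lemma measurable_dens_step (h : R) : measurable_fun setT (fun y : R => expR (- (1 / 2) * c ^+ 2 * h + c * y)).
Proof.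
apply: measurableT_comp => //; apply: measurable_funD => //; exact: measurable_funM.
Qed.

Lemma dens_Fmeasurable u : 0 <= u -> Fmeasurable Fi u (dens u).
Proof.
move=> u0; have := Fmeasurable_comp (B_Fmeasurable u0) (measurable_dens_step u).
exact.
Qed.

Lemma dens_martingale d' (S : measurableType d') u (V : Om -> S) (h : S -> \bar R) :
  0 <= u -> u <= T1 -> Fmeasurable Fi u V -> measurable_fun setT h -> (forall z, 0 <= h z)%E ->
  (\int[P]_w (h (V w) * (dens T1 w)%:E) = \int[P]_w (h (V w) * (dens u w)%:E))%E.
Proof.
move=> u0; rewrite le_eqVlt => /orP[/eqP -> //|uT] hV mh h0.
have m1 : measurable_fun setT (fun z : S * R * R => h z.1.1).
  by apply: measurableT_comp => //; exact: measurableT_comp measurable_fst measurable_fst.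
have m2 : measurable_fun setT (fun z : S * R * R => (`|z.1.2|)%:E).
  apply/measurable_EFinP; apply: measurableT_comp => //.
  exact: measurableT_comp measurable_snd measurable_fst.
have m3 : measurable_fun setT (fun z : S * R * R =>
    (expR (- (1 / 2) * c ^+ 2 * (T1 - u) + c * z.2))%:E).
  by apply/measurable_EFinP; exact: measurableT_comp (measurable_dens_step _) measurable_snd.
(* The absolute value keeps the integrand nonnegative on the whole product; the density itself is
   positive. *)
have H := @increment_integral _ _ (fun w => (V w, dens u w)) u T1
  (fun z => h z.1.1 * (`|z.1.2|)%:E * (expR (- (1 / 2) * c ^+ 2 * (T1 - u) + c * z.2))%:E)%E
  u0 uT (Fmeasurable_pair Fi_filt hV (dens_Fmeasurable u0))
  (emeasurable_funM (emeasurable_funM m1 m2) m3).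
have dn w : `|dens u w| = dens u w by rewrite ger0_norm ?expR_ge0.
transitivity (\int[P]_w (h (V w) * (`|dens u w|)%:E *
    (expR (- (1 / 2) * c ^+ 2 * (T1 - u) + c * (B T1 w - B u w)))%:E))%E.
  by apply: eq_integral => w _; rewrite (dens_split u T1) dn EFinM muleA.
rewrite H; last first.
  by move=> z; rewrite !mule_ge0// lee_fin ?expR_ge0.
apply: eq_integral => w _ /=; rewrite ge0_integralZl//; last 2 first.
- by apply/measurable_EFinP; exact: measurable_dens_step.
- by rewrite mule_ge0// lee_fin.
by rewrite normal_dens ?subr_gt0// mule1 dn.
Qed.

Lemma dens_mean : (\int[P]_w (dens T1 w)%:E = 1)%E.
Proof.
have cstF : Fmeasurable Fi 0 (cst (0 : R)).
  move=> U mU; rewrite preimage_cst; case: ifPn => _; [exact: (FiT Fi_filt)|exact: (Fi0 Fi_filt)].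
have := @dens_martingale _ R 0 (cst 0) (cst 1%E) (lexx _) (ltW T1_gt0) cstF.
move=> /(_ (measurable_cst _) (fun=> lee01)) /=.
under eq_integral do rewrite mul1e.
under [in X in _ = X -> _]eq_integral do rewrite mul1e dens0.
move=> ->; rewrite integral_cst//= probability_setT; exact: mule1.
Qed.

Lemma dens_measurable u : 0 <= u -> measurable_fun setT (dens u).
Proof. by move=> u0; exact: (Fmeasurable_meas Fi_filt (dens_Fmeasurable u0)). Qed.

Lemma girsanov_exists : exists Q : probability Om R,
  forall f : Om -> \bar R, measurable_fun setT f -> (forall w, 0 <= f w)%E ->
    (\int[Q]_w f w = \int[P]_w (f w * (dens T1 w)%:E))%E.
Proof.
apply: exists_density; last exact: dens_mean.
- by move=> w; exact: expR_ge0.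
- by apply: dens_measurable; exact: ltW.
Qed.

Lemma integral_probability_cst d' (T : measurableType d') (nu : probability T R) (k : \bar R) :
  (\int[nu]_w k = k)%E.
Proof.
rewrite (integral_cst nu measurableT).
set q := (X in (k * X)%E); have -> : q = 1%E by exact: probability_setT.
by rewrite mule1.
Qed.

(** * Geometric Brownian motion under the changed measure *)

Variable Q : probability Om R.
Hypothesis HQ : forall f : Om -> \bar R, measurable_fun setT f -> (forall w, 0 <= f w)%E ->
  (\int[Q]_w f w = \int[P]_w (f w * (dens T1 w)%:E))%E.

Lemma girsanov_at d' (S : measurableType d') u (V : Om -> S) (h : S -> \bar R) :
  0 <= u -> u <= T1 -> Fmeasurable Fi u V -> measurable_fun setT h -> (forall z, 0 <= h z)%E ->
  (\int[Q]_w h (V w) = \int[P]_w (h (V w) * (dens u w)%:E))%E.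
Proof.
move=> u0 uT hV mh h0; rewrite -(dens_martingale u0 uT hV mh h0) HQ//.
exact: measurableT_comp mh (Fmeasurable_meas Fi_filt hV).
Qed.

(* The time argument is clamped at [0] because Brownian paths are only continuous on
   [0, +oo). *)
Definition gbm (u : R) (w : Om) : R :=
  expR (b * (B (Num.max 0 u) w - c * Num.max 0 u) - b ^+ 2 / 2 * Num.max 0 u).

(** [y - c * h] is an increment of [B] with the drift that it acquires under [Q] removed. *)
Definition gbm_step (h y : R) : R := expR (b * (y - c * h) - b ^+ 2 / 2 * h).

Lemma gbmE u w : 0 <= u -> gbm u w = gbm_step u (B u w).
Proof. by move=> u0; rewrite /gbm (max_idPr u0). Qed.

Lemma gbm_gt0 u w : 0 < gbm u w. Proof. exact: expR_gt0. Qed.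

Lemma gbm0 w : gbm 0 w = 1.
Proof.
by case: BM => B0 _ _ _; rewrite gbmE// /gbm_step B0 !mulr0 subrr mulr0 subr0 expR0.
Qed.

Lemma measurable_gbm_step h : measurable_fun setT (gbm_step h).
Proof.
apply: measurableT_comp => //; apply: measurable_funB => //.
by apply: measurable_funM => //; exact: measurable_funB.
Qed.

Lemma gbm_Fmeasurable u : 0 <= u -> Fmeasurable Fi u (gbm u).
Proof.
move=> u0; have -> : gbm u = gbm_step u \o B u by apply/funext => w; rewrite gbmE.
exact: Fmeasurable_comp (B_Fmeasurable u0) (measurable_gbm_step u).
Qed.

Lemma measurable_gbm u : measurable_fun setT (gbm u).
Proof.
have -> : gbm u = gbm (Num.max 0 u).
  by apply/funext => w; rewrite /gbm [Num.max 0 (Num.max 0 u)](max_idPr _)// le_max lexx.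
by apply: (Fmeasurable_meas Fi_filt (gbm_Fmeasurable _)); rewrite le_max lexx.
Qed.

Lemma gbm_continuous w : continuous (gbm ^~ w).
Proof.
have up_cont := @max_continuous R 0; have cB := @BM_max_continuous 0 w (lexx 0).
move=> u; apply: (@cvg_comp _ _ _ _ expR); last exact: continuous_expR.
apply: cvgB; last by apply: cvgMr; exact: up_cont.
by apply: cvgMr; apply: cvgB; [exact: cB|apply: cvgMr; exact: up_cont].
Qed.

Lemma gbm_ratio a e w : 0 <= a -> a <= e -> gbm e w / gbm a w = gbm_step (e - a) (B e w - B a w).
Proof.
move=> a0 ae; rewrite !gbmE ?(le_trans a0)// /gbm_step -expRN -expRD; congr expR; ring.
Qed.

(* The law of [x * gbm h] under [Q], integrated against [phi]. *)
Definition gbm_law (h : R) (phi : R -> R) (x : R) : \bar R :=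
  (\int[normal_prob 0%R (Num.sqrt h)]_y (phi (x * gbm_step h y) *
     expR (- (1 / 2) * c ^+ 2 * h + c * y))%:E)%E.

Let measurable_law_int (h : R) (phi : R -> R) : measurable_fun setT phi ->
  measurable_fun setT (fun z : R * R => phi (z.1 * gbm_step h z.2) *
    expR (- (1 / 2) * c ^+ 2 * h + c * z.2)).
Proof.
move=> mphi; apply: measurable_funM; last exact: measurableT_comp (measurable_dens_step _) measurable_snd.
apply: measurableT_comp => //; apply: measurable_funM => //.
exact: measurableT_comp (measurable_gbm_step _) measurable_snd.
Qed.

Let measurable_law1 (h x : R) (phi : R -> R) : measurable_fun setT phi ->
  measurable_fun setT (fun y : R => phi (x * gbm_step h y) *
    expR (- (1 / 2) * c ^+ 2 * h + c * y)).
Proof.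
move=> mphi; apply: measurable_funM; last exact: measurable_dens_step.
apply: measurableT_comp => //; apply: measurable_funM => //.
exact: measurable_gbm_step.
Qed.

Lemma gbm_law_ge0 h (phi : R -> R) x : (forall y, 0 <= phi y) -> (0 <= gbm_law h phi x)%E.
Proof. by move=> p0; apply: integral_ge0 => y _; rewrite lee_fin mulr_ge0 ?expR_ge0. Qed.

Lemma measurable_gbm_law h (phi : R -> R) : measurable_fun setT phi -> (forall y, 0 <= phi y) ->
  measurable_fun setT (gbm_law h phi).
Proof.
move=> mphi p0; have := measurable_fun_fubini_tonelli_F (m2 := normal_prob 0%R (Num.sqrt h))
  (fun z : R * R => (phi (z.1 * gbm_step h z.2) * expR (- (1 / 2) * c ^+ 2 * h + c * z.2))%:E).
apply.
- by apply/measurable_EFinP; exact: measurable_law_int.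
- by move=> z; rewrite lee_fin mulr_ge0 ?expR_ge0.
Qed.

(** The density factorises into [dens a], known at time [a], and a function of the later increment
    of [B]. Independence under [P] integrates the increment out, and [dens a] turns what remains
    back into an integral under [Q]. *)
Lemma girsanov_increment a e A (X : Om -> R) (phi : R -> R) : 0 <= a -> a < e -> e <= T1 ->
  Fi a A -> Fmeasurable Fi a X -> measurable_fun setT phi -> (forall y, 0 <= phi y) ->
  (\int[Q]_(w in A) (phi (X w * (gbm e w / gbm a w)))%:E =
   \int[Q]_(w in A) gbm_law (e - a) phi (X w))%E.
Proof.
move=> a0 ae eT FA FX mphi p0.
have e0 : 0 <= e by rewrite (le_trans a0)// ltW.
have mA := Fi_meas Fi_filt FA.
have FI : Fmeasurable Fi a (\1_A : Om -> R) by exact: (Fmeasurable_indic Fi_filt).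
have mul1A (g : Om -> \bar R) : (\int[Q]_(w in A) g w = \int[Q]_w ((\1_A w : R)%:E * g w))%E.
  rewrite integral_mkcond; apply: eq_integral => w _; rewrite patchE indicE.
  by case: ifPn => _; rewrite ?mul1e ?mul0e.
have FD : Fmeasurable Fi e (fun w => B e w - B a w).
  have := Fmeasurable_comp (Fmeasurable_pair Fi_filt (B_Fmeasurable e0)
    (Fmeasurable_sub Fi_filt (ltW ae) (B_Fmeasurable a0))) (g := fun z : R * R => z.1 - z.2).
  by apply; exact: measurable_funB.
pose V w := ((\1_A w : R, X w), dens a w).
have FV : Fmeasurable Fi a V by exact: (Fmeasurable_pair Fi_filt (Fmeasurable_pair Fi_filt FI FX) (dens_Fmeasurable a0)).
(* The indicator, [X] and [dens a] form one variable known at time [a]; the absolute values make the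
   integrand nonnegative everywhere. *)
pose psi (z : R * R * R * R) : R := `|z.1.1.1| * `|z.1.2| *
  (phi (z.1.1.2 * gbm_step (e - a) z.2) * expR (- (1 / 2) * c ^+ 2 * (e - a) + c * z.2)).
have mpsi : measurable_fun setT psi.
  have m11 : measurable_fun setT (fun z : R * R * R * R => z.1.1) by exact: measurableT_comp measurable_fst measurable_fst.
  apply: measurable_funM.
    apply: measurable_funM; apply: measurableT_comp => //.
      exact: measurableT_comp measurable_fst m11.
    exact: measurableT_comp measurable_snd measurable_fst.
  apply: (@measurableT_comp _ _ _ _ _ _ _ _ (fun z : R * R * R * R => (z.1.1.2, z.2)) (measurable_law_int (e - a) mphi)).
  by apply: measurable_fun_pair => //; exact: measurableT_comp measurable_snd m11.
have psi0 z : 0 <= psi z by rewrite !mulr_ge0 ?expR_ge0.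
have i0 w : `|\1_A w : R| = \1_A w by rewrite ger0_norm.
have d0 w : `|dens a w| = dens a w by rewrite ger0_norm ?expR_ge0.
transitivity (\int[P]_w (psi (V w, B e w - B a w))%:E)%E.
  rewrite mul1A.
  have -> : (\int[Q]_w ((\1_A w : R)%:E * (phi (X w * (gbm e w / gbm a w)))%:E) =
    \int[Q]_w (`|\1_A w : R| * phi (X w * gbm_step (e - a) (B e w - B a w)))%:E)%E.
    by apply: eq_integral => w _; rewrite i0 EFinM (gbm_ratio _ a0 (ltW ae)).
  have FW := Fmeasurable_pair Fi_filt (Fmeasurable_pair Fi_filt (Fmeasurable_sub Fi_filt (ltW ae) FI) (Fmeasurable_sub Fi_filt (ltW ae) FX)) FD.
  rewrite (girsanov_at (h := fun z : R * R * R => (`|z.1.1| * phi (z.1.2 * gbm_step (e - a) z.2))%:E) e0 eT FW); last 2 first.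
  - apply/measurable_EFinP; apply: measurable_funM.
      by apply: measurableT_comp => //; exact: measurableT_comp measurable_fst measurable_fst.
    apply: measurableT_comp => //; apply: measurable_funM.
      exact: measurableT_comp measurable_snd measurable_fst.
    exact: measurableT_comp (measurable_gbm_step _) measurable_snd.
  - by move=> z; rewrite lee_fin mulr_ge0.
  apply: eq_integral => w _; rewrite -EFinM (dens_split a e) /psi /V /= d0; congr EFin; ring.
rewrite (increment_integral a0 ae FV (phi := EFin \o psi)); last 2 first.
- exact/measurable_EFinP.
- by move=> z; rewrite lee_fin.
rewrite mul1A; under [in RHS]eq_integral => w _ do rewrite -i0.
rewrite (girsanov_at (u := a) (V := fun w => (\1_A w : R, X w))
  (h := fun z : R * R => ((`|z.1|)%:E * gbm_law (e - a) phi z.2)%E) a0 (le_trans (ltW ae) eT)).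
- apply: eq_integral => w _; rewrite /psi /V /= i0 d0.
  under [in LHS]eq_integral => y _ do rewrite EFinM.
  rewrite ge0_integralZl//; last 3 first.
  + apply/measurable_EFinP.
    exact: measurable_law1.
  + by move=> y _; rewrite lee_fin mulr_ge0 ?expR_ge0.
  + by rewrite lee_fin mulr_ge0 ?expR_ge0.
  by rewrite EFinM muleAC.
- exact: (Fmeasurable_pair Fi_filt).
- apply: emeasurable_funM.
    by apply/measurable_EFinP; apply: measurableT_comp.
  exact: measurableT_comp (measurable_gbm_law _ mphi p0) measurable_snd.
- by move=> z; rewrite mule_ge0// ?lee_fin// gbm_law_ge0.
Qed.

Lemma girsanov_law h (phi : R -> R) x : 0 < h -> h <= T1 -> measurable_fun setT phi ->
  (forall y, 0 <= phi y) -> (\int[Q]_w (phi (x * gbm h w))%:E = gbm_law h phi x)%E.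
Proof.
move=> h0 hT mphi p0.
have cstF : Fmeasurable Fi 0 (cst x : Om -> R).
  move=> U mU; rewrite preimage_cst; case: ifPn => _; [exact: (FiT Fi_filt)|exact: (Fi0 Fi_filt)].
have := girsanov_increment (lexx 0) h0 hT (FiT Fi_filt 0) cstF mphi p0.
rewrite subr0 /= integral_probability_cst => <-.
by apply: eq_integral => w _; rewrite gbm0 divr1.
Qed.

Lemma gbm_indep a e A (X : Om -> R) (phi : R -> R) : 0 <= a -> a <= e -> e <= T1 ->
  Fi a A -> Fmeasurable Fi a X -> measurable_fun setT phi -> (forall y, 0 <= phi y) ->
  (\int[Q]_(w in A) (phi (X w * (gbm e w / gbm a w)))%:E =
   \int[Q]_(w in A) \int[Q]_v (phi (X w * gbm (e - a) v))%:E)%E.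
Proof.
move=> a0; rewrite le_eqVlt => /orP[/eqP <-|ae] eT FA FX mphi p0.
  apply: eq_integral => w _; rewrite divff ?gt_eqF ?gbm_gt0// mulr1 subrr.
  under eq_integral do rewrite gbm0 mulr1.
  by rewrite integral_probability_cst.
rewrite girsanov_increment//; apply: eq_integral => w _.
rewrite girsanov_law ?subr_gt0// lerBlDr (le_trans eT)// lerDl//.
Qed.

Lemma gbm_semigroup (h k x : R) (phi : R -> R) : 0 <= h -> 0 <= k -> h + k <= T1 ->
  measurable_fun setT phi -> (forall y, 0 <= phi y) ->
  (\int[Q]_w (phi (x * gbm (h + k) w))%:E =
   \int[Q]_w \int[Q]_v (phi (x * gbm h w * gbm k v))%:E)%E.
Proof.
move=> h0 k0 hkT mphi p0.
have hk : h <= h + k by rewrite lerDl.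
have FX : Fmeasurable Fi h (fun w => x * gbm h w).
  have := Fmeasurable_comp (gbm_Fmeasurable h0) (g := fun y : R => x * y).
  by apply; exact: measurable_funM.
have := gbm_indep h0 hk hkT (FiT Fi_filt h) FX mphi p0.
rewrite [h + k - h]addrAC subrr add0r => <-.
by apply: eq_integral => w _; rewrite -mulrA [_ * (_ / _)]mulrC divfK// gt_eqF// gbm_gt0.
Qed.

Lemma gbm_moments (h : R) (k : nat) : 0 <= h <= T1 -> (k <= 4)%N ->
  (\int[Q]_w (gbm h w ^+ k)%:E = (expR (k%:R * (k%:R - 1) / 2 * (b ^+ 2 * h)))%:E)%E.
Proof.
move=> /andP[]; rewrite le_eqVlt => /orP[/eqP <- _ _|h0 hT _].
  under eq_integral do rewrite gbm0 expr1n.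
  by rewrite integral_probability_cst !mulr0 expR0.
have := @girsanov_law h (fun y => `|y ^+ k|) 1 h0 hT _ (fun=> normr_ge0 _).
under eq_integral => w _ do rewrite mul1r ger0_norm ?exprn_ge0 ?(ltW (gbm_gt0 _ _))//.
move=> ->; last by apply: measurableT_comp => //; exact: measurable_funX.
have key (y : R) : `|(1 * gbm_step h y) ^+ k| * expR (- (1 / 2) * c ^+ 2 * h + c * y) =
    expR (- (k%:R * b * c * h) - k%:R * b ^+ 2 / 2 * h - c ^+ 2 / 2 * h) *
    expR ((k%:R * b + c) * y).
  rewrite mul1r ger0_norm ?exprn_ge0 ?expR_ge0//.
  by rewrite /gbm_step -expRM_natl -!expRD; congr expR; field.
rewrite /gbm_law; under eq_integral => y _ do rewrite key EFinM.
rewrite ge0_integralZl//; last first.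
  by apply/measurable_EFinP; apply: measurableT_comp => //; exact: measurable_funM.
rewrite normal_mgf ?sqrtr_gt0// sqr_sqrtr ?(ltW h0)// -EFinM -expRD; congr (expR _)%:E; by field.
Qed.

(** For nonzero [b] the map [gbm_step h] is injective, so the event fixes the value of [B h], whose
    law has no atoms; and null sets of [P] are null for [Q]. *)
Lemma gbm_atom : b ^+ 2 != 0 -> forall h y : R, 0 < h -> Q (gbm h @^-1` [set y]) = 0%E.
Proof.
rewrite expf_eq0/= => b0 h y h0.
pose N := gbm h @^-1` [set y].
have mN : measurable N by rewrite -[X in measurable X]setTI; exact: measurable_gbm.
have PN : P N = 0%E.
  pose Y : set R := gbm_step h @^-1` [set y].
  have NY : N = [set w | Y (B h w - B 0 w)].
    case: BM => B0 _ _ _; apply/seteqP; split => w; rewrite /N /Y /= gbmE ?ltW// B0 subr0//.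
  have mY : measurable Y.
    by rewrite -[X in measurable X]setTI; exact: (measurable_gbm_step h).
  have : P (setT `&` [set w | Y (B h w - B 0 w)]) =
      (P setT * normal_prob 0 (Num.sqrt (h - 0)) Y)%E.
    by case: BM => _ _ _ hi; apply: hi => //; exact: (FiT Fi_filt).
  rewrite setTI -NY probability_setT mul1e => ->.
  apply/eqP; rewrite -measure_le0.
  have [->|/set0P[z Yz]] := eqVneq Y set0; first by rewrite measure0.
  apply: (@le_trans _ _ (normal_prob 0 (Num.sqrt (h - 0)) [set z])).
    apply: le_measure; rewrite ?inE// => z' Yz'; move: Yz Yz'; rewrite /Y /= => <- /expR_inj.
    by move=> /addIr /(mulfI b0) /addIr.
  by rewrite normal_prob_set1// gt_eqF// sqrtr_gt0 subr0.
have := HQ (f := fun w => (\1_N w)%:E); rewrite integral_indic// setIT => ->.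
- rewrite -(@null_set_integral _ _ _ P N (fun w => (dens T1 w)%:E))//; last first.
    by apply/measurable_EFinP; apply: measurable_funTS; exact: dens_measurable (ltW T1_gt0).
  rewrite [RHS]integral_mkcond; apply: eq_integral => w _; rewrite patchE indicE.
  by case: ifPn => _; rewrite ?mul1e ?mul0e.
- by apply/measurable_EFinP; exact: measurable_indic.
- by move=> w; rewrite lee_fin indicE.
Qed.

Lemma gbm_det : b ^+ 2 = 0 -> forall h w, gbm h w = 1.
Proof.
by move=> /eqP; rewrite expf_eq0/= => /eqP b0 h w; rewrite /gbm b0 !mul0r expr0n/= !mul0r subr0 expR0.
Qed.

Lemma gbm_adapted u V : 0 <= u -> measurable V -> Fi u (gbm u @^-1` V).
Proof. by move=> u0; exact: gbm_Fmeasurable. Qed.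
End brownian_measure_change.

(** * The utility model *)

Lemma powR_continuous {R : realType} (h : R -> R) (q : R) : continuous h ->
  (forall u, 0 < h u) -> continuous (fun u => h u `^ q).
Proof.
move=> ch h0; have -> : (fun u => h u `^ q) = (fun u => expR (q * ln (h u))).
  by apply/funext => u; rewrite /powR gt_eqF.
have cl : continuous (fun u => ln (h u)).
  by move=> u; exact: cvg_comp (ch u) (continuous_ln (h0 u)).
move=> u; apply: (@cvg_comp _ _ _ (fun v => q * ln (h v)) expR); last exact: continuous_expR.
by apply: cvgMr; exact: cl.
Qed.

Lemma dist_sandwich {R : realDomainType} (a b c e : R) :
  c <= a + e -> b <= c -> `|a - b| <= e -> `|a - c| <= e.
Proof. rewrite !ler_norml => h1 h2 /andP[h3 h4]; apply/andP; split; lra. Qed.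

Section model.
Context d (Om : measurableType d) (R : realType) (P : probability Om R)
  (Fi : R -> set (set Om)) (B : R -> Om -> R) (p : params R).
Notation g := (p_gamma p).
Notation T1 := (p_T1 p).
Notation T := (p_T p).
Notation th := (theta p).
Notation mu := (@lebesgue_measure R).
Hypotheses (Fi_filt : is_filtration Fi) (BM : is_brownian P Fi B)
  (T1_gt0 : 0 < T1) (T1_lt : T1 < T) (alpha_gt0 : 0 < p_alpha p)
  (th_lt0 : th < 0) (g_gt0 : 0 < g) (g_neq1 : g != 1)
  (K_gt0 : forall t, 0 <= t <= T -> 0 < p_K p t) (K_cont : continuous (p_K p))
  (Delta_lt0 : forall t, 0 <= t <= T1 -> Delta p t < 0).

(** [cq] is the drift of [B] under the changed measure. [bq] is the volatility of the power [- gt p]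
    of [Zproc]: this power turns the exponents of [Yproc] and [Wproc] into [- 1 / g] and [- 1]. *)
Definition cq : R := p_sigmaw p - kappa p.
Definition bq : R := kappa p / g - p_sigmaw p.
(* [k1 u] and [k2 u] are the coefficients of the two conjugate utilities, scaled so that
   [exp (th * u)] times the conjugate utility at [Z u] is [k1 u] (or [k2 u]) times a
   martingale, and [lam] is the growth rate for which this holds.  The excess payoff rate
   is [fM = k2 - k1], and [wM] comes from [q]. *)
Definition lam : R := th - (p_rho p - kappa p ^+ 2 / 2 - p_r p) / g
  - (p_muw p - p_sigmaw p ^+ 2 / 2) + bq * cq + bq ^+ 2 / 2.
Definition clT (u : R) : R := Num.max 0 (Num.min u T).
Definition k1 (u : R) : R := expR (lam * u) * (muT p (clT u) `^ (- gt p) / gt p).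
Definition k2 (u : R) : R := p_K p (clT u) `^ (1 / g) * k1 u.
Definition fM (u : R) : R := k2 u - k1 u.
Definition wM (u : R) : R := expR (th * u).

Let T_gt0 : 0 < T. Proof. exact: lt_trans T1_lt. Qed.
Let g_neq0 : g != 0. Proof. by rewrite gt_eqF. Qed.
Let g1_neq0 : 1 - g != 0. Proof. by rewrite subr_eq0 eq_sym. Qed.

Lemma gt_neq0 : gt p != 0.
Proof. by rewrite /gt mulf_neq0// invr_eq0. Qed.

Lemma clT_bd u : 0 <= clT u <= T.
Proof. by have [] := @clamp_step R 0 T u u (ltW T_gt0) (lexx u). Qed.

Lemma clT_id u : 0 <= u <= T -> clT u = u.
Proof. by move=> /andP[u0 uT]; rewrite /clT (min_idPl uT) (max_idPr u0). Qed.

Lemma clT_continuous : continuous clT.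
Proof.
apply: (@lip_continuous _ 1); suff S (u v : R) : u <= v -> `|clT u - clT v| <= 1 * `|u - v|.
  move=> u v; case/orP: (le_total u v) => uv; first exact: S.
  by rewrite distrC [X in _ * X]distrC; exact: S.
move=> uv; have [_ _ h1 h2] := @clamp_step R 0 T u v (ltW T_gt0) uv.
by rewrite mul1r distrC [X in _ <= X]distrC !ger0_norm ?subr_ge0.
Qed.

Lemma muT_ge1 u : 1 <= muT p u.
Proof.
rewrite /muT lerDl mulr_ge0 ?(ltW alpha_gt0)//.
by apply: Rintegral_ge0 => // v _; exact: expR_ge0.
Qed.

Lemma muT_gt0 u : 0 < muT p u. Proof. exact: lt_le_trans (muT_ge1 u). Qed.

Lemma expRM_continuous (nu : R) : continuous (fun u : R => expR (nu * u)).
Proof.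
move=> u; apply: (@cvg_comp _ _ _ (fun v : R => nu * v) expR); last exact: continuous_expR.
by apply: cvgMr; exact: cvg_id.
Qed.

Lemma muT_clT_continuous : continuous (fun u => muT p (clT u)).
Proof.
pose nu := p_alpha p - p_beta p - p_r p.
(* Pulling the exponential out leaves an integral that depends on [u] through its lower limit
   alone. *)
have E u : pT p u = expR (- nu * u) * tail (fun v => expR (nu * v)) T u.
  rewrite /pT /tail -RintegralZl//; last first.
    by apply: rint_continuous; exact: expRM_continuous.
  by apply: eq_Rintegral => v _; rewrite -expRD; congr expR; rewrite /nu; ring.
have ct : continuous (fun u => tail (fun v => expR (nu * v)) T (clT u)).
  have [C _ HC] := tail_lip (@expRM_continuous nu) (ltW T_gt0).
  exact: lip_continuous HC.
have -> : (fun u => muT p (clT u)) = (fun u => 1 + p_alpha p *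
    (expR (- nu * clT u) * tail (fun v => expR (nu * v)) T (clT u))).
  by apply/funext => u; rewrite /muT E.
move=> u; apply: cvgD; first exact: cvg_cst.
apply: cvgMr; apply: cvgM.
  by apply: (@cvg_comp _ _ _ clT (fun v : R => expR (- nu * v)));
    [exact: clT_continuous|exact: expRM_continuous].
exact: ct.
Qed.

Lemma k1_continuous : continuous k1.
Proof.
have cm : continuous (fun u => muT p (clT u) `^ (- gt p)).
  by apply: powR_continuous => [|u]; [exact: muT_clT_continuous|exact: muT_gt0].
move=> u; apply: cvgM; first exact: expRM_continuous.
by apply: cvgM; [exact: cm|exact: cvg_cst].
Qed.

Lemma K_clT_gt0 u : 0 < p_K p (clT u). Proof. exact: K_gt0 (clT_bd u). Qed.

Lemma k2_continuous : continuous k2.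
Proof.
have cK : continuous (fun u => p_K p (clT u)).
  by move=> u; exact: cvg_comp (@clT_continuous u) (@K_cont (clT u)).
have cm : continuous (fun u => p_K p (clT u) `^ (1 / g)).
  by apply: powR_continuous => [|u]; [exact: cK|exact: K_clT_gt0].
by move=> u; apply: cvgM; [exact: cm|exact: k1_continuous].
Qed.

Lemma fM_continuous : continuous fM.
Proof. by move=> u; apply: cvgB; [exact: k2_continuous|exact: k1_continuous]. Qed.

Lemma wM_continuous : continuous wM. Proof. exact: expRM_continuous. Qed.

Lemma fME u : 0 <= u <= T -> fM u = - Delta p u * (expR (lam * u) * muT p u `^ (- gt p)).
Proof.
move=> uT; rewrite /fM /k2 /k1 /Delta clT_id//; field; exact: gt_neq0.
Qed.

Lemma T1_T u : 0 <= u <= T1 -> 0 <= u <= T.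
Proof. by move=> /andP[-> /= h]; rewrite (le_trans h)// ltW. Qed.

Lemma fM_gt0 u : 0 <= u <= T1 -> 0 < fM u.
Proof.
move=> uT; rewrite fME; last exact: T1_T.
by rewrite mulr_gt0 ?oppr_gt0 ?Delta_lt0// mulr_gt0 ?expR_gt0 ?powR_gt0 ?muT_gt0.
Qed.

Lemma hatV1E u y : 0 < y ->
  hatV p (U1 p) u y = ((y `^ (- gt p)) * (muT p u `^ (- gt p) / gt p))%:E.
Proof.
move=> y0; have m0 : 0 < y * muT p u by rewrite mulr_gt0// muT_gt0.
rewrite mulrA -powRM ?ltW ?muT_gt0//.
have := power_conjugate g_gt0 g_neq1 ltr01 m0; rewrite powR1 mul1r -/(gt p) => <-.
congr ereal_sup; apply/seteqP; split => v [c [c0 ->]]; exists c; split => //.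
- by rewrite /U1 mul1r.
- by rewrite /U1 mul1r.
Qed.

Lemma hatV2E u y : 0 <= u <= T -> 0 < y -> hatV p (U2 p) u y =
  (p_K p u `^ (1 / g) * ((y `^ (- gt p)) * (muT p u `^ (- gt p) / gt p)))%:E.
Proof.
move=> uT y0; have m0 : 0 < y * muT p u by rewrite mulr_gt0// muT_gt0.
rewrite [_ `^ _ * (_ / _)]mulrA -powRM ?ltW ?muT_gt0// mulrA.
exact: power_conjugate g_gt0 g_neq1 (K_gt0 uT) m0.
Qed.

Lemma Zproc_gt0 t z u om : 0 < z -> 0 < Zproc p B t z u om.
Proof.
move=> z0; rewrite /Zproc !mulr_gt0// powR_gt0// /Yproc /Wproc /xit /xi.
  by rewrite mul1r mulr_gt0 ?divr_gt0 ?expR_gt0.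
by rewrite mul1r expR_gt0.
Qed.

Lemma Zproc_pow t z u om : 0 <= t -> t <= u -> 0 < z ->
  Zproc p B t z u om `^ (- gt p) =
  z `^ (- gt p) * expR ((lam - th) * (u - t)) * (gbm B cq bq u om / gbm B cq bq t om).
Proof.
move=> t0 tu z0; rewrite (gbm_ratio B cq bq om t0 tu) /Zproc.
have YE : Yproc p B t 1 u om = expR (p_rho p * (u - t) - kappa p * (B u om - B t om)
    - (kappa p ^+ 2 / 2 + p_r p) * (u - t)).
  by rewrite /Yproc /xit /xi mul1r -expRN -!expRD; congr expR; ring.
have WE : Wproc p B t 1 u om = expR ((p_muw p - p_sigmaw p ^+ 2 / 2) * (u - t)
    + p_sigmaw p * (B u om - B t om)).
  by rewrite /Wproc mul1r.
rewrite YE WE !powRM ?mulr_ge0 ?powR_ge0 ?ltW//.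
rewrite -!powRrM /powR !gt_eqF ?expR_gt0// !expRK /gbm_step -!expRD.
congr expR; rewrite /lam /bq /cq /gt; field; by rewrite g_neq0 g1_neq0.
Qed.

Lemma Yproc_gt0 t y u om : 0 < y -> 0 < Yproc p B t y u om.
Proof. by move=> y0; rewrite /Yproc !mulr_gt0 ?expR_gt0// invr_gt0 expR_gt0. Qed.

(** The [P]-martingale factor in the power of [Yproc]; time is clamped at [t] so that paths are
    continuous on the whole line. *)
Definition expmart (t u : R) (om : Om) : R :=
  expR (gt p * kappa p * (B (Num.max t u) om - B t om)
        - (gt p * kappa p) ^+ 2 / 2 * (Num.max t u - t)).

Lemma Yproc_pow t y u om : t <= u -> 0 < y ->
  expR (- p_rho p * (u - t)) * Yproc p B t y u om `^ (- gt p) =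
  y `^ (- gt p) * (expR (lam * (u - t)) * expmart t u om).
Proof.
move=> tu y0; rewrite /expmart (max_idPr tu).
have YE : Yproc p B t y u om = y * expR ((p_rho p - kappa p ^+ 2 / 2 - p_r p) * (u - t)
    - kappa p * (B u om - B t om)).
  rewrite /Yproc /xit /xi -expRN -mulrA -!expRD; congr (_ * expR _); ring.
rewrite YE powRM ?ltW ?expR_gt0// mulrCA; congr (_ * _).
rewrite {1}/powR gt_eqF ?expR_gt0// expRK -!expRD; congr expR.
rewrite /lam /bq /cq /theta /gt; field; exact: g_neq0.
Qed.

Let B_meas u : 0 <= u -> measurable_fun setT (B u).
Proof. by move=> u0; exact: (Fmeasurable_meas Fi_filt (B_Fmeasurable BM u0)). Qed.

Lemma expmart_mean t u : 0 <= t -> rint P setT (expmart t u) /\ \int[P]_om expmart t u om = 1.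
Proof.
move=> t0; rewrite /expmart; set v := Num.max t u.
have tv : t <= v by rewrite le_max lexx.
have mN : measurable_fun setT (fun om => expR (gt p * kappa p * (B v om - B t om)
        - (gt p * kappa p) ^+ 2 / 2 * (v - t))).
  apply: measurableT_comp => //; apply: measurable_funB => //; apply: measurable_funM => //.
  by apply: measurable_funB; apply: B_meas => //; exact: le_trans tv.
suff E1 : (\int[P]_om (expR (gt p * kappa p * (B v om - B t om)
        - (gt p * kappa p) ^+ 2 / 2 * (v - t)))%:E = 1)%E.
  split; last by rewrite /Rintegral E1.
  by apply: rint_ge0_lty => //; rewrite E1 ltry.
move: tv; rewrite le_eqVlt => /orP[/eqP <-|tv].
  under eq_integral do rewrite !subrr !mulr0 subrr expR0.
  exact: integral_probability_cst.
have z0 : - ((gt p * kappa p) ^+ 2 / 2 * (v - t)) + (gt p * kappa p) ^+ 2 * (v - t) / 2 = 0.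
  by field.
have := @increment_integral _ _ _ P Fi B Fi_filt BM _ R (cst 0) t v
  (fun z => (expR (gt p * kappa p * z.2 - (gt p * kappa p) ^+ 2 / 2 * (v - t)))%:E) t0 tv.
move=> ->.
- under eq_integral => om _.
    under eq_integral => y _ do rewrite /= expRD EFinM muleC.
    rewrite ge0_integralZl//; last first.
      by apply/measurable_EFinP; apply: measurableT_comp => //; exact: measurable_funM.
    rewrite normal_mgf ?sqrtr_gt0 ?subr_gt0// sqr_sqrtr ?subr_ge0 ?(ltW tv)// -EFinM -expRD.
    rewrite z0 expR0.
    over.
  exact: integral_probability_cst.
- by move=> U mU; rewrite preimage_cst; case: ifPn => _; [exact: (FiT Fi_filt)|exact: (Fi0 Fi_filt)].
- apply/measurable_EFinP; apply: measurableT_comp => //; apply: measurable_funB => //.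
  by apply: measurable_funM.
- by move=> z; rewrite lee_fin expR_ge0.
Qed.

Lemma expmart_continuous t om : 0 <= t -> continuous (fun u => expmart t u om).
Proof.
move=> t0; have cB := BM_max_continuous BM (w := om) t0.
have cm := @max_continuous R t.
have c1 : continuous (fun u => gt p * kappa p * (B (Num.max t u) om - B t om)).
  by move=> u; apply: cvgM; [exact: cvg_cst|apply: cvgB; [exact: cB|exact: cvg_cst]].
have c2 : continuous (fun u => (gt p * kappa p) ^+ 2 / 2 * (Num.max t u - t)).
  by move=> u; apply: cvgM; [exact: cvg_cst|apply: cvgB; [exact: cm|exact: cvg_cst]].
move=> u; apply: (@cvg_comp _ _ _ _ expR); last exact: continuous_expR.
by apply: cvgB; [exact: c1|exact: c2].
Qed.

Lemma expmart_joint t : 0 <= t -> measurable_fun setT (fun z : R * Om => expmart t z.1 z.2).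
Proof.
move=> t0; apply: (measurable_fun_joint_continuous (X := expmart t)).
  by move=> u; exact: rint_measurable (expmart_mean u t0).1.
by move=> om; exact: expmart_continuous.
Qed.

Definition F2 (s : R) : R := tail k2 T s.

Lemma tildeVE t y : 0 <= t <= T -> 0 < y ->
  tildeV p P B t y = (F2 t * expR (- lam * t) * y `^ (- gt p))%:E.
Proof.
move=> /andP[t0 tT] y0; rewrite /tildeV.
pose k u := y `^ (- gt p) * expR (- lam * t) * k2 u.
have ck : continuous k by move=> u; apply: cvgM; [exact: cvg_cst|exact: k2_continuous].
have E om : (\int[lebesgue_measure]_(u in `[t, T]) ((expR (- p_rho p * (u - t)))%:E *
      hatV p (U2 p) u (Yproc p B t y u om)) =
    \int[lebesgue_measure]_(u in `[t, T]) (k u * expmart t u om)%:E)%E.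
  apply: eq_integral => u; rewrite inE /= in_itv/= => /andP[tu uT].
  have uT' : 0 <= u <= T by rewrite uT (le_trans t0 tu).
  rewrite hatV2E//; last exact: Yproc_gt0.
  rewrite -EFinM; congr EFin; rewrite mulrCA [X in _ * X = _]mulrA Yproc_pow//.
  rewrite /k /k2 /k1 clT_id// (_ : lam * (u - t) = - lam * t + lam * u); last by ring.
  rewrite expRD; ring.
under eq_integral do rewrite E.
have [_ ->] := @Fubini_weighted _ _ _ P k (expmart t) t T 1 tT ck (expmart_joint t0)
  (fun u om => expR_ge0 _) (fun u _ => expmart_mean u t0).
congr EFin; rewrite mulr1 /k RintegralZl//; last first.
  by apply: rint_continuous; exact: k2_continuous.
by rewrite /F2 /tail; ring.
Qed.

Variable Q : probability Om R.
Hypothesis HQ : forall f : Om -> \bar R, measurable_fun setT f -> (forall w, 0 <= f w)%E ->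
  (\int[Q]_w f w = \int[P]_w (f w * (dens B cq T1 w)%:E))%E.

Lemma tE_integral (X : Om -> \bar R) : measurable_fun setT X ->
  tE p P B X = (\int[Q]_om X om)%E.
Proof.
move=> mX; rewrite /tE -[calE p B T1]/(dens B cq T1) integralE [RHS]integralE.
have c0 om : (0 <= (dens B cq T1 om)%:E)%E by rewrite lee_fin expR_ge0.
congr (_ - _)%E.
- rewrite HQ; last 2 first.
  + exact: measurable_funepos.
  + by [].
  apply: eq_integral => om _; rewrite !funeposE [RHS]muleC maxe_pMr// mule0.
  by rewrite muleC.
- rewrite HQ; last 2 first.
  + exact: measurable_funeneg.
  + by [].
  apply: eq_integral => om _; rewrite !funenegE [RHS]muleC maxe_pMr// mule0.
  by rewrite muleN muleC.
Qed.

Definition Wp (s : R) : R := tail wM T1 s.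
Definition Fp (s : R) : R := tail fM T1 s.

Lemma WpE s : s <= T1 -> Wp s = (expR (th * T1) - expR (th * s)) / th.
Proof.
rewrite le_eqVlt => /orP[/eqP ->|sT]; first by rewrite /Wp tail_TT subrr mul0r.
pose E (u : R) : R := th^-1 * expR (th * u).
have th0 : th != 0 by rewrite lt_eqF.
have d1 (u : R) : is_derive u (1 : R) (fun v : R => th * v) th.
  by apply: is_derive_eq; rewrite [_ *: _]mulr1.
have d2 (u : R) : is_derive u (1 : R) (fun v : R => expR (th * v)) (expR (th * u) * th).
  exact: (@is_derive1_comp R expR (fun v => th * v) u _ _ (is_derive_expR (th * u)) (d1 u)).
have dE (u : R) : is_derive u (1 : R) E (wM u).
  by apply: is_derive_eq; rewrite [_ *: _]mulrC mulfK.
rewrite /Wp /tail /Rintegral (@continuous_FTC2 _ wM E s T1 sT).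
- by rewrite /= /E -mulrBr mulrC.
- exact: continuous_subspaceT wM_continuous.
- split; first by move=> u _; exact: ex_derive.
  + apply: cvg_at_right_filter; apply: cvgM; [exact: cvg_cst|exact: expRM_continuous].
  + apply: cvg_at_left_filter; apply: cvgM; [exact: cvg_cst|exact: expRM_continuous].
- by move=> u _; rewrite derive1E; exact: derive_val.
Qed.

Lemma qfE s : s <= T1 -> qf p s = expR (- (th * s)) * Wp s.
Proof.
move=> sT; rewrite WpE// /qf mulrBr mulrA; congr (_ / _).
rewrite mulrBr -!expRD; congr (expR _ - _); first by ring.
by rewrite addNr expR0.
Qed.

(** Trades the dual value from [s] on for the running utility up to [T1], a constant, and the excess
    [Fp]; after taking means, the contribution of [Fp] is the one that depends on the stopping
    time. *)
Lemma F2_split s : 0 <= s <= T1 -> F2 s = Fp s + tail k1 T1 s + F2 T1.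
Proof.
move=> /andP[s0 sT]; have := tailB k2_continuous sT (ltW T1_lt); rewrite -!/(F2 _) => /eqP.
rewrite subr_eq => /eqP ->; congr (_ + _); rewrite /Fp /tail -RintegralD//.
- by apply: eq_Rintegral => u _; rewrite /fM subrK.
- by apply: rint_continuous; exact: fM_continuous.
- by apply: rint_continuous; exact: k1_continuous.
Qed.

Let M := gbm B cq bq.
Let M_meas h : measurable_fun setT (M h). Proof. exact: measurable_gbm Fi_filt BM cq bq h. Qed.
Let M_gt0 h om : 0 < M h om. Proof. exact: gbm_gt0. Qed.
Let M_0 om : M 0 om = 1. Proof. exact: gbm0 BM cq bq om. Qed.
Let M_mom := gbm_moments Fi_filt BM bq HQ.
Let M_sg := gbm_semigroup Fi_filt BM bq HQ.
Let M_cont om : continuous (M ^~ om). Proof. exact: gbm_continuous BM cq bq om. Qed.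
Let M_adapted := gbm_adapted BM cq bq.
Let M_indep := gbm_indep Fi_filt BM bq HQ.

Lemma W_lip_exists a b : 0 <= a -> a <= b -> b <= T1 -> 0 <= Wp a - Wp b <= 1 * (b - a).
Proof.
move=> a0 ab bT; apply: tail_bound => //; first exact: wM_continuous.
move=> u /andP[au ub]; rewrite expR_ge0 /= -expR0 ler_expR.
by rewrite mulr_le0_ge0 ?(ltW th_lt0)// (le_trans a0).
Qed.

Lemma F_lip_exists : exists2 CF, 0 <= CF &
  forall a b, 0 <= a -> a <= b -> b <= T1 -> 0 <= Fp a - Fp b <= CF * (b - a).
Proof.
have [C C0 HC] := continuous_bounded fM_continuous (ltW T1_gt0); exists C => //.
move=> a b a0 ab bT; apply: tail_bound => //; first exact: fM_continuous.
move=> u /andP[au ub].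
have uT : 0 <= u <= T1 by rewrite (le_trans a0 au) (le_trans ub bT).
by rewrite ltW ?fM_gt0//= (le_trans (ler_norm _))// HC.
Qed.

Lemma WF_slope_model t e : 0 <= t <= T1 -> 0 < e -> exists2 eta : R, 0 < eta &
   forall a b, 0 <= a -> a <= b -> b <= T1 -> `|a - t| < eta -> `|b - t| < eta ->
     `|Wp a - Wp b - wM t * (b - a)| <= e * (b - a) /\
     `|Fp a - Fp b - fM t * (b - a)| <= e * (b - a).
Proof.
move=> _ e0; have [e1 e10 H1] := tail_slope T1 t wM_continuous e0.
have [e2 e20 H2] := tail_slope T1 t fM_continuous e0.
exists (Num.min e1 e2); first by rewrite lt_min e10.
move=> a b _ ab bT; rewrite !lt_min => /andP[a1 a2] /andP[b1 b2].
by split; [exact: H1|exact: H2].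
Qed.

(** * The reduced problem in the martingale coordinate *)

Section starting_point.
Variables (t z : R).
Hypotheses (t_ge0 : 0 <= t) (t_leT1 : t <= T1) (z_gt0 : 0 < z).

(** The starting point in the coordinate in which the process is a martingale; the exponential
    compensates the growth rate [lam - th] of the power of [Zproc]. *)
Definition xhat : R := z `^ (- gt p) * expR ((th - lam) * t).

Lemma xhat_gt0 : 0 < xhat.
Proof. by rewrite mulr_gt0 ?powR_gt0 ?expR_gt0. Qed.

Let X := Xp M t xhat.

Lemma Zproc_Xp u om : t <= u ->
  expR (th * u) * Zproc p B t z u om `^ (- gt p) = expR (lam * u) * X u om.
Proof.
move=> tu; rewrite Zproc_pow// /X /Xp /xhat.
have e1 : expR (th * u) * expR ((lam - th) * (u - t)) = expR (lam * u) * expR ((th - lam) * t).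
  by rewrite -!expRD; congr expR; ring.
rewrite -/M; move: (M u om / M t om) => m.
transitivity (z `^ (- gt p) * (expR (th * u) * expR ((lam - th) * (u - t))) * m); first by ring.
by rewrite e1; ring.
Qed.

Let X_cont om : continuous (fun u => X u om).
Proof.
move=> u; apply: cvgM; first exact: cvg_cst.
by apply: cvgM; [exact: M_cont|exact: cvg_cst].
Qed.

Let X_ge0 u om : 0 <= X u om.
Proof. by rewrite mulr_ge0 ?(ltW xhat_gt0)// divr_ge0 ?ltW. Qed.

Section objective.
Variable tau : Om -> R.
Hypothesis (tau_adm : admissible p Fi t tau).

Let tau_stop : is_stopping_time Fi tau. Proof. by case: tau_adm. Qed.
Let tau_bd om : t <= tau om <= T1. Proof. by case: tau_adm => _; exact. Qed.
Let mtau_ : measurable_fun setT tau. Proof. exact: (mtau Fi_filt t_leT1 tau_stop tau_bd). Qed.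

Let N (u : R) (om : Om) : R := X (Num.min u (tau om)) om.

(** Running utility continued up to [T1] with the process frozen after [tau]. By optional stopping
    at [Num.min u (tau om)] its mean does not depend on [tau]. *)
Definition running (om : Om) : R := \int[mu]_(u in `[t, T1]) (k1 u * N u om).

Let kN_cont om : continuous (fun u => k1 u * N u om).
Proof.
have cm : continuous (fun u : R => Num.min u (tau om)).
  apply: (@lip_continuous _ 1) => u v; rewrite mul1r /Num.min.
  case: (ltP u (tau om)) => h3; case: (ltP v (tau om)) => h4; rewrite ?subrr ?normr0//.
  - by rewrite distrC [X in _ <= X]distrC !ger0_norm ?subr_ge0; lra.
  - by rewrite !ger0_norm ?subr_ge0; lra.
move=> u; apply: cvgM; first exact: k1_continuous.
exact: cvg_comp (@cm u) (@X_cont om _).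
Qed.

Lemma runningE om : running om =
  \int[mu]_(u in `[t, tau om]) (k1 u * X u om) + tail k1 T1 (tau om) * X (tau om) om.
Proof.
have /andP[h1 h2] := tau_bd om.
rewrite /running (Rintegral_itv_cat h1 h2); last by apply: rint_continuous; exact: kN_cont.
have e1 : \int[mu]_(u in `[t, tau om]) (k1 u * N u om) =
    \int[mu]_(u in `[t, tau om]) (k1 u * X u om).
  apply: eq_Rintegral => u; rewrite inE /= in_itv/= => /andP[_ ut].
  by rewrite /N (min_idPl ut).
have e2 : \int[mu]_(u in `[tau om, T1]) (k1 u * N u om) = tail k1 T1 (tau om) * X (tau om) om.
  transitivity (\int[mu]_(u in `[tau om, T1]) (k1 u * X (tau om) om)).
    apply: eq_Rintegral => u; rewrite inE /= in_itv/= => /andP[ut _].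
    by rewrite /N (min_idPr ut).
  apply: RintegralZr; first exact: measurable_itv.
  by apply: rint_continuous; exact: k1_continuous.
by rewrite e1 e2.
Qed.

Lemma payoffE om :
  ((\int[lebesgue_measure]_(u in `[t, tau om])
      ((expR (th * (u - t)))%:E * hatV p (U1 p) u (Zproc p B t z u om))
   + (expR (th * (tau om - t)))%:E *
       (tildeV p P B (tau om) (Zproc p B t z (tau om) om) - (qf p (tau om))%:E))%E =
  (expR (- th * t) * (running om + F2 T1 * X (tau om) om +
     (Fp (tau om) * X (tau om) om - Wp (tau om))))%:E)%E.
Proof.
have /andP[h1 h2] := tau_bd om; have tau0 := le_trans t_ge0 h1.
have eE u : expR (th * (u - t)) = expR (- th * t) * expR (th * u).
  by rewrite -expRD; congr expR; ring.
have -> : (\int[lebesgue_measure]_(u in `[t, tau om])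
      ((expR (th * (u - t)))%:E * hatV p (U1 p) u (Zproc p B t z u om)) =
    (expR (- th * t) * \int[mu]_(u in `[t, tau om]) (k1 u * X u om))%:E)%E.
  have ck : continuous (fun u => k1 u * X u om).
    by move=> u; apply: cvgM; [exact: k1_continuous|exact: X_cont].
  have ick : rint mu `[t, tau om] (fun u => k1 u * X u om) by exact: rint_continuous.
  rewrite -RintegralZl// -EFin_Rintegral//; last exact: rintZ.
  apply: eq_integral => u; rewrite inE /= in_itv/= => /andP[tu ut].
  have uT : 0 <= u <= T by apply: T1_T; rewrite (le_trans t_ge0 tu) (le_trans ut h2).
  rewrite hatV1E; last exact: Zproc_gt0.
  rewrite -EFinM; congr EFin; rewrite eE -[LHS]mulrA; congr (_ * _).
  by rewrite [LHS]mulrA Zproc_Xp// /k1 clT_id//; ring.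
have T1T : 0 <= tau om <= T by apply: T1_T; rewrite tau0.
rewrite tildeVE//; last exact: Zproc_gt0.
rewrite -EFinB -EFinM -EFinD; congr EFin; rewrite eE.
rewrite qfE//.
have -> : expR (- th * t) * expR (th * tau om) *
    (F2 (tau om) * expR (- lam * tau om) * Zproc p B t z (tau om) om `^ (- gt p) -
     expR (- (th * tau om)) * Wp (tau om)) = expR (- th * t) *
    (F2 (tau om) * expR (- lam * tau om) *
       (expR (th * tau om) * Zproc p B t z (tau om) om `^ (- gt p)) -
      (expR (th * tau om) * expR (- (th * tau om))) * Wp (tau om)) by ring.
rewrite Zproc_Xp// -expRD subrr expR0 mul1r.
have -> : F2 (tau om) * expR (- lam * tau om) * (expR (lam * tau om) * X (tau om) om) =
    F2 (tau om) * X (tau om) om.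
  have ee : expR (- lam * tau om) * expR (lam * tau om) = 1 by rewrite -expRD mulNr addNr expR0.
  by rewrite -[LHS]mulrA [expR (- lam * _) * _]mulrA ee mul1r.
rewrite (F2_split (s := tau om)) ?tau0// runningE; ring.
Qed.

Let N_meas : measurable_fun setT (fun w : R * Om => N w.1 w.2).
Proof.
have mJ : measurable_fun setT (fun w : R * Om => M w.1 w.2).
  by apply: (measurable_fun_joint_continuous (X := M)); [exact: M_meas|exact: M_cont].
have mm : measurable_fun setT (fun w : R * Om => (Num.min w.1 (tau w.2), w.2)).
  apply: measurable_fun_pair => //; apply: measurable_minr => //.
  exact: measurableT_comp mtau_ measurable_snd.
rewrite /N /X /Xp; apply: measurable_funM => //; apply: measurable_funM.
  exact: measurableT_comp mJ mm.
have mt : measurable_fun setT (fun om => (M t om)^-1).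
  have -> : (fun om => (M t om)^-1) = (fun om => M t om `^ (-1)).
    by apply/funext => om; rewrite powR_inv1// ltW.
  by apply: (measurableT_comp (measurable_powR (-1))); exact: M_meas.
exact: measurableT_comp mt measurable_snd.
Qed.

Let N_mean u : t <= u <= T1 -> rint Q setT (N u) /\ \int[Q]_om N u om = xhat.
Proof.
move=> /andP[tu uT].
have st : is_stopping_time Fi (fun om => Num.min u (tau om)).
  move=> r; have [ur|ru] := leP u r.
    rewrite (_ : [set _ | _] = setT); first exact: FiT.
    by apply/seteqP; split => om //= _; rewrite ge_min ur.
  rewrite (_ : [set _ | _] = [set om | tau om <= r]); first exact: tau_stop.
  by apply/seteqP; split => om /=; rewrite ge_min leNgt ru.
have bd om : t <= Num.min u (tau om) <= T1.
  by have /andP[h1 h2] := tau_bd om; rewrite le_min tu h1 ge_min uT.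
exact: (optional_stopping (sqr_ge0 bq) M_meas M_gt0 M_mom Fi_filt M_adapted M_cont M_indep
  t_ge0 t_leT1 (ltW xhat_gt0) st bd).
Qed.

Lemma running_mean : rint Q setT running /\
  \int[Q]_om running om = tail k1 T1 t * xhat.
Proof.
have [i1 e1] := Fubini_weighted t_leT1 k1_continuous N_meas
  (fun u om => X_ge0 (Num.min u (tau om)) om) N_mean.
have E om : (\int[lebesgue_measure]_(u in `[t, T1]) (k1 u * N u om)%:E)%E = (running om)%:E.
  by rewrite EFin_Rintegral//; apply: rint_continuous; exact: kN_cont.
have i2 : rint Q setT running.
  by apply: eq_integrable i1 => // om _; rewrite E.
split=> //; apply: EFin_inj; rewrite -EFin_Rintegral// -e1.
by apply: eq_integral => om _; rewrite E.
Qed.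

End objective.

Let Gp := G Q M T1 Wp Fp.

Lemma stopped_value tau : admissible p Fi t tau ->
  [/\ rint Q setT (fun om => Fp (tau om) * X (tau om) om), rint Q setT (fun om => Wp (tau om)) &
   \int[Q]_om (Fp (tau om) * X (tau om) om - Wp (tau om)) <= Gp t xhat + (Fp t * xhat - Wp t)].
Proof.
move=> [tau_stop tau_bd]; have [CF CF0 F_lip] := F_lip_exists.
have [i1 [i2 le]] := value_le M_meas M_gt0 M_mom M_sg T1_gt0 W_lip_exists F_lip
  (tail_TT wM T1) (tail_TT fM T1) CF0 ler01 Fi_filt M_adapted M_cont M_indep
  t_ge0 t_leT1 (ltW xhat_gt0) tau_stop tau_bd.
by split.
Qed.

Lemma objective_mean tau : admissible p Fi t tau ->
  tE p P B (fun om =>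
      (\int[lebesgue_measure]_(u in `[t, tau om])
          ((expR (th * (u - t)))%:E * hatV p (U1 p) u (Zproc p B t z u om))
       + (expR (th * (tau om - t)))%:E *
           (tildeV p P B (tau om) (Zproc p B t z (tau om) om) - (qf p (tau om))%:E))%E) =
  (expR (- th * t) * (tail k1 T1 t * xhat + F2 T1 * xhat +
    \int[Q]_om (Fp (tau om) * X (tau om) om - Wp (tau om))))%:E.
Proof.
move=> adm; have [i1 i2 _] := stopped_value adm.
have [i3 e3] := running_mean adm.
have [i4 e4] : rint Q setT (fun om => X (tau om) om) /\ \int[Q]_om X (tau om) om = xhat.
  case: adm => st bd.
  exact: (optional_stopping (sqr_ge0 bq) M_meas M_gt0 M_mom Fi_filt M_adapted M_cont M_indep
    t_ge0 t_leT1 (ltW xhat_gt0) st bd).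
rewrite (funext (payoffE adm)).
have i5 : rint Q setT (fun om => F2 T1 * X (tau om) om) by exact: rintZ.
have i6 : rint Q setT (fun om => running tau om + F2 T1 * X (tau om) om) by exact: rintD.
have i7 : rint Q setT (fun om => Fp (tau om) * X (tau om) om - Wp (tau om)) by exact: rintB.
have i8 := rintD measurableT i6 i7.
rewrite tE_integral; last first.
  by apply/measurable_EFinP; apply: measurable_funM => //; exact: rint_measurable i8.
rewrite EFin_Rintegral//; last exact: rintZ.
rewrite RintegralZl// RintegralD// RintegralD// RintegralZl// e3 e4 //.
Qed.

Lemma stop_now : (tildeV p P B t z - (qf p t)%:E =
  (expR (- th * t) * (tail k1 T1 t * xhat + F2 T1 * xhat + (Fp t * xhat - Wp t)))%:E)%E.
Proof.
have tT : 0 <= t <= T by apply: T1_T; rewrite t_ge0.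
rewrite tildeVE// -EFinB; congr EFin.
have xE : expR (- th * t) * xhat = expR (- lam * t) * z `^ (- gt p).
  rewrite /xhat mulrCA -expRD mulrC; congr (expR _ * _); ring.
have te : - (th * t) = - th * t by rewrite mulNr.
rewrite qfE// te -[F2 t * _ * _]mulrA -xE.
rewrite (F2_split (s := t)) ?t_ge0//; ring.
Qed.

(** The terms independent of the stopping time cancel, which leaves the comparison of [Fp * X - Wp]
    with its immediate value: [stopped_value] gives one direction, [G_gt0_stopping] the other. *)
Lemma inC_iff : t < T1 -> inC p P Fi B t z <-> 0 < Gp t xhat.
Proof.
move=> tT; have e0 : 0 < expR (- th * t) by exact: expR_gt0.
rewrite /inC stop_now; split.
  move=> [_ _ _ /ereal_sup_gt[v [tau [adm ->]]]].
  rewrite objective_mean// lte_fin ltr_pM2l// ltrD2l => lt1.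
  have [_ _ le1] := stopped_value adm.
  by rewrite -(ltrD2r (Fp t * xhat - Wp t)) add0r (lt_le_trans lt1).
move=> G0; split => //; have [CF CF0 F_lip] := F_lip_exists.
have [tau [st bd lt1]] := G_gt0_stopping M_meas M_gt0 M_mom M_sg T1_gt0 W_lip_exists F_lip
  (tail_TT wM T1) (tail_TT fM T1) CF0 ler01 Fi_filt M_adapted M_cont M_indep
  t_ge0 t_leT1 (ltW xhat_gt0) G0.
have adm : admissible p Fi t tau by split.
apply: (@lt_le_trans _ _ (expR (- th * t) * (tail k1 T1 t * xhat + F2 T1 * xhat +
    \int[Q]_om (Fp (tau om) * X (tau om) om - Wp (tau om))))%:E).
  by rewrite lte_fin ltr_pM2l// ltrD2l.
by apply: ereal_sup_ubound; exists tau; split => //; rewrite objective_mean.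
Qed.

End starting_point.

Lemma Xp_xhat t z u om : 0 <= t -> t <= u -> 0 < z ->
  Xp M t (xhat t z) u om = xhat u (Zproc p B t z u om).
Proof.
move=> t0 tu z0; have e := Zproc_Xp t0 z0 om tu.
have e0 : expR (lam * u) != 0 by rewrite gt_eqF ?expR_gt0.
apply: (mulfI e0); rewrite -e /xhat mulrCA -expRD mulrC; congr (_ * expR _); ring.
Qed.

(** * The free boundary *)

Variable zstar : R -> R.
Hypothesis zstarP : forall t, 0 <= t < T1 -> 0 < zstar t /\
  forall z, 0 < z -> (inC p P Fi B t z <-> (if g < 1 then zstar t < z else z < zstar t)).

Notation GP := (G Q M T1 Wp Fp).

Lemma GP_ge0 t x : 0 <= t -> t <= T1 -> 0 <= GP t x.
Proof.
move=> t0 tT; have [CF CF0 F_lip] := F_lip_exists.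
exact: (G_ge0 M_meas M_gt0 M_mom W_lip_exists F_lip (tail_TT wM T1) (tail_TT fM T1) x t0 tT).
Qed.

Lemma GP_zstar t : 0 <= t < T1 -> GP t (xhat t (zstar t)) = 0.
Proof.
move=> /andP[t0 tT]; have tT' : 0 <= t < T1 by rewrite t0.
have [z0 zP] := zstarP tT'; apply/eqP; rewrite eq_le GP_ge0 ?(ltW tT)// andbT leNgt.
apply/negP => /(inC_iff t0 (ltW tT) z0 tT) /(zP _ z0).
by rewrite ltxx; case: ifP.
Qed.

Definition boundary_integrand (t z u : R) (om : Om) : R :=
  expR (th * (u - t)) * (1 + Delta p u * (muT p u * Zproc p B t z u om) `^ (- gt p)) *
  (if g < 1 then zstar u < Zproc p B t z u om else Zproc p B t z u om < zstar u)%:R.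

(** Restricted to [u < T1], because the value of [zstar] at [T1] is arbitrary. *)
Lemma boundary_integrandE t z u om : 0 <= t -> t <= u -> u < T1 -> 0 < z ->
  boundary_integrand t z u om =
  expR (- th * t) * jump Q M T1 Wp Fp wM fM t (xhat t z) u om.
Proof.
move=> t0 tu uT z0; have u0 := le_trans t0 tu.
have uT' : 0 <= u < T1 by rewrite u0.
have Z0 := Zproc_gt0 t u om z0.
have [_ zP] := zstarP uT'; have {}zP := zP _ Z0.
have b : (0 < GP u (Xp M t (xhat t z) u om)) =
    (if g < 1 then zstar u < Zproc p B t z u om else Zproc p B t z u om < zstar u).
  rewrite (Xp_xhat om t0 tu z0); apply/idP/idP.
  - by move=> h; apply/zP; apply/(inC_iff u0 (ltW uT) Z0 uT).
  - by move=> h; apply/(inC_iff u0 (ltW uT) Z0 uT); apply/zP.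
rewrite /boundary_integrand /jump b mulrA; congr (_ * _).
have uTT : 0 <= u <= T by apply: T1_T; rewrite u0 ltW.
rewrite fME// powRM ?ltW ?muT_gt0// /wM.
have -> : expR (th * (u - t)) = expR (- th * t) * expR (th * u).
  by rewrite -expRD; congr expR; ring.
have e := Zproc_Xp t0 z0 om tu.
rewrite -mulrA; congr (_ * _).
transitivity (expR (th * u) + Delta p u * muT p u `^ (- gt p) *
  (expR (th * u) * Zproc p B t z u om `^ (- gt p))); first by ring.
by rewrite e; ring.
Qed.

Lemma boundary_identity t : 0 <= t < T1 ->
  tE p P B (fun om => \int[lebesgue_measure]_(u in `[t, T1])
    (boundary_integrand t (zstar t) u om)%:E)%E = 0%E.
Proof.
move=> tT'; have [z0 _] := zstarP tT'; have G0 := GP_zstar tT'.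
have /andP[t0 tT] := tT'; have tTle := ltW tT.
set x := xhat t (zstar t) in G0.
have x0 : 0 < x := xhat_gt0 t z0.
have [CF CF0 F_lip] := F_lip_exists.
have mJ : measurable_fun setT (fun w : R * Om =>
    jump Q M T1 Wp Fp wM fM t x (clampT T1 t w.1) w.2).
  exact: (jump_joint_measurable (sqr_ge0 bq) M_meas M_gt0 M_0 M_mom M_sg T1_gt0 W_lip_exists
    F_lip (tail_TT wM T1) (tail_TT fM T1) CF0 ler01 M_cont t0 tTle (ltW x0)
    wM_continuous fM_continuous).
have [iJ eJ] := representation (sqr_ge0 bq) M_meas M_gt0 M_0 M_mom M_sg T1_gt0 W_lip_exists F_lip
  (tail_TT wM T1) (tail_TT fM T1) CF0 ler01 fM_gt0 WF_slope_model Fi_filt M_adapted M_cont M_indep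
  t0 tTle (ltW x0) (gbm_atom Fi_filt BM T1_gt0 HQ) (gbm_det B cq (b := bq))
  wM_continuous fM_continuous x0 G0.
have E om : (\int[lebesgue_measure]_(u in `[t, T1]) (boundary_integrand t (zstar t) u om)%:E =
    (expR (- th * t))%:E *
    \int[lebesgue_measure]_(u in `[t, T1]) (jump Q M T1 Wp Fp wM fM t x u om)%:E)%E.
  (* All comparisons are made on the open interval, which leaves out [T1]. *)
  have mj : measurable_fun `]t, T1[ (fun u => jump Q M T1 Wp Fp wM fM t x u om).
    have h := measurableT_comp mJ (measurable_fun_pair (@measurable_id _ R setT) (measurable_cst om)).
    have := measurable_funTS (D := `]t, T1[) h.
    apply: eq_measurable_fun => u; rewrite inE /= in_itv/= => /andP[tu uT].
    by rewrite clampT_id ?ltW.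
  have mb : measurable_fun `]t, T1[ (fun u => boundary_integrand t (zstar t) u om).
    have := measurable_funM (measurable_cst (expR (- th * t))) mj.
    apply: eq_measurable_fun => u; rewrite inE /= in_itv/= => /andP[tu uT].
    by rewrite (boundary_integrandE om t0 (ltW tu) uT z0).
  have mab : measurable (`]t, T1[%classic : set R) by exact: measurable_itv.
  have cw : continuous (fun u => wM u - fM u * Xp M t x u om).
    move=> u; apply: cvgB; first exact: wM_continuous.
    apply: cvgM; first exact: fM_continuous.
    by apply: cvgM; [exact: cvg_cst|apply: cvgM; [exact: M_cont|exact: cvg_cst]].
  have ij : rint mu `]t, T1[ (fun u => jump Q M T1 Wp Fp wM fM t x u om).
    apply: (@rint_le _ _ _ mu _ _ (fun u => `|wM u - fM u * Xp M t x u om|)) => //.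
      move=> u _; rewrite /jump normrM -[leRHS]mulr1 ler_wpM2l//.
      by case: (_ < _); rewrite ?normr1 ?normr0.
    apply: (@integrableS _ _ _ mu `[t, T1]) => //; first exact: subset_itv_oo_cc.
    by apply: rint_norm => //; exact: rint_continuous.
  transitivity (\int[mu]_(u in `]t, T1[) (boundary_integrand t (zstar t) u om)%:E)%E.
    by apply: (@integral_itv_bndoo _ t T1 _ true false); apply/measurable_EFinP.
  transitivity ((expR (- th * t))%:E *
      \int[mu]_(u in `]t, T1[) (jump Q M T1 Wp Fp wM fM t x u om)%:E)%E; last first.
    congr (_ * _)%E; apply/esym; apply: (@integral_itv_bndoo _ t T1 _ true false).
    exact/measurable_EFinP.
  rewrite -(@integralZl _ _ _ mu _ mab _ ij).
  apply: eq_integral => u; rewrite inE /= in_itv/= => /andP[tu uT].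
  by rewrite (boundary_integrandE om t0 (ltW tu) uT z0).
rewrite (funext E) tE_integral; last first.
  by apply: measurable_funeM; exact: measurable_int iJ.
by rewrite integralZl// eJ mule0.
Qed.

Definition xstar (t : R) : R := xhat t (zstar t).

Let neg_gt_lt (a b : R) : 0 < a -> 0 < b ->
  (a `^ (- gt p) < b `^ (- gt p)) = (if g < 1 then b < a else a < b).
Proof.
move=> a0 b0; rewrite /powR !gt_eqF// ltr_expR !mulNr ltrN2.
case: (ltgtP g 1) g_neq1 => // h _.
- by rewrite ltr_pM2l ?ltr_ln// divr_gt0// subr_gt0.
- rewrite ltr_nM2l ?ltr_ln// pmulr_llt0 ?invr_gt0// subr_lt0 //.
Qed.

Definition zhat (t x : R) : R := (x * expR ((lam - th) * t)) `^ (- (1 / gt p)).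

Lemma zhat_gt0 t x : 0 < x -> 0 < zhat t x.
Proof. by move=> x0; rewrite powR_gt0// mulr_gt0 ?expR_gt0. Qed.

Lemma xhatK t z : 0 < z -> zhat t (xhat t z) = z.
Proof.
move=> z0; rewrite /zhat /xhat -mulrA -expRD (_ : _ + _ = 0); last by ring.
rewrite expR0 mulr1 -powRrM (_ : _ * _ = 1) ?powRr1 ?ltW//.
by field; exact: gt_neq0.
Qed.

Lemma zhatK t x : 0 < x -> xhat t (zhat t x) = x.
Proof.
move=> x0; rewrite /zhat /xhat -powRrM (_ : - (1 / gt p) * _ = 1); last by field; exact: gt_neq0.
rewrite powRr1 ?mulr_ge0 ?expR_ge0 ?ltW// -mulrA -expRD (_ : _ + _ = 0); last by ring.
by rewrite expR0 mulr1.
Qed.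

(** [gt p] has the sign of [1 - g], so passing to the coordinate [x] turns both shapes of the
    continuation region into the part below [xstar]. *)
Lemma GP_gt0_iff t x : 0 <= t < T1 -> 0 < x -> 0 < GP t x <-> x < xstar t.
Proof.
move=> tT' x0; have /andP[t0 tT] := tT'; have [z0 zP] := zstarP tT'.
have zx := zhat_gt0 t x0; have {}zP := zP _ zx.
have E : (x < xstar t) = (if g < 1 then zstar t < zhat t x else zhat t x < zstar t).
  rewrite -{1}(zhatK t x0) /xstar /xhat ltr_pM2r ?expR_gt0// neg_gt_lt//.
have := inC_iff t0 (ltW tT) zx tT; rewrite zhatK// => I.
by rewrite E; split => [/I /zP|/zP /I].
Qed.

Lemma xstar_ge t : 0 <= t < T1 -> wM t / fM t <= xstar t.
Proof.
move=> tT'; have /andP[t0 tT] := tT'; have [z0 _] := zstarP tT'.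
have tTT : 0 <= t <= T1 by rewrite t0 ltW.
rewrite ler_pdivrMr ?fM_gt0// mulrC leNgt; apply/negP => lt.
have [CF CF0 F_lip] := F_lip_exists; have x0 := xhat_gt0 t z0.
have := G_gt0 M_meas M_gt0 M_mom W_lip_exists F_lip (tail_TT wM T1) (tail_TT fM T1)
  WF_slope_model t0 tT (ltW x0) lt.
by move/(GP_gt0_iff tT' x0); rewrite ltxx.
Qed.

Lemma xstar_le y : wM T1 / fM T1 < y -> exists2 eta : R, 0 < eta &
  forall t, 0 <= t < T1 -> T1 - t < eta -> xstar t <= y.
Proof.
move=> ly; have T1T : 0 <= T1 <= T1 by rewrite ltW/=.
have y0 : 0 < y by apply: lt_trans ly; rewrite divr_gt0 ?expR_gt0 ?fM_gt0.
have [CF CF0 F_lip] := F_lip_exists.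
have wy : wM T1 < fM T1 * y by move: ly; rewrite ltr_pdivrMr ?fM_gt0// mulrC.
have [eta eta0 H] := G_eq0_near_T1 (sqr_ge0 bq) M_meas M_gt0 M_mom M_sg T1_gt0 W_lip_exists F_lip
  (tail_TT wM T1) (tail_TT fM T1) ler01 (fun u _ => expR_gt0 (th * u)) fM_gt0 WF_slope_model
  (ltW y0) wy.
exists eta => // t tT' te; have /andP[t0 tT] := tT'.
rewrite leNgt; apply/negP => /(GP_gt0_iff tT' y0).
by rewrite (H t t0 (ltW tT) te) ltxx.
Qed.

(** Squeezed between the zero [wM t / fM t] of the reward rate, by [xstar_ge], and any level above
    its value at [T1], by [xstar_le]. *)
Lemma xstar_cvg : xstar t @[t --> T1^'-] --> wM T1 / fM T1.
Proof.
have T1T : 0 <= T1 <= T1 by rewrite ltW/=.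
have cwf : (fun t => wM t / fM t) @ T1 --> wM T1 / fM T1.
  apply: cvgM; first exact: wM_continuous.
  by apply: cvgV; [rewrite gt_eqF ?fM_gt0|exact: fM_continuous].
apply/cvgrPdist_le => e e0.
have [eta eta0 H] : exists2 eta : R, 0 < eta & forall t, 0 <= t < T1 -> T1 - t < eta ->
    xstar t <= wM T1 / fM T1 + e by apply: xstar_le; rewrite ltrDl.
have hwf : \forall t \near T1^'-, `|wM T1 / fM T1 - wM t / fM t| <= e.
  by move/cvgrPdist_le: (cvg_at_left_filter cwf) => /(_ _ e0).
near=> t.
have tT' : 0 <= t < T1.
  apply/andP; split; last by near: t; exact: nbhs_left_lt.
  by apply: ltW; near: t; exact: nbhs_left_gt.
have te : T1 - t < eta.
  rewrite ltrBlDr -ltrBlDl; near: t; apply: nbhs_left_gt.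
  by rewrite ltrBlDr ltrDl.
have h1 := H t tT' te; have h2 := xstar_ge tT'.
have h3 : `|wM T1 / fM T1 - wM t / fM t| <= e.
  by near: t; exact: hwf.
exact: dist_sandwich h1 h2 h3.
Unshelve. all: by end_near. Qed.

Lemma zstar_cvg : zstar t @[t --> T1^'-] --> (- Delta p T1) `^ (1 / gt p) / muT p T1.
Proof.
have T1T : 0 <= T1 <= T1 by rewrite ltW/=.
have L0 : 0 < wM T1 / fM T1 by rewrite divr_gt0 ?expR_gt0 ?fM_gt0.
have -> : (- Delta p T1) `^ (1 / gt p) / muT p T1 = zhat T1 (wM T1 / fM T1).
  have D0 : 0 < - Delta p T1 by rewrite oppr_gt0 Delta_lt0.
  have m0 := muT_gt0 T1; rewrite fME; last exact: T1_T.
  have DE : - Delta p T1 = expR (ln (- Delta p T1)) by rewrite lnK.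
  have mE : muT p T1 = expR (ln (muT p T1)) by rewrite lnK.
  rewrite /zhat /wM DE mE; move: (ln (- Delta p T1)) (ln (muT p T1)) => D m.
  rewrite /powR !gt_eqF ?mulr_gt0 ?divr_gt0 ?invr_gt0 ?mulr_gt0 ?expR_gt0//.
  rewrite !expRK -!expRD -!expRN -!expRD !expRK; congr expR; field; exact: gt_neq0.
have cz : (fun t => zhat t (xstar t)) @ T1^'- --> zhat T1 (wM T1 / fM T1).
  rewrite /zhat.
  have c1 : (fun t => xstar t * expR ((lam - th) * t)) @ T1^'- -->
      wM T1 / fM T1 * expR ((lam - th) * T1).
    apply: cvgM; first exact: xstar_cvg.
    by apply: cvg_at_left_filter; exact: expRM_continuous.
  have L1 : 0 < wM T1 / fM T1 * expR ((lam - th) * T1) by rewrite mulr_gt0 ?expR_gt0.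
  have cp : {for wM T1 / fM T1 * expR ((lam - th) * T1),
      continuous (fun v : R => v `^ (- (1 / gt p)))}.
    apply: differentiable_continuous; apply/derivable1_diffP.
    exact: (@ex_derive _ _ _ _ _ _ _ (is_derive1_powR (- (1 / gt p)) L1)).
  exact: cvg_comp c1 cp.
have E : {near T1^'-, (fun t => zhat t (xstar t)) =1 zstar}.
  near=> t; have tT' : 0 <= t < T1.
    apply/andP; split; last by near: t; exact: nbhs_left_lt.
    by apply: ltW; near: t; exact: nbhs_left_gt.
  by rewrite /xstar xhatK//; have [] := zstarP tT'.
by apply: cvg_trans cz; exact: near_eq_cvg.
Unshelve. all: by end_near. Qed.

End model.
Unset Implicit Arguments.

Theorem mainTheorem9 (d : measure_display) (Omega : measurableType d) (R : realType)
    (P : probability Omega R) (F : R -> set (set Omega)) (B : R -> Omega -> R)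
    (p : params R) (delta M : R) (zstar : R -> R) :
  is_filtration F -> usual_conditions P F -> is_brownian P F B ->
  0 < p_T1 p -> p_T1 p < p_T p ->
  0 < p_r p -> 0 < p_mu p -> 0 < p_sigma p -> 0 < p_rho p -> 0 < p_muw p ->
  0 < p_sigmaw p -> 0 < p_alpha p -> 0 < p_beta p ->
  theta p < 0 ->
  0 < p_gamma p -> p_gamma p != 1 ->
  (forall t, 0 <= t <= p_T p -> 0 < p_K p t) ->
  (forall (n : nat) (x : R), derivable (derive1n n (p_K p)) x 1) ->
  0 < delta -> delta <= M ->
  (forall t, 0 <= t <= p_T1 p -> - M <= Delta p t <= - delta) ->
  (forall t, 0 <= t < p_T1 p -> 0 < zstar t /\
     forall z, 0 < z ->
       (inC (Omega := Omega) p P F B t z <->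
        (if p_gamma p < 1 then zstar t < z else z < zstar t))) ->
  ((forall t, 0 <= t < p_T1 p ->
     tE p P B (fun om =>
       (\int[lebesgue_measure]_(u in `[t, p_T1 p])
         ((expR (theta p * (u - t)) *
           (1 + Delta p u * (muT p u * Zproc p B t (zstar t) u om) `^ (- gt p)) *
           (if p_gamma p < 1 then zstar u < Zproc p B t (zstar t) u om
            else Zproc p B t (zstar t) u om < zstar u)%:R)%:E))%E) = 0%E)) /\
  zstar t @[t --> (p_T1 p)^'-] --> ((- Delta p (p_T1 p)) `^ (1 / gt p) / muT p (p_T1 p)).
Proof.
move=> Fi_filt _ BM T1_gt0 T1_lt _ _ _ _ _ _ alpha_gt0 _ th_lt0 g_gt0 g_neq1 K_gt0 K_smooth
  delta_gt0 _ Delta_bd zstarP.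
have K_cont : continuous (p_K p).
  move=> t; apply: differentiable_continuous; apply/derivable1_diffP.
  exact: K_smooth 0%N t.
have Delta_lt0 t : 0 <= t <= p_T1 p -> Delta p t < 0.
  by move=> /Delta_bd /andP[_ h]; rewrite (le_lt_trans h)// oppr_lt0.
(* [calE] at [T1] is [dens] with drift [cq p], so [Q] is the measure behind [tE]. *)
have [Q HQ] := girsanov_exists Fi_filt BM (cq p) T1_gt0.
split; last first.
  exact: (zstar_cvg Fi_filt BM T1_gt0 T1_lt alpha_gt0 th_lt0 g_gt0 g_neq1 K_gt0 K_cont Delta_lt0
    HQ zstarP).
move=> t tT.
exact: (boundary_identity Fi_filt BM T1_gt0 T1_lt alpha_gt0 th_lt0 g_gt0 g_neq1 K_gt0 K_cont
  Delta_lt0 HQ zstarP tT).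
Qed.
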